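(* There exists $d\ge 9$ such that every $P_5$-free graph $G$ with $\omega(G)\ge 2$ contains either: (i) a complete pair $(X,Y)$ with $\rho(X)\ge y^9\rho(G)$ and $\rho(Y)\ge(1-3y)\rho(G)$ for some $y\in(0,\tfrac14]$; or (ii) a complete blockade $(B_1,\ldots,B_k)$ for some $k\ge 2$ such that $\rho(B_i)\ge k^{-d}\rho(G)$ for all $i\in\{1,\dots,k\}$.
   Context: All graphs are finite, simple; $P_5$-free means no induced subgraph isomorphic to the five-vertex path. $|G|$ is the number of vertices, $\alpha(G)$ the stability number, $\omega(G)$ the clique number. $\psi(G)=|G|/\alpha(G)$ if $|G|\ge1$ and $\psi(G)=0$ if $G$ has no vertices; the Hall ratio $\rho(G)$ is the maximum of $\psi(F)$ over all induced subgraphs $F$ of $G$. For $S\subseteq V(G)$, $\rho(S):=\rho(G[S])$. A pair $(X,Y)$ of disjoint vertex subsets is complete if every vertex of $X$ is adjacent to every vertex of $Y$. A blockade is a sequence $(B_1,\dots,B_k)$ of pairwise disjoint vertex subsets; it is complete if $(B_i,B_j)$ is complete for all distinct $i,j$. *)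

(* Defs.v *)
From HB Require Import structures.
From mathcomp Require Import all_boot all_order all_algebra.
From mathcomp Require Import reals exp.

Set Implicit Arguments.
Unset Strict Implicit.
Unset Printing Implicit Defensive.

Import Order.TTheory GRing.Theory Num.Theory.

Record sgraph := SGraph {
  vertex :> finType;
  adj : rel vertex;
  adj_sym : symmetric adj;
  adj_irrefl : irreflexive adj
}.

Section Induced.
Variables (G : sgraph) (S : {set G}).

Let V : finType := {x : G | x \in S}.
Let iadj : rel V := fun u v => adj (val u) (val v).

Fact induced_sym : symmetric iadj.
Proof. by move=> u v; apply: adj_sym. Qed.

Fact induced_irrefl : irreflexive iadj.
Proof. by move=> u; apply: adj_irrefl. Qed.

Definition induced : sgraph := SGraph induced_sym induced_irrefl.
End Induced.

Section PathGraph.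
Variable n : nat.

Let padj : rel 'I_n := fun i j => (i.+1 == j :> nat) || (j.+1 == i :> nat).

Fact path_graph_sym : symmetric padj.
Proof. by move=> i j; rewrite /padj orbC. Qed.

Fact path_graph_irrefl : irreflexive padj.
Proof. by move=> i; rewrite /padj orbb eqn_leq ltnn. Qed.

(* [n] is the number of vertices. *)
Definition path_graph : sgraph := SGraph path_graph_sym path_graph_irrefl.
End PathGraph.

Definition isomorphic (G H : sgraph) : Prop :=
  exists2 f : G -> H, bijective f & forall x y, adj (f x) (f y) = adj x y.

Definition induced_free (H G : sgraph) : Prop :=
  forall S : {set G}, ~ isomorphic H (induced S).

Definition P5_free (G : sgraph) : Prop := induced_free (path_graph 5) G.

Definition stable (G : sgraph) (A : {set G}) : bool :=
  [forall x in A, forall y in A, ~~ adj x y].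

Definition clique (G : sgraph) (A : {set G}) : bool :=
  [forall x in A, forall y in A, (x != y) ==> adj x y].

Definition stability_number (G : sgraph) : nat :=
  \max_(A : {set G} | stable A) #|A|.

Definition clique_number (G : sgraph) : nat :=
  \max_(A : {set G} | clique A) #|A|.

Local Open Scope ring_scope.

Definition psi (R : realType) (G : sgraph) : R :=
  if (0 < #|G|)%N then #|G|%:R / (stability_number G)%:R else 0.

(* The default value 0 is [psi] of the empty induced subgraph, and [psi] is
   nonnegative, so this is the maximum over all induced subgraphs. *)
Definition hall_ratio (R : realType) (G : sgraph) : R :=
  \big[Num.max/0]_(S : {set G}) psi R (induced S).

Definition hall_ratio_set (R : realType) (G : sgraph) (S : {set G}) : R :=
  hall_ratio R (induced S).

Definition complete_pair (G : sgraph) (X Y : {set G}) : Prop :=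
  [disjoint X & Y] /\ {in X & Y, forall x y, adj x y}.

Definition blockade (G : sgraph) (k : nat) (B : 'I_k -> {set G}) : Prop :=
  forall i j, i != j -> [disjoint B i & B j].

Definition complete_blockade (G : sgraph) (k : nat) (B : 'I_k -> {set G}) :
    Prop :=
  blockade B /\ forall i j, i != j -> complete_pair (B i) (B j).

(* Main.v *)
(** Assume that neither outcome holds, with [d = 400], and write [r] for the
    Hall ratio of [G].

    For a threshold [u] let [pnum u A] be the largest number of pairwise pure
    (complete or anticomplete) subsets of [A] of Hall ratio at least [u], and
    let [phi u A = rho A / pnum u A ^ 14].  A set maximizing [phi] is
    "concentrated": in every pure family all but one of the members have a
    negligible union.  In a concentrated set the nonneighbours of a vertex are
    controlled by modules, because a component of [C \ N(u)] is a module of [C]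
    whenever [u] has a neighbour anticomplete to [C].  Hence every set of large
    [phi] contains a long sequence of blocks in which the nonneighbours of a
    vertex occupy a tiny fraction of each later block ([potential_blocks]).

    A sequence of [k] such blocks of Hall ratio at least [r / k^80] is called
    [state].  Either the potential inside one block is small, and the block
    yields a state of length [k^2], or every block contains many pure pieces
    avoiding the neighbourhood of some vertex [v]; a neighbour of [v] is mixed
    on at most one of them, so one piece per block can be chosen to form a
    complete blockade.  Since a state of length [k] forces [r > k^400], no state
    exists ([no_state]).

    It remains to find a first state.  If a connected set has no two
    anticomplete connected subsets of almost full Hall ratio (a tangle), then
    either it can be shrunk slightly so that this holds for a smaller
    threshold, or some connected set [Gam] has a large boundary each vertex of
    which is mixed on [Gam] and complete to an anchor beyond it; nonadjacent
    boundary vertices have comparable sets of anchors, so ordering the boundary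
    by the number of anchors gives a state.  Failure of outcome (i) makes the
    graph itself a tangle, and the thresholds [w], [w^(1/8)], ... descend to a
    set without pure pairs, where [phi] is the Hall ratio. *)
Require Import Defs.
From HB Require Import structures.
From mathcomp Require Import all_boot all_order all_algebra.
From mathcomp Require Import boolp reals exp.
From mathcomp Require Import ring lra zify.

Set Implicit Arguments.
Unset Strict Implicit.
Unset Printing Implicit Defensive.

Import Order.TTheory GRing.Theory Num.Theory.
Local Open Scope ring_scope.

(** * Extremal choices of vertex sets *)

Section Extremal.
Variable T : finType.

Lemma ex_min_set (P : {set T} -> Prop) :
  (exists X, P X) -> exists2 X, P X & forall Y, P Y -> (#|X| <= #|Y|)%N.
Proof.
case=> X0 PX0; have PX0b : `[< P X0 >] by apply/asboolP.
case: (arg_minnP (P := fun X => `[< P X >]) (fun X : {set T} => #|X|) PX0b) => X /asboolP PX H.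
by exists X => // Y /asboolP; apply: H.
Qed.

Lemma ex_max_set (P : {set T} -> Prop) :
  (exists X, P X) -> exists2 X, P X & forall Y, P Y -> (#|Y| <= #|X|)%N.
Proof.
case=> X0 PX0; have PX0b : `[< P X0 >] by apply/asboolP.
case: (arg_maxnP (P := fun X => `[< P X >]) (fun X : {set T} => #|X|) PX0b) => X /asboolP PX H.
by exists X => // Y /asboolP; apply: H.
Qed.

Lemma ex_maximal_sup (P : {set T} -> Prop) X0 : P X0 ->
  exists2 X, P X /\ X0 \subset X & forall Y, P Y -> X \subset Y -> Y = X.
Proof.
move=> PX0; have [|X [PX sX] H] := ex_max_set (P := fun X => P X /\ X0 \subset X).
  by exists X0; split.
exists X => // Y PY sXY; apply/esym/eqP; rewrite eqEcard sXY H //.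
by split=> //; apply: subset_trans sXY.
Qed.

Lemma ex_max_real (R : realType) (P : {set T} -> Prop) (f : {set T} -> R) :
  (exists X, P X) -> exists2 X, P X & forall Y, P Y -> f Y <= f X.
Proof.
case=> X0 PX0; have PX0b : `[< P X0 >] by apply/asboolP.
case: (arg_maxP (P := fun X => `[< P X >]) f PX0b) => X /asboolP PX H.
by exists X => // Y /asboolP; apply: H.
Qed.

End Extremal.

(** * Connectivity through cuts, and components *)

Section Connectivity.
Variables (T : finType) (e : rel T).
Implicit Types (X Y C : {set T}) (x y : T).
Hypothesis e_sym : symmetric e.

(** Cuts replace paths because the uses below extract an edge that leaves part of a connected set.
    Taken with the complement relation [nadj], the same notion gives anticonnected sets. *)
Definition conn (X : {set T}) : Prop :=
  forall (P : {set T}) x y, x \in X -> y \in X -> x \in P -> y \notin P ->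
  exists a b, [/\ a \in X, b \in X, a \in P, b \notin P & e a b].

Lemma conn_set1 x : conn [set x].
Proof. by move=> P a b /set1P-> /set1P-> ->. Qed.

Lemma conn_meet X Y z : conn X -> conn Y -> z \in X -> z \in Y -> conn (X :|: Y).
Proof.
move=> cX cY zX zY P x y xU yU xP yP.
have H W : W = X \/ W = Y -> conn W -> forall w w', w \in W -> w' \in W ->
   w \in P -> w' \notin P -> exists a b, [/\ a \in X :|: Y, b \in X :|: Y, a \in P,
     b \notin P & e a b].
  move=> WE cW w w' wW w'W wP w'P; have [a [b [aW bW aP bP eab]]] := cW P w w' wW w'W wP w'P.
  by exists a, b; split=> //; rewrite inE; case: WE => E; rewrite -E ?aW ?bW ?orbT.
have [zP|zP] := boolP (z \in P).
  by case/setUP: yU => yW; [apply: (H X _ _ z y)|apply: (H Y _ _ z y)] => //; auto.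
by case/setUP: xU => xW; [apply: (H X _ _ x z)|apply: (H Y _ _ x z)] => //; auto.
Qed.

Lemma conn_edge X Y x y : conn X -> conn Y -> x \in X -> y \in Y -> e x y -> conn (X :|: Y).
Proof.
move=> cX cY xX yY exy.
have cxy : conn [set x; y].
  move=> P a b; rewrite !inE => /orP[]/eqP-> /orP[]/eqP-> // H1 H2; try by rewrite H1 in H2.
    by exists x, y; rewrite !inE !eqxx ?orbT.
  by exists y, x; rewrite !inE !eqxx ?orbT e_sym.
have c1 : conn (X :|: [set x; y]) by apply: (conn_meet (z := x)) => //; rewrite !inE eqxx.
have -> : X :|: Y = (X :|: [set x; y]) :|: Y.
  apply/setP=> z; rewrite !inE; case: eqP => [->|_]; case: eqP => [->|_];
    rewrite ?xX ?yY ?orbT ?orbF //.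
by apply: (conn_meet (z := y)) => //; rewrite !inE eqxx !orbT.
Qed.

Lemma component_at X y : y \in X ->
  exists C, [/\ C \subset X, y \in C, conn C &
     forall a b, a \in C -> b \in X :\: C -> ~~ e a b].
Proof.
move=> yX.
have [|C [[sC cC] /subsetP yC] mC] := @ex_maximal_sup _ (fun C => C \subset X /\ conn C) [set y].
  by split; [rewrite sub1set|apply: conn_set1].
exists C; split=> //; first by apply: yC; rewrite inE.
move=> a b aC /setDP[bX bC]; apply/negP => eab.
have E : C :|: [set b] = C.
  apply: mC; last exact: subsetUl.
  split; first by rewrite subUset sC sub1set.
  by apply: (conn_edge (x := a) (y := b)) => //; [apply: conn_set1|rewrite inE].
by move: bC; rewrite -E !inE eqxx orbT.
Qed.

Lemma conn_to_complement X C x y : conn X -> C \subset X -> x \in C -> y \in X :\: C ->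
  exists a b, [/\ a \in C, b \in X :\: C & e a b].
Proof.
move=> cX /subsetP sC xC /setDP[yX yC].
have [a [b [aX bX aC bC eab]]] := cX C x y (sC _ xC) yX xC yC.
by exists a, b; rewrite inE bX bC.
Qed.

End Connectivity.

(** * The Hall ratio of a vertex set *)

Section HallRatio.
Variables (R : realType) (G : sgraph).
Implicit Types (A B C D E F I J X Y Z : {set G}) (x y z u v w : G).

Definition nadj : rel G := fun x y => (x != y) && ~~ adj x y.
Definition nb x : {set G} := [set y | adj x y].

Lemma nadj_sym : symmetric nadj.
Proof. by move=> x y; rewrite /nadj eq_sym adj_sym. Qed.

Lemma in_nb x y : (y \in nb x) = adj x y. Proof. by rewrite inE. Qed.

Definition cpl X Y := [forall x in X, forall y in Y, adj x y].
Definition acpl X Y := [forall x in X, forall y in Y, nadj x y].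
Definition pure X Y := cpl X Y || acpl X Y.

Lemma allrP (r : rel G) X Y :
  reflect {in X & Y, forall x y, r x y} [forall x in X, forall y in Y, r x y].
Proof.
apply: (iffP forall_inP) => [H x y xX yY|H x xX]; first by move/forall_inP: (H x xX); apply.
by apply/forall_inP => y yY; apply: H.
Qed.

Lemma cplP X Y : reflect {in X & Y, forall x y, adj x y} (cpl X Y).
Proof. exact: allrP. Qed.
Lemma acplP X Y : reflect {in X & Y, forall x y, nadj x y} (acpl X Y).
Proof. exact: allrP. Qed.

Lemma cplC X Y : cpl X Y = cpl Y X.
Proof. by apply/cplP/cplP => H x y xX yY; rewrite adj_sym H. Qed.
Lemma acplC X Y : acpl X Y = acpl Y X.
Proof. by apply/acplP/acplP => H x y xX yY; rewrite nadj_sym H. Qed.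
Lemma pureC X Y : pure X Y = pure Y X.
Proof. by rewrite /pure cplC acplC. Qed.

Lemma cplW X Y X' Y' : X' \subset X -> Y' \subset Y -> cpl X Y -> cpl X' Y'.
Proof. by move=> /subsetP s1 /subsetP s2 /cplP H; apply/cplP => x y /s1 ? /s2 ?; apply: H. Qed.
Lemma acplW X Y X' Y' : X' \subset X -> Y' \subset Y -> acpl X Y -> acpl X' Y'.
Proof. by move=> /subsetP s1 /subsetP s2 /acplP H; apply/acplP => x y /s1 ? /s2 ?; apply: H. Qed.
Lemma pureW X Y X' Y' : X' \subset X -> Y' \subset Y -> pure X Y -> pure X' Y'.
Proof. by move=> s1 s2 /orP[/(cplW s1 s2)|/(acplW s1 s2)] H; rewrite /pure H ?orbT. Qed.

Lemma cpl_disj X Y : cpl X Y -> [disjoint X & Y].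
Proof.
move/cplP=> H; rewrite -setI_eq0; apply/eqP/setP=> x; rewrite !inE.
by apply/negP => /andP[xX xY]; move: (H x x xX xY); rewrite adj_irrefl.
Qed.
Lemma acpl_disj X Y : acpl X Y -> [disjoint X & Y].
Proof.
move/acplP=> H; rewrite -setI_eq0; apply/eqP/setP=> x; rewrite !inE.
by apply/negP => /andP[xX xY]; move: (H x x xX xY); rewrite /nadj eqxx.
Qed.
Lemma pure_disj X Y : pure X Y -> [disjoint X & Y].
Proof. by case/orP => [/cpl_disj|/acpl_disj]. Qed.

(** Stability number and Hall ratio are computed inside [G], which avoids induced subgraphs of
    induced subgraphs. In [rho] the empty [F] contributes [0 / 0 = 0]. *)
Definition al X : nat := \max_(I : {set G} | (I \subset X) && stable I) #|I|.
Definition rho X : R := \big[Num.max/0]_(F : {set G} | F \subset X) (#|F|%:R / (al F)%:R).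

Lemma stableP A : reflect {in A &, forall x y, ~~ adj x y} (stable A).
Proof.
apply: (iffP forall_inP) => [H x y xX yY|H x xX]; first by move/forall_inP: (H x xX); apply.
by apply/forall_inP => y yY; apply: H.
Qed.

Lemma al_ge X I : I \subset X -> stable I -> (#|I| <= al X)%N.
Proof. by move=> s st; rewrite /al (bigD1 I) ?s //= leq_maxl. Qed.

Lemma al_witness X : exists2 I : {set G}, I \subset X & stable I /\ #|I| = al X.
Proof.
have [I /andP[s st] E] : {I : {set G} | (I \subset X) && stable I & al X = #|I|}.
  have h0 : (set0 \subset X) && stable (set0 : {set G}).
    by rewrite sub0set; apply/stableP=> x y; rewrite inE.
  by apply: eq_bigmax_cond; apply/card_gt0P; exists set0; rewrite unfold_in.
by exists I.
Qed.

Lemma alS X Y : X \subset Y -> (al X <= al Y)%N.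
Proof.
by move=> s; have [I sI [st <-]] := al_witness X; apply: al_ge => //; apply: subset_trans s.
Qed.

Lemma al_gt0 X x : x \in X -> (0 < al X)%N.
Proof.
move=> xX; apply: leq_trans (al_ge (I := [set x]) _ _); rewrite ?cards1 ?sub1set //.
by apply/stableP=> a b /set1P-> /set1P->; rewrite adj_irrefl.
Qed.

Lemma al_leq_card X : (al X <= #|X|)%N.
Proof. by have [I s [_ <-]] := al_witness X; apply: subset_leq_card. Qed.

Lemma alU_anti X Y : acpl X Y -> (al X + al Y <= al (X :|: Y))%N.
Proof.
move=> a; have [I sI [stI <-]] := al_witness X; have [J sJ [stJ <-]] := al_witness Y.
have aIJ := acplW sI sJ a.
rewrite -[(#|I| + _)%N]subn0 -[X in (_ - X <= _)%N](cards0 G).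
have/eqP <- : I :&: J == set0 by rewrite setI_eq0 (acpl_disj aIJ).
rewrite -cardsU; apply: al_ge; first exact: setUSS.
move/acplP: aIJ => aIJ.
apply/stableP=> x y /setUP[] hx /setUP[] hy.
- by apply: (stableP _ stI).
- by case/andP: (aIJ _ _ hx hy).
- by rewrite adj_sym; case/andP: (aIJ _ _ hy hx).
- by apply: (stableP _ stJ).
Qed.

Lemma rho_ge0 X : 0 <= rho X.
Proof.
rewrite /rho; elim/big_rec: _ => // F x _ hx.
by rewrite le_max hx orbT.
Qed.

Lemma rho_le X c : 0 <= c ->
  (forall F, F \subset X -> #|F|%:R <= c * (al F)%:R) -> rho X <= c.
Proof.
move=> c0 H; rewrite /rho; elim/big_rec: _ => // F x sF hx.
rewrite ge_max hx andbT; have [->|[y yF]] := set_0Vmem F; first by rewrite cards0 mul0r.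
by rewrite ler_pdivrMr ?H // ltr0n (al_gt0 yF).
Qed.

Lemma card_le_rho X F : F \subset X -> #|F|%:R <= rho X * (al F)%:R.
Proof.
move=> sF; have [->|[y yF]] := set_0Vmem F; first by rewrite cards0 mulr_ge0 ?rho_ge0.
rewrite -ler_pdivrMr ?ltr0n ?(al_gt0 yF) //.
by rewrite /rho (bigD1 F) //= le_max lexx.
Qed.

Lemma rhoS X Y : X \subset Y -> rho X <= rho Y.
Proof.
move=> s; apply: rho_le; first exact: rho_ge0.
by move=> F sF; apply: card_le_rho; apply: subset_trans s.
Qed.

Lemma rho0 : rho set0 = 0.
Proof.
apply/eqP; rewrite eq_le rho_ge0 andbT; apply: rho_le => // F.
by rewrite subset0 => /eqP->; rewrite cards0 mul0r.
Qed.

Lemma rho_ge1 X x : x \in X -> 1 <= rho X.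
Proof.
move=> xX; have s : [set x] \subset X by rewrite sub1set.
apply: le_trans (rhoS s); have := card_le_rho (subxx [set x]).
rewrite cards1 => H; have E : al [set x] = 1%N.
  have h1 : (0 < al [set x])%N by apply: (@al_gt0 _ x); rewrite inE.
  by have := al_leq_card [set x]; rewrite cards1; lia.
by move: H; rewrite E mulr1.
Qed.

Lemma rho_set1 x : rho [set x] = 1.
Proof.
apply/eqP; rewrite eq_le (@rho_ge1 _ x) ?inE ?eqxx // andbT.
apply: rho_le => // F sF; rewrite mul1r ler_nat.
have [->|[y yF]] := set_0Vmem F; first by rewrite cards0.
by apply: leq_trans (al_gt0 yF); rewrite -(cards1 x) subset_leq_card.
Qed.

Lemma rho_gt0_ex X : 0 < rho X -> exists x, x \in X.
Proof. by move=> h; have [E|[x xX]] := set_0Vmem X; [rewrite E rho0 ltxx in h|exists x]. Qed.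

Lemma rhoU X Y : rho (X :|: Y) <= rho X + rho Y.
Proof.
apply: rho_le; first by rewrite addr_ge0 ?rho_ge0.
move=> F sF; rewrite mulrDl.
have h : (#|F| <= #|F :&: X| + #|F :&: Y|)%N.
  apply: leq_trans (leq_card_setU _ _); apply: subset_leq_card.
  by rewrite -setIUr subsetI subxx.
have [s1 s2] := (subsetIl F X, subsetIl F Y).
apply: le_trans (_ : (#|F :&: X| + #|F :&: Y|)%:R <= _); first by rewrite ler_nat.
rewrite natrD lerD //.
  apply: le_trans (card_le_rho (subsetIr F X)) _.
  by rewrite ler_wpM2l ?rho_ge0 // ler_nat alS.
apply: le_trans (card_le_rho (subsetIr F Y)) _.
by rewrite ler_wpM2l ?rho_ge0 // ler_nat alS.
Qed.

Lemma rhoD X Y : rho X <= rho (X :\: Y) + rho Y.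
Proof. by apply: le_trans (rhoU _ _); apply: rhoS; apply/subsetP=> z zX;
  rewrite !inE zX andbT orNb. Qed.

Lemma rho_split X Y Z : X \subset Y :|: Z -> rho X <= rho Y + rho Z.
Proof. by move=> s; apply: le_trans (rhoU _ _); apply: rhoS. Qed.

(** Stability numbers add over an anticomplete pair, so the Hall ratio of the union is a maximum and
    not a sum. *)
Lemma rhoU_anti X Y c : acpl X Y -> rho X <= c -> rho Y <= c -> rho (X :|: Y) <= c.
Proof.
move=> a hX hY; have c0 : 0 <= c by apply: le_trans hX; apply: rho_ge0.
apply: rho_le => // F sF.
have a' : acpl (F :&: X) (F :&: Y) by apply: acplW a; apply: subsetIr.
have E : F = (F :&: X) :|: (F :&: Y) by rewrite -setIUr; apply/esym/setIidPl.
have h : (#|F| <= #|F :&: X| + #|F :&: Y|)%N by rewrite {1}E leq_card_setU.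
have h2 : (al (F :&: X) + al (F :&: Y) <= al F)%N by rewrite {3}E alU_anti.
apply: le_trans (_ : (#|F :&: X| + #|F :&: Y|)%:R <= _); first by rewrite ler_nat.
apply: le_trans (_ : c * (al (F :&: X) + al (F :&: Y))%:R <= _); last first.
  by rewrite ler_wpM2l ?ler_nat.
rewrite !natrD mulrDr lerD //.
  by apply: le_trans (card_le_rho (subsetIr F X)) _; rewrite ler_wpM2r.
by apply: le_trans (card_le_rho (subsetIr F Y)) _; rewrite ler_wpM2r.
Qed.

(** Take [F] maximizing [#|F| / al F]. Inside it the Hall ratio controls cardinality: a subset with
    a small share of the Hall ratio has at most that share of the vertices, so counting arguments
    become available. *)
Lemma rho_tight X : exists F : {set G}, [/\ F \subset X, rho F = rho X &
  forall Y, Y \subset F -> rho F * #|Y|%:R <= rho Y * #|F|%:R].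
Proof.
have [F [sF EF E2]] : exists F : {set G}, [/\ F \subset X,
  #|F|%:R = rho X * (al F)%:R & rho F = rho X].
  have [E|[x xX]] := set_0Vmem X.
    by exists set0; split; rewrite ?sub0set // E rho0 ?cards0 ?mul0r.
  have [|F [sF hF] mF] := @ex_max_real _ R (fun F => F \subset X /\ exists y, y \in F)
      (fun F => #|F|%:R / (al F)%:R).
    by exists X; split => //; exists x.
  case: hF => y yF; exists F.
  have p : 0 < (al F)%:R :> R by rewrite ltr0n (al_gt0 yF).
  have EF : #|F|%:R = rho X * (al F)%:R.
    apply/eqP; rewrite eq_le card_le_rho //= -ler_pdivlMr //.
    apply: rho_le; first by rewrite divr_ge0.
    move=> Y sY; have [->|[z zY]] := set_0Vmem Y.
      by rewrite cards0 mulr_ge0 // divr_ge0.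
    rewrite -ler_pdivrMr ?ltr0n ?(al_gt0 zY) //; apply: mF; split=> //; by exists z.
  split=> //; apply/eqP; rewrite eq_le rhoS //=.
  by rewrite -(ler_pM2r p) -EF card_le_rho.
exists F; split=> // Y sY; rewrite EF -E2 mulrCA ler_wpM2l ?rho_ge0 //.
apply: le_trans (card_le_rho (subxx Y)) _.
by rewrite ler_wpM2l ?rho_ge0 // ler_nat alS.
Qed.

Definition no_path5 := forall a b c d e : G, adj a b -> adj b c -> adj c d -> adj d e ->
  ~~ adj a c -> ~~ adj a d -> ~~ adj a e -> ~~ adj b d -> ~~ adj b e -> ~~ adj c e -> False.

End HallRatio.

(** * Modules, pure families and the potential *)

Section Modules.
Variables (R : realType) (G : sgraph).
Implicit Types (A B C D E F I J K X Y Z : {set G}) (k x y z v w : G).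
Implicit Types (P Q : {set {set G}}).

Local Notation rho := (@rho R G).

Lemma card_setD_lt A B x : x \in A -> x \in B -> (#|A :\: B| < #|A|)%N.
Proof.
move=> xA xB; apply: proper_card; apply/properP; split; first exact: subsetDl.
by exists x => //; rewrite inE xB.
Qed.

Lemma conn_mixed X w x y : conn (@adj G) X -> x \in X -> y \in X -> adj w x -> ~~ adj w y ->
  exists a b, [/\ a \in X, b \in X, adj w a, ~~ adj w b & adj a b].
Proof.
move=> cX xX yX wx wy; have [||a [b [aX bX]]] := cX (nb w) x y xX yX; rewrite ?in_nb //.
by move=> wa wb ab; exists a, b.
Qed.

Lemma acpl_split X C : (forall a b, a \in C -> b \in X :\: C -> ~~ adj a b) -> acpl C (X :\: C).
Proof.
move=> H; apply/acplP => a b aC bX; rewrite /nadj H // andbT.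
by apply: contraTneq bX => <-; rewrite inE aC.
Qed.

Lemma conn_in_closed K X C k : conn (@adj G) K -> K \subset X -> acpl C (X :\: C) ->
  k \in K -> k \in C -> K \subset C.
Proof.
move=> cK /subsetP sK /acplP a kK kC; apply/subsetP => y yK; apply: contraT => yC.
have [b [c [bK cK' bC cC ebc]]] := cK C k y kK yK kC yC.
by have := a b c bC; rewrite inE cC (sK _ cK') /nadj ebc andbF => /(_ isT).
Qed.

Lemma component X y : y \in X -> exists C : {set G}, [/\ C \subset X, y \in C,
  conn (@adj G) C & acpl C (X :\: C)].
Proof.
move=> yX; have [C [s yC cC H]] := component_at (@adj_sym G) yX.
by exists C; split=> //; apply: acpl_split.
Qed.

Lemma anticomponent X y : y \in X ->
  exists C : {set G}, [/\ C \subset X, y \in C, conn (@nadj G) C & cpl C (X :\: C)].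
Proof.
move=> yX; have [C [s yC cC H]] := component_at (@nadj_sym G) yX.
exists C; split=> //; apply/cplP => a b aC bX; apply: contraT => nab.
have := H a b aC bX; rewrite /nadj nab andbT negbK => /eqP E.
by move: bX; rewrite -E inE aC.
Qed.

(** A smallest union of components keeping the whole Hall ratio is a single component, by
    [rhoU_anti]. *)
Lemma component_rho X : exists C : {set G}, [/\ C \subset X, conn (@adj G) C,
  acpl C (X :\: C) & rho C = rho X].
Proof.
have [|C [sC aC rC] mC] := @ex_min_set _ (fun C => [/\ C \subset X,
  acpl C (X :\: C) & rho C = rho X]).
  by exists X; split=> //; rewrite setDv; apply/acplP => a b; rewrite inE.
exists C; split=> //; have [->|[x xC]] := set_0Vmem C; first by move=> P x y; rewrite inE.
have [D [sD xD cD aD]] := component xC.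
have aCD : acpl (C :\: D) (X :\: (C :\: D)).
  apply/acplP => a b /setDP[aC' aD']; rewrite !inE negb_and negbK => /andP[/orP[bD|bC] bX].
    by rewrite nadj_sym; apply: (acplP _ _ aD) => //; rewrite inE aD' aC'.
  by apply: (acplP _ _ aC) => //; rewrite inE bC bX.
have aDX : acpl D (X :\: D).
  apply/acplP => a b aD'; rewrite !inE => /andP[bD bX]; have [bC|bC] := boolP (b \in C).
    by apply: (acplP _ _ aD) => //; rewrite inE bD bC.
  by apply: (acplP _ _ aC) => //; [apply: (subsetP sD)|rewrite inE bC].
have E : C = D :|: (C :\: D) by rewrite setDE setUIr setUCr setIT; apply/esym/setUidPr.
have [h|h] := leP (rho C) (rho D).
  suff -> : C = D by [].
  apply/esym/eqP; rewrite eqEcard sD mC //; split=> //; first exact: subset_trans sC.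
  by apply/eqP; rewrite -rC eq_le rhoS.
have h2 : rho C <= rho (C :\: D).
  rewrite leNgt; apply/negP => h2.
  have : rho C <= Num.max (rho D) (rho (C :\: D)).
    by rewrite {1}E; apply: rhoU_anti; rewrite ?le_max ?lexx ?orbT.
  by rewrite le_max => /orP[]; lra.
have : (#|C| <= #|C :\: D|)%N.
  apply: mC; split=> //; first by apply: subset_trans sC; apply: subsetDl.
  by apply/eqP; rewrite -rC eq_le h2 rhoS // subsetDl.
by rewrite leqNgt (card_setD_lt xC xD).
Qed.

Definition nonnb X v := (X :\: nb v) :\ v.

Lemma nonnbP X v x : (x \in nonnb X v) = [&& x != v, ~~ adj v x & x \in X].
Proof. by rewrite !inE. Qed.


Lemma rho_nonnb X v : rho X <= rho (X :&: nb v) + rho (nonnb X v) + 1.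
Proof.
rewrite -(rho_set1 R v); apply: le_trans (_ : rho ((X :&: nb v) :|: nonnb X v) + rho [set v] <= _).
  apply: rho_split; apply/subsetP => x xX; rewrite !inE xX !andbT /=.
  by case: (adj v x) => //; case: (x == v).
by rewrite lerD2r rhoU.
Qed.

Lemma rho_nonnb1 X v : rho (X :\: nb v) <= rho (nonnb X v) + 1.
Proof. by rewrite -(rho_set1 R v); apply: rhoD. Qed.

Hypothesis noP5 : no_path5 G.

Lemma acpl1P v C : acpl [set v] C -> forall c, c \in C -> (v != c) && ~~ adj v c.
Proof. by move/acplP=> H c cC; apply: H; rewrite ?inE. Qed.

(** Gyarfas path argument: if all neighbourhoods were small, one could repeatedly delete a
    neighbourhood, keep the heaviest component and step into it, growing an induced path
    [v0 v1 v2 a b]. *)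
Lemma gyarfas X : 4%:R < rho X -> exists2 v, v \in X & rho X / 4%:R <= rho (X :&: nb v).
Proof.
move=> r4; apply: contrapT => H.
have {}H v : v \in X -> rho (X :&: nb v) < rho X / 4%:R.
  by move=> vX; rewrite ltNge; apply/negP => h; apply: H; exists v.
have [C0 [s0 c0 _ r0]] := component_rho X.
have [v0 v0C] : exists v0, v0 \in C0 by apply: (@rho_gt0_ex R); rewrite r0; lra.
have Hs C v : C \subset X -> v \in X -> rho (C :&: nb v) < rho X / 4%:R.
  by move=> s vX; apply: le_lt_trans (H v vX); apply/rhoS/setSI.
have sX0 := subsetP s0.
have h1 : rho X < rho (nonnb C0 v0) + rho X / 4%:R + 1.
  have := rho_nonnb C0 v0; have := Hs _ _ s0 (sX0 _ v0C); rewrite r0; lra.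
have [C1 [s1 c1 a1 r1]] := component_rho (nonnb C0 v0).
have [y1 y1C] : exists y, y \in C1 by apply: (@rho_gt0_ex R); rewrite r1; lra.
have s10 : {subset C1 <= C0} by move=> x /(subsetP s1); rewrite nonnbP => /and3P[].
have n01 x : x \in C1 -> ~~ adj v0 x by move/(subsetP s1); rewrite nonnbP => /and3P[].
have v0C1 : v0 \notin C1 by apply/negP => /(subsetP s1); rewrite nonnbP eqxx.
have [x1 [v1 [x1C v1C1 ex1]]] : exists a b, [/\ a \in C1, b \in C0 :\: C1 & adj a b].
  by apply: (conn_to_complement c0 (x := y1) (y := v0)); rewrite ?inE ?v0C1 //; apply/subsetP.
case/setDP: v1C1 => v1C0 v1C1.
have e01 : adj v0 v1.
  apply: contraT => n; have [E|nv] := eqVneq v1 v0.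
    by have := n01 _ x1C; rewrite -E adj_sym ex1.
  have := (acplP _ _ a1) _ v1 x1C; rewrite inE v1C1 nonnbP nv n v1C0 /nadj ex1 andbF.
  by move/(_ isT).
have h2 : rho X < rho (C1 :\: nb v1) + rho X / 4%:R + rho X / 4%:R + 1.
  have := rhoD R C1 (C1 :&: nb v1).
  have -> : C1 :\: (C1 :&: nb v1) = C1 :\: nb v1.
    by apply/setP => x; rewrite !inE; case: (x \in C1); rewrite ?andbF.
  have := Hs C1 v1; rewrite r1 => /(_ _ (sX0 _ v1C0)).
  have : C1 \subset X by apply/subsetP => x /s10/sX0.
  move=> ss /(_ ss); lra.
have [C2 [s2 c2 a2 r2]] := component_rho (C1 :\: nb v1).
have [y2 y2C] : exists y, y \in C2 by apply: (@rho_gt0_ex R); rewrite r2; lra.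
have s21 : {subset C2 <= C1} by move=> x /(subsetP s2); rewrite inE => /andP[].
have n12 x : x \in C2 -> ~~ adj v1 x by move/(subsetP s2); rewrite !inE => /andP[].
have x1C2 : x1 \notin C2 by apply/negP => /n12; rewrite adj_sym ex1.
have [x2 [v2 [x2C v2C2 ex2]]] : exists a b, [/\ a \in C2, b \in C1 :\: C2 & adj a b].
  by apply: (conn_to_complement c1 (x := y2) (y := x1)); rewrite ?inE ?x1C2 //; apply/subsetP.
case/setDP: v2C2 => v2C1 v2C2.
have e12 : adj v1 v2.
  apply: contraT => n.
  have := (acplP _ _ a2) _ v2 x2C; rewrite !inE v2C2 v2C1 n /nadj ex2 andbF.
  by move/(_ isT).
(* What remains has Hall ratio above [rho X / 2 - 1], which exceeds [rho X / 4] because [rho X > 4];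
   so [C2] does not fit into the neighbourhood of [v2]. *)
have [z zC nz] : exists2 z, z \in C2 & ~~ adj v2 z.
  apply: contrapT => Hz.
  have : rho (C2 :\: nb v1) <= rho (X :&: nb v2).
    apply: rhoS; apply/subsetP => x; rewrite !inE => /andP[_ xC].
    rewrite sX0 ?s10 ?s21 //=; apply: contraT => n; case: Hz; by exists x.
  have -> : C2 :\: nb v1 = C2.
    by apply/setP => x; rewrite !inE; case: (boolP (x \in C2)) => [/n12->|]; rewrite ?andbF.
  have := H v2 (sX0 _ (s10 _ v2C1)); rewrite r2; lra.
rewrite adj_sym in ex2.
have [a [b [aC bC ea nb' eab]]] := conn_mixed c2 x2C zC ex2 nz.
have [aC1 bC1] := (s21 _ aC, s21 _ bC).
by apply: (@noP5 v0 v1 v2 a b) => //; rewrite ?n12 ?n01.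
Qed.

Definition module_in C E := E \subset C /\
  forall x a b, x \in C -> x \notin E -> a \in E -> b \in E -> adj x a = adj x b.

Lemma module_pure C E F : module_in C E -> module_in C F -> [disjoint E & F] -> pure E F.
Proof.
move=> [sE mE] [sF mF] dEF.
have [->|[e0 e0E]] := set_0Vmem E; first by rewrite /pure; apply/orP; left; apply/cplP => x y;
  rewrite inE.
have [->|[f0 f0F]] := set_0Vmem F; first by rewrite /pure; apply/orP; left; apply/cplP => x y;
  rewrite inE.
have nE x : x \in F -> x \notin E by move=> xF; rewrite (disjointFl dEF).
have nF x : x \in E -> x \notin F by move=> xF; rewrite (disjointFr dEF).
have Eq e f : e \in E -> f \in F -> adj e f = adj e0 f0.
  move=> eE fF; rewrite (mF e f f0) ?nF ?(subsetP sE) //.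
  by rewrite adj_sym (mE f0 e e0) ?nE ?(subsetP sF) // adj_sym.
rewrite /pure; have [h|h] := boolP (adj e0 f0).
  by apply/orP; left; apply/cplP => x y xE yF; rewrite Eq.
apply/orP; right; apply/acplP => x y xE yF; rewrite /nadj Eq // h andbT.
by apply: contraTneq xE => ->; rewrite nE.
Qed.

Lemma module_union C E F z : module_in C E -> module_in C F -> z \in E -> z \in F ->
  module_in C (E :|: F).
Proof.
move=> [sE mE] [sF mF] zE zF; split; first by rewrite subUset sE.
have H x a : x \in C -> x \notin E :|: F -> a \in E :|: F -> adj x a = adj x z.
  move=> xC; rewrite !inE negb_or => /andP[xE xF] /orP[h|h]; [exact: mE|exact: mF].
by move=> x a b xC xn aU bU; rewrite !H.
Qed.

(** A vertex [x] of [C] outside [E] with a neighbour in [E] is adjacent to [u], as [E] is a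
    component of [C :\: nb u]. If [x] were mixed on [E], an edge [a' b'] of [E] would give the
    induced path [v u x a' b']. *)
Lemma nonneighbour_component_module C v u E : acpl [set v] C -> adj v u -> conn (@adj G) E ->
  E \subset C :\: nb u -> acpl E ((C :\: nb u) :\: E) -> module_in C E.
Proof.
move=> aC vu cE sE aE; have sEC : E \subset C by apply: subset_trans sE (subsetDl _ _).
split=> //; suff H x a b : x \in C -> x \notin E -> a \in E -> b \in E -> adj x a -> adj x b.
  by move=> x a b xC xE aE' bE'; apply/idP/idP; apply: H.
move=> xC xE aE' bE' xa; apply: contraT => xb.
have ux : adj u x.
  apply: contraT => n; have := (acplP _ _ aE) a x aE'; rewrite !inE xE xC n => /(_ isT).
  by rewrite /nadj adj_sym xa andbF.
have [a' [b' [a'E b'E xa' xb' ab']]] := conn_mixed cE aE' bE' xa xb.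
have nu y : y \in E -> ~~ adj u y by move/(subsetP sE); rewrite !inE => /andP[].
have nv y : y \in C -> ~~ adj v y by case/(acpl1P aC)/andP.
have sC := subsetP sEC.
have [a'C b'C] := (sC _ a'E, sC _ b'E).
by case: (@noP5 v u x a' b') => //; rewrite ?nv ?nu.
Qed.

Definition concentrated (u : R) A (tau : R) : Prop := forall P,
  (forall X, X \in P -> X \subset A /\ u <= rho X) ->
  {in P &, forall X Y, X != Y -> pure X Y} ->
  exists E0, rho (cover (P :\ E0)) <= tau.

Lemma concentratedS u A B tau : B \subset A -> concentrated u A tau -> concentrated u B tau.
Proof.
move=> s cA P H; apply: cA => X XP; have [sX rX] := H X XP; split=> //.
exact: subset_trans sX s.
Qed.

Lemma concentrated_pair u A tau X Y : 0 < u -> u <= tau -> concentrated u A tau -> X \subset A ->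
  Y \subset A ->
  pure X Y -> tau < rho X -> rho Y <= tau.
Proof.
move=> u0 ut cA sX sY p rX; rewrite leNgt; apply/negP => rY.
have nXY : X != Y.
  apply/eqP => E; have := pure_disj p; rewrite -E -setI_eq0 setIid => /eqP E0.
  by move: rX; rewrite E0 rho0; lra.
have [|X' Y'|E0] := cA [set X; Y].
- by move=> Z; rewrite !inE => /orP[]/eqP->; split=> //; lra.
- by rewrite !inE => /orP[]/eqP-> /orP[]/eqP->; rewrite ?eqxx // => _; rewrite // pureC.
apply/negP; rewrite -ltNge.
have H Z : Z \in [set X; Y] -> Z != E0 -> tau < rho Z -> tau < rho (cover ([set X; Y] :\ E0)).
  move=> ZP nZ hZ; apply: lt_le_trans hZ _; apply: rhoS.
  by apply: (bigcup_sup Z); rewrite !inE in ZP *; rewrite nZ.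
have [E|nX] := eqVneq X E0; last by apply: (H X); rewrite ?inE ?eqxx.
by apply: (H Y); rewrite ?inE ?eqxx ?orbT // -E eq_sym.
Qed.

(** Take a smallest union [W] of anticomponents with Hall ratio above [tau], and one anticomponent
    [D] of it. If [D] were small, then [D], [W :\: D] and [S :\: W] would all have Hall ratio at
    most [tau], against [3 * tau < rho S]. *)
Lemma big_anticomponent u S tau : 0 < u -> u <= tau -> concentrated u S tau -> 3%:R * tau < rho S ->
  exists D : {set G}, [/\ D \subset S, conn (@nadj G) D, cpl D (S :\: D) & rho S <= rho D + tau].
Proof.
move=> u0 ut cS hS.
have [|W [sW cW rW] mW] := @ex_min_set _ (fun W => [/\ W \subset S, cpl W (S :\: W) & tau < rho W]).
  exists S; split=> //; last by lra.
  by rewrite setDv; apply/cplP => a b _; rewrite inE.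
have [y yW] : exists y, y \in W by apply: (@rho_gt0_ex R); lra.
have [D [sD yD cD aD]] := anticomponent yW.
have aDS : cpl D (S :\: D).
  apply/cplP => a b aD'; rewrite !inE => /andP[bD bS]; have [bW|bW] := boolP (b \in W).
    by apply: (cplP _ _ aD) => //; rewrite inE bD bW.
  by apply: (cplP _ _ cW); rewrite ?inE ?bW ?(subsetP sD).
have aWD : cpl (W :\: D) (S :\: (W :\: D)).
  apply/cplP => a b /setDP[aW aD']; rewrite !inE negb_and negbK => /andP[/orP[bD|bW] bS].
    by rewrite adj_sym; apply: (cplP _ _ aD) => //; rewrite inE aD' aW.
  by apply: (cplP _ _ cW) => //; rewrite inE bW bS.
have rWD : rho (W :\: D) <= tau.
  rewrite leNgt; apply/negP => h.
  have : (#|W| <= #|W :\: D|)%N.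
    by apply: mW; split=> //; apply: subset_trans sW; apply: subsetDl.
  by rewrite leqNgt (card_setD_lt yW yD).
have sDS : D \subset S by apply: subset_trans sW.
exists D; split=> //.
have rD : tau < rho D.
  rewrite ltNge; apply/negP => h.
  have h1 : rho (S :\: W) <= tau.
    by apply: (concentrated_pair u0 ut cS sW (subsetDl _ _)) => //; rewrite /pure cW.
  have := rhoD R W D; have := rhoD R S W; lra.
have : rho (S :\: D) <= tau.
  by apply: (concentrated_pair u0 ut cS sDS (subsetDl _ _)) => //; rewrite /pure aDS.
have := rhoD R S D; lra.
Qed.

(* For [w] adjacent to [v] and [c0], every component of [C :\: nb w] is a module
   avoiding [c0], so it lies in a maximal connected one; [D] omits those of
   Hall ratio at least [u]. *)
Lemma module_kernel (u : R) C v tau : 0 < u -> u <= tau -> conn (@adj G) C -> acpl [set v] C ->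
  concentrated u C tau ->
  64%:R * tau <= rho C -> 64%:R <= rho C ->
  exists X1 : {set G}, [/\ X1 \subset C, rho C / 8%:R <= rho X1 &
   forall c0, c0 \in X1 -> exists D : {set G}, [/\ D \subset C, rho C / 2%:R <= rho D &
     forall w, adj v w -> adj c0 w -> rho (D :\: nb w) <= u]].
Proof.
move=> u0 ut cC aC ccC ct c64.
(* [X] is a smallest heavy connected module, and [X1] below is its large anticomponent. *)
have [|X [[sX mX] cX rX] minX] := @ex_min_set _
   (fun X => [/\ module_in C X, conn (@adj G) X & rho C / 4%:R <= rho X]).
  by exists C; split=> //; [split=> // x a b ->|lra].
have [|X1 [sX1 acX1 cplX1 rX1]] := @big_anticomponent u X tau u0 ut (concentratedS sX ccC);
  first by lra.
exists X1; split; [exact: subset_trans sX1 sX|lra|].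
move=> c0 c0X1; have c0C : c0 \in C by apply: (subsetP sX); apply: (subsetP sX1).
pose good F := [/\ module_in C F, conn (@adj G) F & c0 \notin F].
(* A heavy good [F] is not pure to [X1], by concentration, so it meets [X]; by minimality it has
   some [g] outside [X]. Connectivity of [X] makes [g] complete to [X], hence [F] complete to
   [X :\: F]. As [X1] is anticonnected and contains [c0], it misses [F] and is complete to it, a
   contradiction. *)
have small F : good F -> rho F < rho C / 4%:R.
  move=> [[sF mF] cF c0F]; rewrite ltNge; apply/negP => rF.
  have noX1F : ~ pure X1 F.
    move=> p; have := concentrated_pair u0 ut ccC (subset_trans sX1 sX) sF p; lra.
  have [dFX|[f /setIP[fF fX]]] := set_0Vmem (F :&: X).
    apply: noX1F; rewrite pureC; apply: pureW (subxx F) sX1 _.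
    by apply: (@module_pure C) => //; rewrite -setI_eq0 dFX.
  have c0X : c0 \in X by apply: (subsetP sX1).
  have [sFX|/subsetPn[g gF gX]] := boolP (F \subset X).
    have : (#|X| <= #|F|)%N by apply: minX.
    by rewrite leqNgt proper_card //; apply/properP; split=> //; exists c0.
  have [b [a [bX aX bF aF eba]]] := cX F f c0 fX c0X fF c0F.
  have ag : adj a g by rewrite (mF a g b) ?(subsetP sX) // adj_sym.
  have gC : g \in C by apply: (subsetP sF).
  have gX' x : x \in X -> adj g x by move=> xX; rewrite (mX g x a) // adj_sym.
  have XF x y : x \in X -> x \notin F -> y \in F -> adj x y.
    by move=> xX xF yF; rewrite (mF x y g) ?(subsetP sX) // adj_sym gX'.
  have X1F x : x \in X1 -> x \notin F.
    move=> xX1; apply/negP => xF.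
    have [p [q [pX qX pF qF]]] := acX1 F x c0 xX1 c0X1 xF c0F.
    by rewrite nadj_sym /nadj XF ?andbF // (subsetP sX1).
  apply: noX1F; rewrite /pure; apply/orP; left; apply/cplP => x y xX1 yF.
  by apply: XF => //; [apply: (subsetP sX1)|apply: X1F].
pose maxg F := good F /\ forall Y, good Y -> F \subset Y -> Y = F.
pose big := [set F : {set G} | `[< maxg F >] && (u <= rho F)].
have maxg_disj E F z : maxg E -> maxg F -> z \in E -> z \in F -> E = F.
  move=> [[mE cE nE] hE] [[mF cF nF] hF] zE zF.
  have gU : good (E :|: F).
    split; [exact: module_union zE zF|exact: conn_meet zE zF|by rewrite inE negb_or nE].
  by rewrite -(hE _ gU (subsetUl _ _)) -[RHS](hF _ gU (subsetUr _ _)).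
(* Maximal good modules are disjoint, since two that meet have a good union; hence they are pairwise
   pure. All but one have a negligible union, and the exception is bounded by [small]. *)
have [||E0 rE0] := ccC big.
- by move=> F; rewrite inE => /andP[/asboolP[[[sF _] _ _] _] ->].
- move=> E F; rewrite !inE => /andP[/asboolP mE _] /andP[/asboolP mF _] nEF.
  apply: (@module_pure C); [by case: mE => [[]]|by case: mF => [[]]|].
  rewrite -setI_eq0; apply: contraNT nEF => /set0Pn[z /setIP[zE zF]].
  by apply/eqP; apply: (maxg_disj E F z).
have rbig : rho (cover big) <= rho C / 4%:R + tau.
  have [E0b|E0b] := boolP (E0 \in big); last first.
    have -> : big = big :\ E0 by apply/esym/setDidPl; rewrite disjoint_sym disjoints1.
    by have := rho_ge0 R C; lra.
  apply: le_trans (_ : rho E0 + rho (cover (big :\ E0)) <= _).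
    by apply: rho_split; rewrite /cover (big_setD1 E0).
  rewrite inE in E0b; case/andP: E0b => /asboolP[g _] _; have := small _ g; lra.
pose D := (C :\: cover big) :\ c0.
have rD : rho C / 2%:R <= rho D.
  have := rhoD R C (cover big); have := rhoD R (C :\: cover big) [set c0].
  by rewrite rho_set1 -/D; lra.
exists D; split=> //; first by rewrite /D; apply: subset_trans (subsetDl _ _) (subsetDl _ _).
move=> w vw c0w; have [K [sK cK _ <-]] := component_rho (D :\: nb w).
have [->|[k kK]] := set_0Vmem K; first by rewrite rho0; lra.
have sKC : K \subset C :\: nb w.
  apply: subset_trans sK _; apply: setSD; rewrite /D.
  by apply: subset_trans (subsetDl _ _) (subsetDl _ _).
have [E [sE kE cE aE]] := component (subsetP sKC _ kK).
have mE := nonneighbour_component_module aC vw cE sE aE.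
have gE : good E by split=> //; apply/negP => /(subsetP sE); rewrite !inE adj_sym c0w.
have [F [gF sEF] hF] := @ex_maximal_sup _ good E gE.
have kD : k \in D by have := subsetP sK _ kK; rewrite inE => /andP[].
have Fnb : F \notin big.
  apply/negP => Fb; move: kD; rewrite !inE => /and3P[_ + _]; apply/negP; rewrite negbK.
  by apply/bigcupP; exists F => //; apply: (subsetP sEF).
have : rho K <= rho F.
  apply: rhoS; apply: subset_trans sEF; exact: conn_in_closed aE kK kE.
have : rho F < u.
  move: Fnb; rewrite inE negb_and => /orP[/asboolP[]//|]; by rewrite -ltNge.
lra.
Qed.

Definition pfam (u : R) A P :=
  [forall X in P, (X \subset A) && (u <= rho X)] &&
  [forall X in P, forall Y in P, (X != Y) ==> pure X Y].

Lemma pfamP u A P : reflect ((forall X, X \in P -> X \subset A /\ u <= rho X) /\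
   {in P &, forall X Y, X != Y -> pure X Y}) (pfam u A P).
Proof.
apply: (iffP andP) => [[/forall_inP h1 /forall_inP h2]|[h1 h2]]; split.
- by move=> X /h1/andP.
- by move=> X Y /h2/forall_inP h /h/implyP.
- by apply/forall_inP => X /h1[-> ->].
- by apply/forall_inP => X XP; apply/forall_inP => Y YP; apply/implyP; apply: h2.
Qed.

Definition pnum (u : R) A : nat := \max_(P : {set {set G}} | pfam u A P) #|P|.

Lemma pnum_ge u A P : pfam u A P -> (#|P| <= pnum u A)%N.
Proof. by move=> h; rewrite /pnum (bigD1 P) //= leq_maxl. Qed.

Lemma pnum_wit u A : {P : {set {set G}} | pfam u A P & pnum u A = #|P|}.
Proof.
apply: eq_bigmax_cond; apply/card_gt0P; exists set0; rewrite unfold_in.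
by apply/pfamP; split=> [X|X Y]; rewrite inE.
Qed.

Lemma pnumS u A B : A \subset B -> (pnum u A <= pnum u B)%N.
Proof.
move=> s; have [P /pfamP[h1 h2] ->] := pnum_wit u A; apply: pnum_ge; apply/pfamP; split=> // X XP.
by have [sX ?] := h1 X XP; split=> //; apply: subset_trans s.
Qed.

Lemma pnum_gt0 u A : u <= rho A -> (0 < pnum u A)%N.
Proof.
move=> h; rewrite -(cards1 A); apply: pnum_ge; apply/pfamP; split.
  by move=> X /set1P->.
by move=> X Y /set1P-> /set1P->; rewrite eqxx.
Qed.

(** The optimal families of the members of [P] can be merged: pieces of different members inherit
    their purity. Positivity of [u] makes all pieces nonempty, so that none is counted twice. *)
Lemma pnum_sum u A P : 0 < u -> pfam u A P -> (\sum_(E in P) pnum u E <= pnum u A)%N.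
Proof.
move=> u0 /pfamP[h1 h2].
pose W E := s2val (pnum_wit u E).
have WP E : pfam u E (W E) by apply: (s2valP (pnum_wit u E)).
have WE E : pnum u E = #|W E| by apply: (s2valP' (pnum_wit u E)).
pose F E := if E \in P then W E else set0.
have dF E E' : E != E' -> [disjoint F E & F E'].
  move=> n; rewrite -setI_eq0; apply/eqP/setP => X; rewrite !inE /F.
  case: ifP => EP; last by rewrite inE.
  case: ifP => E'P; last by rewrite inE andbF.
  apply/negP => /andP[XE XE'].
  have /pfamP[/(_ X XE)[sX rX] _] := WP E; have /pfamP[/(_ X XE')[sX' _] _] := WP E'.
  have [x xX] : exists x, x \in X by apply: (@rho_gt0_ex R); lra.
  have := pure_disj (h2 _ _ EP E'P n); rewrite -setI_eq0 => /eqP/setP/(_ x).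
  by rewrite !inE (subsetP sX) // (subsetP sX').
have -> : (\sum_(E in P) pnum u E = #|\bigcup_E F E|)%N.
  rewrite -sum1_card partition_disjoint_bigcup // big_mkcond /=; apply: eq_bigr => E _.
  by rewrite sum1_card /F; case: ifP => _; rewrite ?cards0.
apply: pnum_ge; apply/pfamP; split.
  move=> X /bigcupP[E _]; rewrite /F; case: ifP => EP; last by rewrite inE.
  have /pfamP[H _] := WP E; move=> /H[sX ?]; split=> //.
  by apply: subset_trans sX (h1 E EP).1.
move=> X Y /bigcupP[E _ XE] /bigcupP[E' _ YE'] nXY; move: XE YE'; rewrite /F.
case: ifP => EP; last by rewrite inE.
case: ifP => E'P; last by rewrite inE.
have [EE|nE] := eqVneq E E'.
  by rewrite -EE => XE YE; have /pfamP[_] := WP E; apply.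
move=> XE YE; have /pfamP[/(_ X XE)[sX _] _] := WP E; have /pfamP[/(_ Y YE)[sY _] _] := WP E'.
exact: pureW sX sY (h2 _ _ EP E'P nE).
Qed.

(* The exponent is chosen so that a factor [160] lost in [rho] is paid for when
   the number of required blocks drops to two thirds: [(3 / 2) ^ 14 >= 160]. *)
Definition phi (u : R) A : R := rho A / (pnum u A)%:R ^+ 14.

Definition rigid (u : R) A := conn (@adj G) A /\
  forall E, E \subset A -> u <= rho E -> phi u E <= phi u A.

Lemma phi_le_sub u A E c : 0 < c -> E \subset A -> u <= rho E -> rho A <= c * rho E ->
  phi u A <= c * phi u E.
Proof.
move=> c0 s uE h; rewrite /phi mulrA; have p : (0 < pnum u E)%N by apply: pnum_gt0.
have p' : (pnum u E <= pnum u A)%N by apply: pnumS.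
apply: le_trans (_ : c * rho E / (pnum u A)%:R ^+ 14 <= _).
  by rewrite ler_wpM2r // invr_ge0 exprn_ge0.
rewrite ler_wpM2l //; first by rewrite mulr_ge0 ?rho_ge0 // ltW.
rewrite lef_pV2 ?posrE ?exprn_gt0 ?ltr0n //; last exact: leq_trans p'.
by rewrite lerXn2r ?nnegrE ?ler_nat.
Qed.

(** A maximizer of [phi] of least cardinality is connected, because its component of full Hall ratio
    has at least the same potential. *)
Lemma exists_rigid u A : 0 < u -> u <= rho A ->
  exists A' : {set G}, [/\ A' \subset A, u <= rho A', rigid u A' & phi u A <= phi u A'].
Proof.
move=> u0 uA.
have [|A0 [s0 r0] m0] := @ex_max_real _ R (fun E => E \subset A /\ u <= rho E) (phi u).
  by exists A.
have [|A1 [s1 r1 h1] m1] := @ex_min_set _ (fun E => [/\ E \subset A0,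
  u <= rho E & phi u A0 <= phi u E]).
  by exists A0.
have sA1 := subset_trans s1 s0.
exists A1; split=> //; last by apply: le_trans h1; apply: m0.
split; last by move=> E sE rE; apply: le_trans h1; apply: m0; split=> //; apply: subset_trans sA1.
have [C [sC cC _ rC]] := component_rho A1.
suff <- : C = A1 by [].
apply/eqP; rewrite eqEcard sC m1 //; split; [exact: subset_trans s1|by rewrite rC|].
apply: le_trans h1 _; rewrite -[X in _ <= X]mul1r; apply: phi_le_sub; rewrite ?rC ?mul1r //.
Qed.

(* Of two pure sets one has at most half of [pnum u A], hence, by maximality
   of [phi], at most a [2 ^- 14] fraction of the Hall ratio. *)
Lemma rigid_concentrated u A : 0 < u -> u <= rho A -> rigid u A ->
  concentrated u A (rho A / 2%:R ^+ 13).
Proof.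
move=> u0 uA [_ rig] P h1 h2.
have [->|[E1 E1P]] := set_0Vmem P.
  by exists set0; rewrite set0D /cover big_set0 rho0 divr_ge0 ?rho_ge0 ?exprn_ge0.
case: (arg_maxnP (P := fun E => E \in P) (pnum u) E1P) => E0 E0P m0.
exists E0; have pf : pfam u A P by apply/pfamP.
have sumP := pnum_sum u0 pf.
have pA : (0 < pnum u A)%N by apply: pnum_gt0.
pose p : R := (pnum u A)%:R.
have p0 : 0 < p by rewrite ltr0n.
(* [E0] has the largest [pnum], so every other member has at most [p / 2]. Thirteen of the fourteen
   factors [pnum u E / p] are bounded by [1 / 2]; the last is kept, to be summed by [pnum_sum]. *)
have bnd E : E \in P :\ E0 -> rho E <= rho A / 2%:R ^+ 13 * ((pnum u E)%:R / p).
  rewrite inE => /andP[nE EP]; have [sE rE] := h1 _ EP.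
  rewrite inE in nE.
  have q0 : (0 < pnum u E)%N by apply: pnum_gt0.
  have h : (2 * pnum u E <= pnum u A)%N.
    apply: leq_trans sumP; rewrite (bigD1 E0) //= (bigD1 E) /=; last by rewrite EP nE.
    have := m0 _ EP; lia.
  have := rig _ sE rE; rewrite /phi ler_pdivrMr ?exprn_gt0 ?ltr0n // => h3.
  apply: le_trans h3 _; rewrite -/p.
  set q : R := (pnum u E)%:R.
  have hq : 2%:R * q <= p by rewrite /q /p -natrM ler_nat.
  have q0' : 0 < q by rewrite ltr0n.
  rewrite -!mulrA ler_wpM2l ?rho_ge0 // [X in X <= _]mulrC ler_pdivrMr ?exprn_gt0 //.
  rewrite -[14%N]/(13.+1) !(exprS _ 13).
  set a := q ^+ 13; set b := p ^+ 13.
  have h13 : (2%:R * q) ^+ 13 <= b by rewrite lerXn2r ?nnegrE //; lra.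
  rewrite exprMn -/a in h13.
  have -> : (2%:R ^+ 13)^-1 * (q / p) * (p * b) = q * (b / 2%:R ^+ 13).
    have pn : p != 0 by rewrite gt_eqF.
    have tn : 2%:R ^+ 13 != 0 :> R by rewrite expf_neq0 // pnatr_eq0.
    by move: tn; generalize (2%:R ^+ 13 : R) => t tn; field; rewrite ?pn ?tn.
  rewrite ler_wpM2l ?(ltW q0') // ler_pdivlMr ?exprn_gt0 // mulrC //.
have : rho (cover (P :\ E0)) <= \sum_(E in P :\ E0) rho E.
  rewrite /cover; elim/big_rec2: _ => [|E x S ES h]; first by rewrite rho0.
  by apply: le_trans (rhoU _ _ _) _; rewrite lerD2l.
move=> h; apply: le_trans h _; apply: le_trans (_ : \sum_(E in P :\ E0) rho A / 2%:R ^+ 13 *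
  ((pnum u E)%:R / p) <= _).
  by apply: ler_sum => E EP; apply: bnd.
rewrite -mulr_sumr -[X in _ <= X]mulr1 ler_wpM2l ?divr_ge0 ?rho_ge0 ?exprn_ge0 //.
rewrite -mulr_suml ler_pdivrMr // mul1r -natr_sum ler_nat.
by apply: leq_trans sumP; rewrite [X in (_ <= X)%N](big_setD1 E0) //= leq_addl.
Qed.

End Modules.

(** * Sequences of dense blocks *)

Section Blocks.
Variables (R : realType) (G : sgraph).
Implicit Types (A B C D E F I J K X Y Z S T : {set G}) (k x y z v w : G).
Implicit Types (P Q : {set G}) (s : seq {set G}).

Local Notation rho := (@rho R G).

(** The relation is oriented: vertices of the earlier block [X] see nearly all of the later block
    [Y], with no condition on vertices of [Y]. *)
Definition dense_after (delta : R) X Y :=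
  [disjoint X & Y] && [forall x in X, rho (Y :\: nb x) <= delta * rho Y].

Definition blocks (delta sigma : R) A s :=
  all (fun B => (B \subset A) && (sigma <= rho B)) s && pairwise (dense_after delta) s.

Definition has_blocks (delta sigma : R) A (N : nat) := exists2 s,
  blocks delta sigma A s & size s = N.

Lemma has_blocksS delta sigma A B N : A \subset B -> has_blocks delta sigma A N ->
  has_blocks delta sigma B N.
Proof.
move=> sAB [s /andP[/allP h p] sz]; exists s => //; rewrite /blocks p andbT.
by apply/allP => X /h/andP[sX ->]; rewrite (subset_trans sX).
Qed.

Lemma has_blocks_sigma delta sigma sigma' A N : sigma <= sigma' -> has_blocks delta sigma' A N ->
  has_blocks delta sigma A N.
Proof.
move=> sAB [s /andP[/allP h p] sz]; exists s => //; rewrite /blocks p andbT.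
by apply/allP => X /h/andP[-> sX] /=; apply: le_trans sX.
Qed.

Lemma has_blocks0 delta sigma A : has_blocks delta sigma A 0.
Proof. by exists [::]. Qed.

Lemma has_blocks1 delta sigma A : sigma <= rho A -> has_blocks delta sigma A 1.
Proof. by move=> h; exists [:: A]; rewrite // /blocks /= subxx h. Qed.

Lemma has_blocks_cat delta sigma A P Q n m : 0 <= delta -> P \subset A -> Q \subset A ->
  [disjoint P & Q] ->
  (forall x, x \in P -> rho (Q :\: nb x) <= delta * sigma) ->
  has_blocks delta sigma P n -> has_blocks delta sigma Q m -> has_blocks delta sigma A (n + m).
Proof.
move=> d0 sP sQ dPQ h [s /andP[/allP hs ps] <-] [t /andP[/allP ht pt] <-].
exists (s ++ t); last by rewrite size_cat.
rewrite /blocks all_cat pairwise_cat ps pt !andbT; apply/andP; split.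
  apply/andP; split; apply/allP => B.
    by move/hs=> /andP[sB ->]; rewrite (subset_trans sB).
  by move/ht=> /andP[sB ->]; rewrite (subset_trans sB).
apply/allrelP => X Y /hs/andP[sX rX] /ht/andP[sY rY]; apply/andP; split.
  by apply: disjointWl sX _; apply: disjointWr sY _.
apply/forall_inP => x xX; apply: le_trans (_ : delta * sigma <= _).
  by apply: le_trans (h x (subsetP sX _ xX)); apply: rhoS; apply: setSD.
by rewrite ler_wpM2l.
Qed.

(** Cut [T] along [f], each time taking a smallest initial segment of Hall ratio at least [sigma].
    Removing its top vertex drops it below [sigma], so it costs at most [sigma + 1 <= 2 * sigma]. *)
Lemma ordered_partition (f : G -> nat) delta sigma T N : 0 <= delta -> 1 <= sigma ->
  2%:R * N%:R * sigma <= rho T ->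
  (forall x, x \in T -> rho [set y in T | (f x <= f y)%N && ~~ adj x y] <= delta * sigma) ->
  has_blocks delta sigma T N.
Proof.
move=> d0 s1; elim: N T => [|N IH] T hT dT; first exact: has_blocks0.
have [|W [sW iW rW] mW] := @ex_min_set _ (fun W => [/\ W \subset T,
    (forall x y, x \in W -> y \in T :\: W -> (f x <= f y)%N) & sigma <= rho W]).
  exists T; split=> //; first by move=> x y _; rewrite setDv inE.
  rewrite -natr1 in hT; have := ler0n R N; nra.
have [w wW] : exists w, w \in W by apply: (@rho_gt0_ex R); lra.
case: (arg_maxnP (P := fun x => x \in W) f wW) => x xW mx.
have rWx : rho (W :\ x) < sigma.
  rewrite ltNge; apply/negP => h.
  have : (#|W| <= #|W :\ x|)%N.
    apply: mW; split=> //; first by apply: subset_trans sW; apply: subsetDl.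
    move=> y z /setD1P[yx yW] /setDP[zT]; rewrite in_setD1 negb_and negbK => /orP[/eqP->|zW].
      exact: mx.
    by apply: iW => //; rewrite inE zW.
  by rewrite leqNgt (card_setD_lt (x := x)) ?inE.
have rW2 : rho W <= 2%:R * sigma by have := rhoD R W [set x]; rewrite rho_set1; lra.
rewrite -add1n; apply: (has_blocks_cat (P := W) (Q := T :\: W)) => //; rewrite ?subsetDl //.
- by rewrite disjoint_sym disjoints_subset; apply/subsetP => y; rewrite !inE => /andP[].
- move=> y yW; apply: le_trans (dT y (subsetP sW _ yW)); apply: rhoS.
  apply/subsetP => z /setDP[zTW]; rewrite in_nb => nyz.
  by rewrite inE nyz andbT (iW y z) //; case/setDP: zTW => ->.
- exact: has_blocks1.
apply: IH.
  have := rhoD R T W; rewrite -natr1 in hT; lra.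
move=> y /setDP[yT _]; apply: le_trans (dT y yT); apply: rhoS.
by apply/subsetP => z; rewrite !inE => /andP[/andP[_ ->]].
Qed.

Lemma direct_partition delta sigma T N : 0 <= delta -> 1 <= sigma ->
  2%:R * N%:R * sigma <= rho T -> (forall x, x \in T -> rho (T :\: nb x) <= delta * sigma) ->
  has_blocks delta sigma T N.
Proof.
move=> d0 s1 hT dT; apply: (@ordered_partition (fun _ => 0%N)) => // x xT.
apply: le_trans (dT x xT); apply: rhoS; apply/subsetP => y.
by rewrite !inE leqnn /= andbC.
Qed.

Hypothesis noP5 : no_path5 G.

Section Dominant.
Variables (u tau : R) (A C : {set G}) (v : G).
Hypotheses (u0 : 0 < u) (utau : u <= tau) (cA : concentrated u A tau) (sC : C \subset A).
Hypotheses (vC : acpl [set v] C) (rC : 64%:R * tau <= rho C).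

Let domc w D := [/\ conn (@adj G) D, D \subset C :\: nb w,
  acpl D ((C :\: nb w) :\: D) & tau < rho D].

Let attach D := [set x in C :\: D | [exists y in D, adj x y]].

Let domc_sub w D : domc w D -> D \subset C.
Proof. by case=> _ s _ _; apply: subset_trans s (subsetDl _ _). Qed.

Let domc_attach w D : adj v w -> domc w D -> cpl D (attach D).
Proof.
move=> vw [cD sD aD rD]; have [_ mD] := nonneighbour_component_module noP5 vC vw cD sD aD.
apply/cplP => a x aD'; rewrite !inE => /andP[/andP[xD xC] /exists_inP[y yD xy]].
by rewrite adj_sym (mD x a y).
Qed.

Let domc_rest D : D \subset C -> acpl D ((C :\: attach D) :\: D).
Proof.
move=> sD; apply: acpl_split => a b aD /setDP[/setDP[bC bn] bD].
apply: contra bn => ab; rewrite !inE bD bC; apply/exists_inP; exists a => //.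
by rewrite adj_sym.
Qed.

(** Both [attach D], complete to [D], and the remaining vertices, anticomplete to [D], are pure to
    the heavy set [D]; concentration bounds each by [tau]. *)
Let domc_big w D : adj v w -> domc w D -> rho (C :\: D) <= 2%:R * tau.
Proof.
move=> vw dD; have sD := domc_sub dD.
have sDA := subset_trans sD sC.
have rD : tau < rho D by case: dD.
have sat : attach D \subset C by apply/subsetP => x; rewrite !inE => /andP[/andP[]].
have h1 : rho (attach D) <= tau.
  apply: (concentrated_pair u0 utau cA sDA) rD; first exact: subset_trans sC.
  by rewrite /pure (domc_attach vw dD).
have h2 : rho ((C :\: attach D) :\: D) <= tau.
  apply: (concentrated_pair u0 utau cA sDA) rD.
    by apply: subset_trans sC; apply: subset_trans (subsetDl _ _) (subsetDl _ _).
  by rewrite /pure (domc_rest sD) orbT.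
have : rho (C :\: D) <= rho (attach D) + rho ((C :\: attach D) :\: D).
  apply: rho_split; apply/subsetP => x /setDP[xC xD].
  by rewrite inE orbC; case: (boolP (x \in attach D)); rewrite ?orbT // => n;
    rewrite !in_setD xC xD n.
lra.
Qed.

Let attach_nb w D x : domc w D -> x \in attach D -> adj w x.
Proof.
move=> [_ sD aD _]; rewrite !inE => /andP[/andP[xD xC] /exists_inP[y yD xy]].
apply: contraT => n; have := (acplP _ _ aD) y x yD; rewrite !inE xD xC n /nadj adj_sym xy andbF.
by move/(_ isT).
Qed.

(** If [D'] left [D], it would contain an attachment [x] of [D], and [y x w v w'] would be an
    induced path. *)
Let domc_sub2 w w' D D' y : adj v w -> adj v w' -> nadj w w' -> domc w D -> domc w' D' ->
  y \in D -> y \in D' -> D' \subset D.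
Proof.
move=> vw vw' /andP[_ nww] dD dD' yD yD'.
have sD := domc_sub dD; have sD' := domc_sub dD'.
have nv z : z \in C -> ~~ adj v z by case/(acpl1P vC)/andP.
apply: (conn_in_closed (X := C :\: attach D) (k := y)) => //; last exact: domc_rest;
  first by case: dD'.
apply/subsetP => x xD'; rewrite inE (subsetP sD') // andbT; apply/negP => xat.
have wx := attach_nb dD xat.
have w'n z : z \in D' -> ~~ adj w' z.
  by case: dD' => _ /subsetP s _ _ /s; rewrite !inE => /andP[].
have wn z : z \in D -> ~~ adj w z.
  by case: dD => _ /subsetP s _ _ /s; rewrite !inE => /andP[].
have yx : adj y x by apply: (cplP _ _ (domc_attach vw dD)).
have [xC yC] := (subsetP sD' _ xD', subsetP sD _ yD).
by apply: (@noP5 y x w v w') => //;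
  rewrite ?(adj_sym _ v) ?(adj_sym _ w) ?(adj_sym _ w') ?w'n ?wn ?nv // adj_sym.
Qed.

(** Heavy components for nonadjacent [w], [w'] meet, because each is almost all of [C], and so
    coincide. Along a large anticonnected [K] inside [S] a single component [D0] therefore serves
    all vertices, so [K] and [D0] are two heavy anticomplete sets, against concentration. *)
Lemma mixed_small S : S \subset A -> (forall w, w \in S -> adj v w /\ tau < rho (C :\: nb w)) ->
  rho S <= 3%:R * tau.
Proof.
have [u0' [ut rC']] := (u0, (utau, rC)).
move=> sS hS; rewrite leNgt; apply/negP => rS.
have [K [sK cK _ rK]] := big_anticomponent u0 utau (concentratedS sS cA) rS.
have tau0 : 0 < tau by lra.
have vK w : w \in K -> adj v w by move/(subsetP sK)/hS=> [].
have ex w : w \in K -> exists D, domc w D.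
  move=> /(subsetP sK)/hS[_ h]; have [D [sD cD aD rD]] := component_rho R (C :\: nb w).
  by exists D; split=> //; rewrite rD.
have uniqD w w' D D' : w \in K -> w' \in K -> nadj w w' -> domc w D -> domc w' D' -> D = D'.
  move=> wK w'K n dD dD'.
  have [y yD yD'] : exists2 y, y \in D & y \in D'.
    have [dis|[y /setIP[]]] := set_0Vmem (D :&: D'); last by exists y.
    have h1 := domc_big (vK _ wK) dD; have h2 := domc_big (vK _ w'K) dD'.
    have s : D' \subset C :\: D by rewrite subsetD (domc_sub dD') -setI_eq0 setIC dis eqxx.
    have := rhoS R s; have := rhoD R C D'; lra.
  apply/eqP; rewrite eqEsubset (@domc_sub2 w' w D' D y) 1?nadj_sym ?vK //.
  by rewrite (@domc_sub2 w w' D D' y) ?vK.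
have [w0 w0K] : exists w, w \in K by apply: (@rho_gt0_ex R); lra.
have [D0 dD0] := ex _ w0K.
have all0 w : w \in K -> domc w D0.
  move=> wK; apply: contrapT => nd.
  have [||a [b [aK bK aP bP nab]]] := cK [set w | `[< domc w D0 >]] w0 w w0K wK; rewrite ?inE.
  - exact/asboolP.
  - exact/asboolP.
  have [D' dD'] := ex _ bK.
  move: bP; rewrite inE => /asboolP; apply; rewrite inE in aP; move/asboolP: aP => da.
  by rewrite (uniqD a b D0 D').
have sD0 := domc_sub dD0; have rD0 : tau < rho D0 by case: dD0.
have : rho K <= tau.
  apply: (concentrated_pair u0 utau cA (subset_trans sD0 sC) (subset_trans sK sS)) rD0.
  rewrite /pure; apply/orP; right; apply/acplP => d w dD wK; rewrite nadj_sym.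
  have [_ s _ _] := all0 w wK; have := subsetP s _ dD; rewrite !inE => /andP[n dC].
  rewrite /nadj n andbT; apply: contraTneq (vK _ wK) => ->.
  by case/(acpl1P vC)/andP: dC.
lra.
Qed.

End Dominant.

(** Double counting in tight subsets of [F] and [X]: each vertex of [F'] misses at most half of
    [X'], so some [c0] in [X'] misses at most half of [F']. Tightness turns this half back into Hall
    ratio. *)
Lemma averaging (eps : R) F X : 0 < rho F -> 0 < rho X ->
  (forall w, w \in F -> rho (X :\: nb w) <= eps) -> 2%:R * eps <= rho X ->
  exists2 c0, c0 \in X & exists P : {set G}, [/\ P \subset F,
    P \subset nb c0 & rho F <= 2%:R * rho P].
Proof.
move=> rF rX hF he.
have [F' [sF EF tF]] := rho_tight R F; have [X' [sX EX tX]] := rho_tight R X.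
have [x0 x0X] : exists x, x \in X' by apply: (@rho_gt0_ex R); rewrite EX.
have [f0 f0F] : exists x, x \in F' by apply: (@rho_gt0_ex R); rewrite EF.
have X0 : 0 < #|X'|%:R :> R by rewrite ltr0n; apply/card_gt0P; exists x0.
have F0 : 0 < #|F'|%:R :> R by rewrite ltr0n; apply/card_gt0P; exists f0.
have half w : w \in F' -> (#|X' :\: nb w| * 2 <= #|X'|)%N.
  move=> wF; have h := tX (X' :\: nb w) (subsetDl _ _).
  have h2 : rho (X' :\: nb w) <= eps.
    by apply: le_trans (hF w (subsetP sF _ wF)); apply/rhoS/setSD.
  rewrite -(ler_nat R) natrM -(ler_pM2l rX) -EX mulrA.
  rewrite EX in h *.
  have : rho (X' :\: nb w) * #|X'|%:R <= eps * #|X'|%:R by rewrite ler_wpM2r // ltW.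
  nra.
have key : (\sum_(c in X') (#|F' :\: nb c| * 2) <= \sum_(c in X') #|F'|)%N.
  have -> : (\sum_(c in X') (#|F' :\: nb c| * 2) = \sum_(w in F') (#|X' :\: nb w| * 2))%N.
    rewrite -!big_distrl /=; congr (_ * _)%N.
    have E (S T : {set G}) : (\sum_(c in S) #|T :\: nb c| = \sum_(c in S) \sum_(w in T) ~~ adj c
      w)%N.
      apply: eq_bigr => c _; rewrite -sum1_card big_mkcond [RHS]big_mkcond /=;
        apply: eq_bigr => w _.
      by rewrite !inE; case: (w \in T); case: (adj c w).
    rewrite !E exchange_big /=; apply: eq_bigr => w _; apply: eq_bigr => c _; by rewrite adj_sym.
  apply: leq_trans (_ : \sum_(w in F') #|X'| <= _)%N; first by apply: leq_sum.
  by rewrite !sum_nat_const mulnC.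
have [c0 c0X h0] : exists2 c0, c0 \in X' & (#|F' :\: nb c0| * 2 <= #|F'|)%N.
  apply: contrapT => H; move: key; apply/negP; rewrite -ltnNge.
  rewrite [X in (_ < X)%N](bigD1 x0) //= (bigD1 x0) //= -addSn leq_add //.
    by rewrite ltnNge; apply/negP => h; apply: H; exists x0.
  apply: leq_sum => c /andP[cX _]; apply: ltnW; rewrite ltnNge; apply/negP => h.
  by apply: H; exists c.
exists c0; first exact: (subsetP sX).
exists (F' :&: nb c0); split.
- by apply: subset_trans sF; apply: subsetIl.
- exact: subsetIr.
have h := tF (F' :&: nb c0) (subsetIl _ _).
have hc : (#|F'| <= #|F' :&: nb c0| * 2)%N by have := cardsID (nb c0) F'; move: h0; clear; lia.
rewrite -(ler_pM2r F0) -EF -mulrA; apply: le_trans (_ : rho F' * (#|F' :&: nb c0| * 2)%:R <= _).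
  by rewrite ler_wpM2l ?rho_ge0 ?ler_nat.
rewrite natrM mulrA mulrC ler_wpM2l //.
Qed.

Lemma phi_le_rho u A : phi u A <= rho A.
Proof.
rewrite /phi; case: (pnum u A) => [|p]; first by rewrite expr0n invr0 mulr0 rho_ge0.
by rewrite ler_pdivrMr ?exprn_gt0 // ler_peMr ?rho_ge0 // exprn_ege1 // ler1n.
Qed.

End Blocks.

(** * Long block sequences from a large potential *)

Section DenseBlocks.
Variables (R : realType) (G : sgraph).
Implicit Types (A B C D E F I J K X Y Z S T : {set G}) (k x y z v w : G).
Implicit Types (P Q : {set G}) (s : seq {set G}).

Local Notation rho := (@rho R G).

Hypothesis noP5 : no_path5 G.

Lemma acpl_nonnb A v : acpl [set v] (nonnb A v).
Proof. by apply/acplP => a b /set1P->; rewrite nonnbP /nadj eq_sym => /and3P[-> ->]. Qed.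

Lemma nonnb_sub A v : nonnb A v \subset A.
Proof. by apply: subset_trans (subsetDl _ _) (subsetDl _ _). Qed.

Lemma disjoint_nb_nonnb P Q A v : P \subset nb v -> Q \subset nonnb A v -> [disjoint P & Q].
Proof.
move=> /subsetP sP /subsetP sQ; rewrite -setI_eq0; apply/eqP/setP => x; rewrite !inE.
by apply/negP => /andP[/sP + /sQ]; rewrite nonnbP in_nb => -> /and3P[].
Qed.

(** [module_kernel] applied inside a rigid subset of [C]; rigidity supplies the concentration, and
    [Q] keeps half of the Hall ratio, hence half of the potential. Common neighbours of [v] and [c0]
    may precede [Q] in a block sequence. *)
Lemma kernel_split (u : R) C v : 0 < u -> acpl [set v] C -> 2%:R ^+ 13 * u <= phi u C ->
  2%:R ^+ 13 <= phi u C ->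
  exists (c0 : G) (Q : {set G}), [/\ c0 \in C, Q \subset C, phi u C <= 2%:R * phi u Q &
     forall w, adj v w -> adj c0 w -> rho (Q :\: nb w) <= u].
Proof.
move=> u0 aC hu h13; have hp := @phi_le_rho R G u C.
have t13 : 1 <= 2%:R ^+ 13 :> R by rewrite exprn_ege1 // ler1n.
have t7 : 2%:R ^+ 13 = 64%:R * 128%:R :> R by rewrite -natrM -natrX.
have uC : u <= rho C by nra.
have [C' [sC uC' rig hphi]] := exists_rigid u0 uC.
have hp' := @phi_le_rho R G u C'.
pose tau := rho C' / 2%:R ^+ 13.
have Etau : rho C' = 2%:R ^+ 13 * tau by rewrite mulrC divfK // gt_eqF //; lra.
have ut : u <= tau by rewrite ler_pdivlMr; lra.
have cc := rigid_concentrated u0 uC' rig; rewrite -/tau in cc.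
have aC' : acpl [set v] C' by apply: acplW aC.
have [||X1 [sX1 rX1 HX1]] := module_kernel noP5 u0 ut rig.1 aC' cc.
- by rewrite Etau; nra.
- by lra.
have [c0 c0X] : exists c0, c0 \in X1 by apply: (@rho_gt0_ex R); lra.
have [Q [sQ rQ HQ]] := HX1 c0 c0X.
exists c0, Q; split=> //; first by apply: (subsetP sC); apply: (subsetP sX1).
  exact: subset_trans sC.
apply: le_trans hphi _; apply: phi_le_sub => //; lra.
Qed.

(** By [mixed_small] most neighbours of [v] are nearly complete to the heavy component [C] of
    nonneighbours. Averaging against the kernel [X1] finds [c0] adjacent to half of them; these form
    [P], and the set [Q] of [c0] is dense after them. *)
Lemma mid_split (u : R) A v : 0 < u -> rigid u A -> 2%:R ^+ 13 * u <= rho A ->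
  2%:R ^+ 13 <= rho A ->
  rho A <= 40%:R * rho (A :&: nb v) -> rho A <= 80%:R * rho (nonnb A v) ->
  exists P Q : {set G}, [/\ P \subset A :&: nb v, Q \subset nonnb A v, rho A <= 160%:R * rho P,
    rho A <= 160%:R * rho Q & forall w, w \in P -> rho (Q :\: nb w) <= u].
Proof.
move=> u0 rig hu h13 hn hm.
have t13 : 1 <= 2%:R ^+ 13 :> R by rewrite exprn_ege1 // ler1n.
have t7 : 2%:R ^+ 13 = 64%:R * 128%:R :> R by rewrite -natrM -natrX.
have uA : u <= rho A by nra.
pose tau := rho A / 2%:R ^+ 13.
have Etau : rho A = 64%:R * 128%:R * tau by rewrite -t7 mulrC divfK // gt_eqF //; lra.
have ut : u <= tau by rewrite ler_pdivlMr; lra.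
have cA := rigid_concentrated u0 uA rig; rewrite -/tau in cA.
have [C [sC cC aC rC]] := component_rho R (nonnb A v).
have vC : acpl [set v] C by apply: acplW (acpl_nonnb A v).
have sCA : C \subset A by apply: subset_trans sC (nonnb_sub _ _).
have rC64 : 64%:R * tau <= rho C by rewrite rC; lra.
have [|X1 [sX1 rX1 HX1]] := module_kernel noP5 u0 ut cC vC (concentratedS sCA cA) rC64;
  first by lra.
pose Nb := [set w in A :&: nb v | rho (C :\: nb w) <= tau].
pose Ns := [set w in A :&: nb v | tau < rho (C :\: nb w)].
have rNs : rho Ns <= 3%:R * tau.
  apply: (mixed_small noP5 u0 ut cA sCA vC rC64).
    by apply/subsetP => w; rewrite !inE => /andP[/andP[]].
  by move=> w; rewrite !inE => /andP[/andP[_ ->]].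
have rNb : rho A <= 45%:R * rho Nb.
  have : rho (A :&: nb v) <= rho Nb + rho Ns.
    apply: rho_split; apply/subsetP => w; rewrite !inE => ->.
    by rewrite /=; case: leP.
  lra.
have Nbv w : w \in Nb -> adj v w by rewrite !inE => /andP[/andP[]].
have [||||c0 c0X [P [sP c0P rP]]] := @averaging _ _ tau Nb X1; [lra|lra| |lra|].
  move=> w; rewrite inE => /andP[_ h]; apply: le_trans h; apply: rhoS; exact: setSD.
have [Q [sQ rQ HQ]] := HX1 c0 c0X.
exists P, Q; split; [|exact: subset_trans sC|lra|lra|].
  by apply: subset_trans sP _; apply/subsetP => w; rewrite !inE => /andP[].
move=> w wP; apply: HQ; first by apply: Nbv; apply: (subsetP sP).
by have := subsetP c0P _ wP; rewrite in_nb.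
Qed.

(** Pays for a loss of [16 * q ^ 2] in potential when the number of blocks drops by a factor
    [q / 8]. *)
Lemma pow14_ratio (q n N : R) : 64%:R <= q -> 0 <= n -> 0 <= N -> n * q <= 8%:R * N ->
  16%:R * q ^+ 2 * n ^+ 14 <= N ^+ 14.
Proof.
move=> hq n0 N0 h.
have h1 : (n * q) ^+ 14 <= (8%:R * N) ^+ 14 by rewrite lerXn2r ?nnegrE ?mulr_ge0 //; lra.
have h2 : 64%:R ^+ 12 <= q ^+ 12 by rewrite lerXn2r ?nnegrE //; lra.
rewrite !exprMn in h1.
have p8 : 0 < 8%:R ^+ 14 :> R by rewrite exprn_gt0.
rewrite -(ler_pM2l p8); apply: le_trans h1.
have -> : q ^+ 14 = q ^+ 12 * q ^+ 2 by rewrite -exprD.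
have h3 : 8%:R ^+ 14 * 16%:R <= q ^+ 12.
  apply: le_trans h2.
  have -> : (64 = 8 * 8)%N by [].
  rewrite natrM exprMn -[(14)%N]/((12 + 2)%N) exprD -mulrA ler_wpM2l ?exprn_ge0 //.
  have -> : (12 = 4 + 8)%N by [].
  rewrite exprD; apply: le_trans (_ : 8%:R ^+ 4 * 1 <= _); first by rewrite -natrX; lra.
  by rewrite ler_wpM2l ?exprn_ge0 // exprn_ege1 // ler1n.
have : 0 <= n ^+ 14 by rewrite exprn_ge0.
have : 0 <= q ^+ 2 by rewrite sqr_ge0.
move=> h4 h5; have h6 : 0 <= q ^+ 2 * n ^+ 14 by rewrite mulr_ge0.
have := ler_wpM2r h6 h3; lra.
Qed.

Lemma pow14_half (n N : R) : 0 <= n -> 0 <= N -> 3%:R * n <= 2%:R * N ->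
  160%:R * n ^+ 14 <= N ^+ 14.
Proof.
move=> n0 N0 h.
have h7 : 0 <= n ^+ 7 by rewrite exprn_ge0.
have : (3%:R * n) ^+ 7 <= (2%:R * N) ^+ 7 by rewrite lerXn2r ?nnegrE ?mulr_ge0 //; lra.
rewrite !exprMn => h1; have N7 : 0 <= N ^+ 7 by rewrite exprn_ge0.
have -> : (14 = 7 * 2)%N by [].
rewrite !exprM; set a := n ^+ 7 in h7 h1 *; set b := N ^+ 7 in N7 h1 *.
have : 13%:R * a <= b by move: h1; rewrite -!natrX; lra.
nra.
Qed.

Section DenseStep.
Variables (u sigma delta L : R) (A : {set G}) (N Jx : nat).
Hypotheses (u0 : 0 < u) (ud : u <= delta * sigma) (d0 : 0 <= delta) (d1 : delta <= 1) (s1 : 1 <=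
  sigma).
Hypotheses (N2 : (2 <= N)%N) (L_def : L = 8%:R * (2%:R ^+ Jx) ^+ 2) (dJ : 2%:R * N%:R <= delta *
  2%:R ^+ Jx).
Hypothesis hA : sigma * L * N%:R ^+ 14 <= phi u A.
Hypothesis IHQ : forall Q v m, v \in A -> Q \subset A :\ v -> (0 < m <= N)%N -> sigma <= rho Q ->
  ((2 <= m)%N -> sigma * L * m%:R ^+ 14 <= phi u Q) -> has_blocks delta sigma Q m.

Let N14 : 2%:R ^+ 14 <= N%:R ^+ 14 :> R.
Proof. by rewrite lerXn2r ?nnegrE // ler_nat. Qed.

(** Induction on the number [i] of doublings left before the density [2 ^ j] reaches [2 ^ Jx], where
    [direct_partition] applies. Either half of [T] is twice as dense, or many vertices have sizeable
    nonneighbourhoods from which blocks are peeled off. *)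
Lemma dense_blocks i j T : (i + j = Jx)%N -> (6 <= j)%N -> T \subset A ->
  rho A <= 2%:R ^+ j * rho T ->
  (forall x, x \in T -> 2%:R ^+ j * rho (T :\: nb x) <= rho T) -> has_blocks delta sigma T N.
Proof.
have [u0' [ud' [d0' [d1' [s1' [dJ' hA']]]]]] := (u0, (ud, (d0, (d1, (s1, (dJ, hA)))))).
have N14' := N14.
have NR : 2%:R <= N%:R :> R by rewrite ler_nat.
have rA : sigma * L * N%:R ^+ 14 <= rho A by apply: le_trans hA' (phi_le_rho _ _).
have t14 : 2%:R ^+ 14 = 128%:R * 128%:R :> R by rewrite -natrM -natrX.
rewrite t14 in N14'.
have NN : N%:R <= N%:R ^+ 14 :> R by rewrite -[X in X <= _]expr1 ler_weXn2l //; lra.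
elim: i j T => [|i IH] j T ij j6 sT rT dT.
  rewrite add0n in ij; subst j; set q := 2%:R ^+ Jx in rT dT dJ' *.
  have q0 : 1 <= q by rewrite exprn_ege1 // ler1n.
  have L8 : L = 8%:R * q ^+ 2 by [].
  have hT : 2%:R * N%:R * sigma <= rho T.
    have p : 0 < q by lra.
    rewrite -(ler_pM2l p); apply: le_trans rT; apply: le_trans rA; rewrite L8.
    have -> : sigma * (8%:R * q ^+ 2) * N%:R ^+ 14 = q * (8%:R * q * (sigma * N%:R ^+ 14)) by ring.
    rewrite ler_pM2l //.
    have h1 : sigma * N%:R <= sigma * N%:R ^+ 14 by rewrite ler_wpM2l //; lra.
    have h2 : 0 <= sigma * N%:R by rewrite mulr_ge0 //; lra.
    have : sigma * N%:R <= q * (sigma * N%:R ^+ 14).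
      apply: (le_trans h1); rewrite ler_peMl //; exact: le_trans h2 h1.
    lra.
  have N0 : 0 < 2%:R * N%:R :> R by lra.
  pose sg := rho T / (2%:R * N%:R).
  have Esg : 2%:R * N%:R * sg = rho T by rewrite mulrC divfK // gt_eqF.
  have hsg : sigma <= sg by rewrite ler_pdivlMr // mulrC.
  apply: (has_blocks_sigma hsg); apply: direct_partition => //; [lra|by rewrite Esg|].
  move=> x xT; have := dT x xT; rewrite -Esg => h.
  have p : 0 < q by lra.
  rewrite -(ler_pM2l p); apply: le_trans h _.
  have : 0 <= sg by lra.
  nra.
set q := 2%:R ^+ j in rT dT *.
have q64 : 64%:R <= q.
  have -> : 64%:R = 2%:R ^+ 6 :> R by rewrite -natrX.
  by rewrite ler_weXn2l // ler1n.
have Lq : 8%:R * q ^+ 2 <= L.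
  by rewrite L_def ler_pM2l // lerXn2r ?nnegrE ?exprn_ge0 // ler_weXn2l ?ler1n // -ij leq_addl.
have [[T' [sT' rT' dT']]|HT] := EM (exists T' : {set G}, [/\ T' \subset T, rho T <= 2%:R * rho T' &
     forall x, x \in T' -> 4%:R * q * rho (T' :\: nb x) <= rho T]).
  apply: (has_blocksS sT'); apply: (IH j.+1); first by rewrite addnS -ij addSn.
  - exact: leqW.
  - exact: subset_trans sT.
  - rewrite exprS -/q; nra.
  by move=> x xT; rewrite exprS -/q; have := dT' x xT; lra.
have {}HT T' : T' \subset T -> rho T <= 2%:R * rho T' ->
    exists2 v, v \in T' & rho T < 4%:R * q * rho (T' :\: nb v).
  move=> sT' rT'; apply: contrapT => H; apply: HT; exists T'; split=> // x xT.
  by rewrite leNgt; apply/negP => h; apply: H; exists x.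
(* There are [r = q / 4] peeling rounds of at most [M] blocks each, and [r * M >= N]. A round costs
   at most [2 * rho T / q], so at least half of [T] survives to the end. *)
pose r := (2 ^ (j - 2))%N; pose M := (N %/ r).+1.
have Er : q = 4%:R * r%:R.
  rewrite /q /r natrX; have -> : 4%:R = 2%:R ^+ 2 :> R by rewrite -natrX.
  by rewrite -exprD; congr (_ ^+ _); move: j6; clear; lia.
have r16 : (16 <= r)%N.
  by rewrite /r -[16%N]/(2 ^ 4)%N leq_exp2l //; move: j6; clear; lia.
have MN : (M <= N)%N.
  by apply: ltn_Pdiv; [apply: leq_trans r16|apply: leq_trans N2].
have rM : (N <= r * M)%N by rewrite /M mulnC; apply: ltnW; apply: ltn_ceil; move: r16;
  generalize r; clear; lia.
have M2 : (2 <= M)%N -> (M * r <= 2 * N)%N.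
  rewrite /M ltnS => h; have := leq_divM N r; move: h; generalize (N %/ r)%N r; clear; nia.
clear IH NN t14 NR.
have qp : 0 < q by apply: lt_le_trans q64.
have q2 : 0 < q ^+ 2 by rewrite exprn_gt0.
pose W := sigma * N%:R ^+ 14.
have W0 : 128%:R * 128%:R * sigma <= W by rewrite /W mulrC ler_wpM2l //; lra.
have LW : sigma * L * N%:R ^+ 14 = L * W by rewrite /W; ring.
have rA8 : 8%:R * q ^+ 2 * W <= phi u A.
  apply: le_trans hA'; rewrite LW ler_wpM2r //; lra.
have rA9 : 8%:R * q ^+ 2 * W <= rho A by apply: le_trans rA8 (phi_le_rho _ _).
have rT8 : 8%:R * q <= rho T.
  rewrite -(ler_pM2l qp); apply: le_trans rT; apply: le_trans rA9.
  rewrite expr2; have : 1 <= W by lra.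
  have : 0 <= q * q by rewrite mulr_ge0 // ltW.
  nra.
(* [i'] counts the rounds left. The bound reads [rho T <= rho T'] at the start, when [i' = r], and
   [rho T <= 2 * rho T'] at [i' = 0]. *)
suff peel i' T' N' : T' \subset T -> rho T * (q + 4%:R * i'%:R) <= 2%:R * q * rho T' ->
    (N' <= i' * M)%N -> (N' <= N)%N -> has_blocks delta sigma T' N'.
  by apply: (peel r) => //; rewrite -Er; lra.
elim: i' T' N' => [|i' IHi] T' N' sT' rT' hN' hN; first by move: hN';
  rewrite mul0n leqn0 => /eqP->; exact: has_blocks0.
rewrite -natr1 in rT'.
have i0 : 0 <= i'%:R :> R by [].
have rTpos : 0 < rho T by lra.
have [|v vT' hv] := HT T' sT'.
  rewrite -(ler_pM2l qp); nra.
pose C := nonnb T' v.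
have sCA : C \subset A by apply: subset_trans (nonnb_sub _ _) (subset_trans sT' sT).
have rC : rho T <= 8%:R * q * rho C.
  have := rho_nonnb1 R T' v; rewrite -/C; nra.
have rAC : rho A <= 8%:R * q ^+ 2 * rho C.
  apply: le_trans rT _; rewrite expr2.
  have -> : 8%:R * (q * q) * rho C = q * (8%:R * q * rho C) by ring.
  by rewrite ler_pM2l.
have WC : W <= rho C.
  have p : 0 < 8%:R * q ^+ 2 by rewrite mulr_gt0.
  rewrite -(ler_pM2l p); apply: le_trans rAC; lra.
have ds : delta * sigma <= sigma by nra.
have pC : phi u A <= 8%:R * q ^+ 2 * phi u C by apply: phi_le_sub => //; lra.
have WpC : W <= phi u C.
  have p : 0 < 8%:R * q ^+ 2 by rewrite mulr_gt0.
  rewrite -(ler_pM2l p); lra.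
have t13 : 2%:R ^+ 13 = 64%:R * 128%:R :> R by rewrite -natrM -natrX.
have [||c0 [Q [c0C sQ pQ HQ]]] := @kernel_split u C v u0' (acpl_nonnb _ _).
- by rewrite t13; lra.
- by rewrite t13; lra.
have vT : v \in T by apply: (subsetP sT').
have c0T' : c0 \in T' by apply: (subsetP (nonnb_sub T' v)).
have c0T : c0 \in T by apply: (subsetP sT').
pose T2 := T' :&: nb v :&: nb c0.
have rT2 : rho T * (q + 4%:R * i'%:R) <= 2%:R * q * rho T2.
  have h1 : rho T' <= rho T2 + (rho (T' :\: nb v) + rho (T' :\: nb c0)).
    apply: le_trans (_ : rho T2 + rho ((T' :\: nb v) :|: (T' :\: nb c0)) <= _).
      apply: rho_split; apply/subsetP => x xT; rewrite !inE xT /=.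
      by case: (adj v x); case: (adj c0 x).
    by rewrite lerD2l rhoU.
  have h2 : q * rho (T' :\: nb v) <= rho T.
    apply: le_trans (dT v vT); rewrite ler_wpM2l //; first exact: ltW.
    by apply/rhoS/setSD.
  have h3 : q * rho (T' :\: nb c0) <= rho T.
    apply: le_trans (dT c0 c0T); rewrite ler_wpM2l //; first exact: ltW.
    by apply/rhoS/setSD.
  have := ler_wpM2l (ltW qp) h1; rewrite !mulrDr; lra.
pose n1 := minn N' (i' * M); pose n2 := (N' - n1)%N.
have -> : N' = (n1 + n2)%N by rewrite /n2 /n1 subnKC // geq_minl.
have n2M : (n2 <= M)%N by rewrite mulSn in hN'; rewrite /n2 /n1; move: hN';
  generalize (i' * M)%N; clear; lia.
have sT2v : T2 \subset nb v by rewrite /T2 setIAC; apply: subsetIr.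
apply: (has_blocks_cat (P := T2) (Q := Q)) => //.
- by rewrite /T2 -setIA subsetIl.
- exact: subset_trans sQ (nonnb_sub _ _).
- exact: disjoint_nb_nonnb sT2v sQ.
- move=> x; rewrite !inE => /andP[/andP[_ vx] c0x]; apply: le_trans ud'; exact: HQ.
- apply: IHi => //; [|by rewrite /n1 geq_minr|by apply: leq_trans hN; rewrite /n1 geq_minl].
  by rewrite /T2 -setIA; apply: subset_trans sT'; apply: subsetIl.
have [->|n20] := posnP n2; first exact: has_blocks0.
have vA : v \in A by apply: (subsetP sT).
have hpQ := @phi_le_rho R G u Q.
apply: (IHQ (v := v)) => //.
- apply: subset_trans sQ _; apply/subsetP => x; rewrite nonnbP !inE => /and3P[-> _ xT].
  by rewrite (subsetP sT) // (subsetP sT').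
- by rewrite n20 (leq_trans n2M).
- by lra.
(* Two or more blocks from [Q] force [M >= 2], hence [M * r <= 2 * N]. Since [Q] keeps a
   [1 / (16 * q ^ 2)] part of the potential of [A], [pow14_ratio] suffices. *)
move=> n22.
have hM : (2 <= M)%N by apply: leq_trans n2M.
have nq : n2%:R * q <= 8%:R * N%:R.
  have h : (n2 * r <= 2 * N)%N by apply: leq_trans (M2 hM); rewrite leq_mul2r n2M orbT.
  have : (n2 * r)%:R <= (2 * N)%:R :> R by rewrite ler_nat.
  rewrite !natrM Er; lra.
have h16 := pow14_ratio q64 (ler0n _ _) (ler0n _ _) nq.
have p16 : 0 < 16%:R * q ^+ 2 by rewrite mulr_gt0.
rewrite -(ler_pM2l p16); apply: le_trans (_ : sigma * L * N%:R ^+ 14 <= _); last first.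
  have p8 : 0 <= 8%:R * q ^+ 2 by rewrite mulr_ge0 // ltW.
  have := ler_wpM2l p8 pQ; lra.
have sL : 0 <= sigma * L.
  by rewrite mulr_ge0 ?(le_trans ler01 s1) // L_def mulr_ge0 ?sqr_ge0.
have := ler_wpM2l sL h16; lra.
Qed.

End DenseStep.

Lemma uphalf_ratio N : (3 <= N)%N -> (3 * uphalf N <= 2 * N)%N.
Proof. by move=> h; have := uphalfE N; have := odd_double_half N.+1; rewrite -muln2;
  case: (odd _); lia. Qed.

(** Induction on [#|A|] inside a rigid set. If a vertex of [A1] has substantial neighbours and
    nonneighbours, [mid_split] yields two parts that share the blocks; otherwise [A1] is dense and
    [dense_blocks] applies. The length [2 * kp + 5] makes [delta * 2 ^ (2 * kp + 5)] equal to
    [2 * 2 ^ kp]. *)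
Lemma potential_blocks kp (u sigma : R) A N : 0 < u -> u <= (16%:R * 2%:R ^+ kp)^-1 * sigma ->
  1 <= sigma ->
  (2 <= N <= 2 ^ kp)%N -> sigma * (8%:R * (2%:R ^+ (2 * kp + 5)) ^+ 2) * N%:R ^+ 14 <= phi u A ->
  has_blocks ((16%:R * 2%:R ^+ kp)^-1) sigma A N.
Proof.
set delta := (16%:R * 2%:R ^+ kp)^-1; set L := 8%:R * _.
move=> u0 ud s1 /andP[N2 Nk] hA.
have K1 : 1 <= 2%:R ^+ kp :> R by rewrite exprn_ege1 // ler1n.
have d0 : 0 <= delta by rewrite invr_ge0; lra.
have d1 : delta <= 1 by rewrite invf_le1; lra.
have Edelta : delta * (16%:R * 2%:R ^+ kp) = 1 by rewrite mulVf // gt_eqF //; lra.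
have q0 : 1 <= 2%:R ^+ (2 * kp + 5) :> R by rewrite exprn_ege1 // ler1n.
have L8 : 8%:R <= L by rewrite /L; nra.
(* A single block needs only Hall ratio [sigma], so the potential is demanded from two blocks on;
   the recursion ends there. *)
suff main m : forall A N, (#|A| < m)%N -> (0 < N <= 2 ^ kp)%N -> sigma <= rho A ->
    ((2 <= N)%N -> sigma * L * N%:R ^+ 14 <= phi u A) -> has_blocks delta sigma A N.
  apply: (main #|A|.+1) => //; first by rewrite (leq_trans _ N2).
  apply: le_trans (phi_le_rho u A); apply: le_trans hA.
  rewrite -mulrA -[X in X <= _]mulr1 ler_wpM2l //; first by lra.
  have : 1 <= N%:R ^+ 14 :> R by rewrite exprn_ege1 // ler1n (leq_trans _ N2).
  nra.
clear A N N2 Nk hA.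
elim: m => // m IH A0 N cA /andP[N1 Nk] rA0 hA0.
have [N2|N2] := ltnP 1 N; last first.
  have -> : N = 1%N by apply/eqP; rewrite eqn_leq N2.
  exact: has_blocks1.
have {}hA0 := hA0 N2.
have N14 : 128%:R * 128%:R <= N%:R ^+ 14 :> R.
  have -> : 128%:R * 128%:R = 2%:R ^+ 14 :> R by rewrite -natrM -natrX.
  by rewrite lerXn2r ?nnegrE // ler_nat.
pose W := sigma * N%:R ^+ 14.
have W0 : 128%:R * 128%:R * sigma <= W by rewrite /W mulrC ler_wpM2l //; lra.
have LW : sigma * L * N%:R ^+ 14 = L * W by rewrite /W; ring.
have ds : delta * sigma <= sigma by nra.
have uA0 : u <= rho A0 by lra.
have [A [sA uA rig pA]] := exists_rigid u0 uA0.
have hA : sigma * L * N%:R ^+ 14 <= phi u A by lra.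
have rAp := @phi_le_rho R G u A.
have rA : 8%:R * (128%:R * 128%:R * sigma) <= rho A.
  apply: le_trans rAp; apply: le_trans hA; rewrite LW; nra.
have t13 : 2%:R ^+ 13 = 64%:R * 128%:R :> R by rewrite -natrM -natrX.
apply: (has_blocksS sA).
have sAm : (#|A| <= #|A0|)%N by apply: subset_leq_card.
have IHQ Q v n : v \in A -> Q \subset A :\ v -> (0 < n <= N)%N -> sigma <= rho Q ->
    ((2 <= n)%N -> sigma * L * n%:R ^+ 14 <= phi u Q) -> has_blocks delta sigma Q n.
  move=> vA sQ hn rQ hQ; apply: IH => //.
    have := subset_leq_card sQ; rewrite (cardsD1 v A) vA in sAm; move: sAm cA; clear; lia.
  by case/andP: hn => -> h; apply: leq_trans Nk.
pose A1 := [set v in A | rho A <= 40%:R * rho (A :&: nb v)].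
have sA1 : A1 \subset A by apply/subsetP => x; rewrite inE => /andP[].
have rA1 : 9%:R * rho A <= 10%:R * rho A1.
  have h : 10%:R * rho (A :\: A1) <= rho A.
    rewrite leNgt; apply/negP => h.
    have [|v /setDP[vA vA1] hv] := @gyarfas R G noP5 (A :\: A1); first by lra.
    case/negP: vA1; rewrite inE vA /=.
    have : rho ((A :\: A1) :&: nb v) <= rho (A :&: nb v) by apply/rhoS/setSI/subsetDl.
    lra.
  have := rhoD R A A1; lra.
have [[v vA1 hv]|H] := EM (exists2 v, v \in A1 & rho A1 <= 64%:R * rho (A1 :\: nb v)); last first.
  apply: (has_blocksS sA1).
  have kp1 : (1 <= kp)%N by rewrite lt0n; apply: contraTneq (leq_trans N2 Nk) => ->.
  have dJ : 2%:R * N%:R <= delta * 2%:R ^+ (2 * kp + 5).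
    have -> : 2%:R ^+ (2 * kp + 5) = 16%:R * 2%:R ^+ kp * (2%:R * 2%:R ^+ kp) :> R.
      rewrite mul2n -addnn !exprD; have -> : 2%:R ^+ 5 = 16%:R * 2%:R :> R by rewrite -natrM -natrX.
      ring.
    rewrite [delta * _]mulrA Edelta mul1r ler_pM2l // -natrX ler_nat //.
  have e6 : 2%:R ^+ 6 = 64%:R :> R by rewrite -natrX.
  apply: (@dense_blocks u sigma delta L A N (2 * kp + 5)%N u0 ud d0 d1 s1 N2 erefl dJ hA IHQ (2 *
    kp + 5 - 6)%N 6%N) => //.
    by move: kp1; clear; lia.
    by rewrite e6; lra.
  move=> x xA1; rewrite e6 leNgt; apply/negP => h; apply: H; exists x => //; exact: ltW.
have vA : v \in A by apply: (subsetP sA1).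
have hn : rho A <= 40%:R * rho (A :&: nb v) by move: vA1; rewrite inE => /andP[].
have hm : rho A <= 80%:R * rho (nonnb A v).
  have : rho (A1 :\: nb v) <= rho (A :\: nb v) by apply/rhoS/setSD.
  have := rho_nonnb1 R A v; lra.
have [||P [Q [sP sQ rP rQ HPQ]]] := mid_split u0 rig _ _ hn hm; [by rewrite t13;
  lra|by rewrite t13; lra|].
have sPA : P \subset A :\ v.
  apply: subset_trans sP _; apply/subsetP => x; rewrite !inE => /andP[-> vx].
  by rewrite andbT; apply: contraTneq vx => ->; rewrite adj_irrefl.
have sQA : Q \subset A :\ v.
  by apply: subset_trans sQ _; apply/subsetP => x; rewrite nonnbP !inE => /and3P[-> _ ->].
have sPA' : P \subset A := subset_trans sPA (subsetDl _ _).
have sQA' : Q \subset A := subset_trans sQA (subsetDl _ _).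
(* For [N = 2] each part supplies one block. For [N >= 3] a part supplies at most [2 * N / 3]
   blocks, and [pow14_half] absorbs the factor [160]. *)
have half X n : X \subset A :\ v -> rho A <= 160%:R * rho X -> (0 < n <= uphalf N)%N ->
  has_blocks delta sigma X n.
  move=> sX rX hn'; have sXA : X \subset A := subset_trans sX (subsetDl _ _).
  have uN : (uphalf N <= N)%N by rewrite uphalf_half -{3}(odd_double_half N) -addnn addnA leq_addr.
  apply: (IHQ X v) => //; [by case/andP: hn' => -> h; apply: leq_trans uN|lra|move=> n2].
  have N3 : (3 <= N)%N by rewrite ltnNge; apply/negP => h; have E : N = 2%N by [apply/eqP;
    rewrite eqn_leq h]; move: hn'; rewrite E /=; move: n2; clear; lia.
  have pX : phi u A <= 160%:R * phi u X by apply: phi_le_sub => //; lra.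
  have hr := uphalf_ratio N3.
  have h3 : 3%:R * n%:R <= 2%:R * N%:R :> R by rewrite -!natrM ler_nat; move: hr hn';
    generalize (uphalf N); clear; lia.
  have h14 := pow14_half (ler0n _ _) (ler0n _ _) h3.
  have sL : 0 <= sigma * L by rewrite mulr_ge0 ?(le_trans ler01 s1) // (le_trans _ L8).
  have := ler_wpM2l sL h14; lra.
have uh : (uphalf N + N./2 = N)%N by rewrite uphalf_half -[RHS]odd_double_half -addnn addnA.
have hh : (N./2 <= uphalf N)%N by rewrite uphalf_half leq_addl.
have h0 : (0 < N./2)%N by rewrite half_gt0.
rewrite -uh; apply: (has_blocks_cat (P := P) (Q := Q)) => //.
- apply: (disjoint_nb_nonnb (A := A) (v := v)) => //; apply: subset_trans sP (subsetIr _ _).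
- by move=> x xP; apply: le_trans (HPQ x xP) ud.
- by apply: half => //; rewrite leqnn andbT (leq_trans h0).
- by apply: half => //; rewrite h0.
Qed.

End DenseBlocks.

(** * Complete transversals of dense blocks *)

Section Transversals.
Variables (R : realType) (G : sgraph).
Implicit Types (A B C D E F I J K X Y Z S T W : {set G}) (k x y z v w : G).
Implicit Types (P Q : {set G}) (s t : seq {set G}).

Local Notation rho := (@rho R G).

(** After [m] choices the common neighbourhood [W] misses at most an [m * delta] fraction of each
    later block, so a next vertex exists. *)
Lemma greedy_clique (delta : R) s W m : 0 <= delta -> pairwise (dense_after delta) s ->
  (forall Y, Y \in s -> 0 < rho Y /\ rho (Y :\: W) <= m%:R * delta * rho Y) ->
  (m + size s)%:R * delta < 1 ->
  exists t : seq G, [/\ size t = size s, {subset t <= W} & pairwise (@adj G) t].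
Proof.
move=> d0; elim: s W m => [|Y s IH] W m /= ps hs hm; first by exists [::].
case/andP: ps => /allP pY ps.
have [Y0 YW] := hs Y (mem_head _ _).
have [x xY xW] : exists2 x, x \in Y & x \in W.
  have [dis|[x /setIP[]]] := set_0Vmem (Y :&: W); last by exists x.
  move: YW; have -> : Y :\: W = Y by apply/setDidPl; rewrite -setI_eq0 dis.
  rewrite leNgt => /negP[]; rewrite gtr_pMl //; apply: le_lt_trans hm.
  by rewrite ler_wpM2r // ler_nat leq_addr.
have [||t [szt sW pt]] := IH (W :&: nb x) m.+1 ps.
- move=> Z Zs; have [|Z0 ZW] := hs Z; first by rewrite inE Zs orbT.
  split=> //.
  have /andP[_ /forall_inP/(_ x xY) h] := pY Z Zs.
  have : rho (Z :\: (W :&: nb x)) <= rho (Z :\: W) + rho (Z :\: nb x).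
    apply: rho_split; apply/subsetP => z; rewrite !inE negb_and => /andP[/orP[->|->] ->] //.
    by rewrite orbT.
  rewrite -natr1 !mulrDl mul1r; lra.
- by move: hm; rewrite addnS addSn.
exists (x :: t); split; rewrite /= ?szt //.
  by move=> z; rewrite inE => /orP[/eqP->|/sW/setIP[]].
rewrite pt andbT; apply/allP => z /sW/setIP[_]; by rewrite in_nb.
Qed.

(** Anticomponents below [u0] are merged until a group first reaches [u0]; the group then stays
    below [2 * u0], and distinct groups are complete to each other. *)
Lemma group_anticomponents (u0 : R) N X : 0 < u0 ->
  (forall D, D \subset X -> conn (@nadj G) D -> cpl D (X :\: D) -> rho D < u0) ->
  2%:R * N%:R * u0 <= rho X ->
  exists s, [/\ size s = N, pairwise (@cpl G) s & forall Y, Y \in s -> Y \subset X /\ u0 <= rho Y].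
Proof.
move=> u00; elim: N X => [|N IH] X hX rX; first by exists [::].
rewrite -natr1 in rX; have N0 := ler0n R N.
have [|W [sW cW rW] mW] := @ex_min_set _ (fun W => [/\ W \subset X, cpl W (X :\: W) & u0 <= rho W]).
  exists X; split=> //; last by nra.
  by rewrite setDv; apply/cplP => a b _; rewrite inE.
have [y yW] : exists y, y \in W by apply: (@rho_gt0_ex R); lra.
have [D [sD yD cD aD]] := anticomponent yW.
have aDX : cpl D (X :\: D).
  apply/cplP => a b aD'; rewrite !inE => /andP[bD bS]; have [bW|bW] := boolP (b \in W).
    by apply: (cplP _ _ aD) => //; rewrite inE bD bW.
  by apply: (cplP _ _ cW); rewrite ?inE ?bW ?(subsetP sD).
have aWD : cpl (W :\: D) (X :\: (W :\: D)).
  apply/cplP => a b /setDP[aW aD']; rewrite !inE negb_and negbK => /andP[/orP[bD|bW] bS].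
    by rewrite adj_sym; apply: (cplP _ _ aD) => //; rewrite inE aD' aW.
  by apply: (cplP _ _ cW) => //; rewrite inE bW bS.
have rWD : rho (W :\: D) < u0.
  rewrite ltNge; apply/negP => h.
  have : (#|W| <= #|W :\: D|)%N.
    by apply: mW; split=> //; apply: subset_trans sW; apply: subsetDl.
  by rewrite leqNgt (card_setD_lt yW yD).
have rD : rho D < u0 by apply: hX => //; apply: subset_trans sW.
have rW2 : rho W <= 2%:R * u0 by have := rhoD R W D; lra.
have [||s [szs ps hs]] := IH (X :\: W).
- move=> E sE cE aE; apply: hX => //; first exact: subset_trans sE (subsetDl _ _).
  apply/cplP => a b aE' /setDP[bX bE]; have [bW|bW] := boolP (b \in W).
    by rewrite adj_sym; apply: (cplP _ _ cW) => //; apply: (subsetP sE).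
  by apply: (cplP _ _ aE) => //; rewrite !inE bE bW bX.
- have := rhoD R X W; lra.
exists (W :: s); split; rewrite /= ?szs //.
  rewrite ps andbT; apply/allP => Y /hs[sY _]; exact: cplW (subxx W) sY cW.
move=> Y; rewrite inE => /orP[/eqP->//|/hs[sY ->]]; split=> //.
exact: subset_trans sY (subsetDl _ _).
Qed.

Hypothesis noP5 : no_path5 G.

Definition mixed w Y := [exists a in Y, adj w a] && [exists b in Y, ~~ adj w b].

Lemma mixedP w Y : reflect ((exists2 a, a \in Y & adj w a) /\ (exists2 b,
  b \in Y & ~~ adj w b)) (mixed w Y).
Proof. by apply: (iffP andP) => -[/exists_inP ? /exists_inP ?]. Qed.

Lemma mixed_conn w Y : conn (@adj G) Y -> mixed w Y ->
  exists a b, [/\ a \in Y, b \in Y, adj w a, ~~ adj w b & adj a b].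
Proof. by move=> cY /mixedP[[a aY wa] [b bY wb]]; apply: conn_mixed aY bY wa wb. Qed.

Lemma mixed_anticonn w Y : conn (@nadj G) Y -> mixed w Y ->
  exists a b, [/\ a \in Y, b \in Y, adj w a, ~~ adj w b & nadj a b].
Proof.
move=> cY /mixedP[[a aY wa] [b bY wb]].
have [||x [y [xX yX]]] := cY (nb w) a b aY bY; rewrite ?in_nb //.
by move=> wx wy xy; exists x, y.
Qed.

(** If [Z] and [Z'] are complete, a nonadjacent pair [x], [y] of [Z] split by [w] and a nonneighbour
    [d] of [w] in [Y'] give the path [v w x d y]. If they are anticomplete, split edges of [Y] and
    [Y'] give [b a w c d]. *)
Lemma mixed_once v w Y Z Y' Z' : adj v w -> conn (@adj G) Y -> conn (@adj G) Y' ->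
  Y \subset Z -> Y' \subset Z' -> conn (@nadj G) Z -> pure Z Z' ->
  acpl [set v] Z -> acpl [set v] Z' -> mixed w Y -> mixed w Y' -> False.
Proof.
move=> vw cY cY' sY sY' cZ p vZ vZ' mY mY'.
have nv z : z \in Z -> ~~ adj v z by case/(acpl1P vZ)/andP.
have nv' z : z \in Z' -> ~~ adj v z by case/(acpl1P vZ')/andP.
have [sZ sZ'] := (subsetP sY, subsetP sY').
case/orP: p => p.
  have mZ : mixed w Z.
    by case/mixedP: mY => -[a aY wa] [b bY wb]; apply/mixedP; split; [exists a|exists b] => //;
      apply: sZ.
  have [x [y [xZ yZ wx wy /andP[_ xy]]]] := mixed_anticonn cZ mZ.
  case/mixedP: mY' => _ [d dY wd].
  have dZ := sZ' _ dY; have dx := cplP _ _ p _ _ xZ dZ; have dy := cplP _ _ p _ _ yZ dZ.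
  by apply: (@noP5 v w x d y) => //; try (by rewrite adj_sym); [exact: nv|exact: nv'|exact: nv].
have [a [b [aY bY wa wb ab]]] := mixed_conn cY mY.
have [c [d [cY2 dY wc wd cd]]] := mixed_conn cY' mY'.
have np z z' : z \in Y -> z' \in Y' -> ~~ adj z z'.
  by move=> zY zY'; case/andP: (acplP _ _ p _ _ (sZ _ zY) (sZ' _ zY')).
by apply: (@noP5 b a w c d) => //; first [by rewrite adj_sym|exact: np].
Qed.

Definition cdense (q : nat) X Y := [forall x in X, (q * #|Y :\: nb x| <= #|Y|)%N].
Definition tight Y := forall Z, Z \subset Y -> rho Y * #|Z|%:R <= rho Z * #|Y|%:R.

(** Each block is replaced by a tight subset of the same Hall ratio, which turns density in Hall
    ratio into density in cardinality, with [q = 1 / delta]. *)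
Lemma tighten (delta : R) q s : 0 < delta -> delta * q%:R = 1 -> pairwise (dense_after delta) s ->
  (forall Y, Y \in s -> 0 < rho Y) ->
  exists s', [/\ size s' = size s, pairwise (cdense q) s' &
    forall Y, Y \in s' -> tight Y /\ exists2 Z, Z \in s & rho Y = rho Z /\ Y \subset Z].
Proof.
move=> d0 dq; elim: s => [|Y s IH] /= ps hs; first by exists [::].
case/andP: ps => /allP pY ps.
have [|s' [szs ps' hs']] := IH ps; first by move=> Z Zs; apply: hs; rewrite inE Zs orbT.
have [F [sF rF tF]] := rho_tight R Y.
exists (F :: s'); split; rewrite /= ?szs //.
- rewrite ps' andbT; apply/allP => Y' /hs'[tY' [Z Zs [rY' sY']]].
  apply/forall_inP => x xF.
  have /andP[_ /forall_inP/(_ x (subsetP sF _ xF)) h] := pY Z Zs.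
  have Z0 : 0 < rho Z by apply: hs; rewrite inE Zs orbT.
  have h1 := tY' _ (subsetDl Y' (nb x)).
  have h2 : rho (Y' :\: nb x) <= delta * rho Z by apply: le_trans h; apply/rhoS/setSD.
  rewrite -(ler_nat R) natrM.
  have h3 : rho Z * #|Y' :\: nb x|%:R <= delta * rho Z * #|Y'|%:R.
    by rewrite -rY'; apply: le_trans h1 _; rewrite ler_wpM2r // rY'.
  have h4 : #|Y' :\: nb x|%:R <= delta * #|Y'|%:R by rewrite -(ler_pM2l Z0); lra.
  rewrite -(ler_pM2l d0) mulrA dq mul1r //.
- move=> Y'; rewrite inE => /orP[/eqP->|Y's].
    by split=> //; exists Y; rewrite ?mem_head.
  by have [tY' [Z Zs h]] := hs' _ Y's; split=> //; exists Z => //; rewrite inE Zs orbT.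
Qed.

Lemma card_disjoint_family (T U : finType) (L : {set T}) (f : T -> {set U}) (S : {set U}) c :
  {in L, forall l, (#|S| < c * #|f l|)%N /\ f l \subset S} ->
  {in L &, forall l l', l != l' -> [disjoint f l & f l']} -> (0 < c)%N -> (#|L| < c)%N.
Proof.
move=> hL dL c0; have [->|[l0 l0L]] := set_0Vmem L; first by rewrite cards0.
pose F l := if l \in L then f l else set0.
have dF l l' : l != l' -> [disjoint F l & F l'].
  move=> n; rewrite /F; case: ifP => hl; last by rewrite disjoints_subset sub0set.
  case: ifP => hl'; last by rewrite disjoint_sym disjoints_subset sub0set.
  exact: dL.
have E : (\sum_(l in L) #|f l| = #|\bigcup_l F l|)%N.
  rewrite -sum1_card partition_disjoint_bigcup // big_mkcond /=; apply: eq_bigr => l _.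
  by rewrite sum1_card /F; case: ifP => _; rewrite ?cards0.
have h1 : (\sum_(l in L) #|f l| <= #|S|)%N.
  rewrite E; apply: subset_leq_card; apply/bigcupsP => l _; rewrite /F.
  by case: ifP => [/hL[]|_] //; rewrite sub0set.
have h2 : (#|L| * #|S| + #|L| <= c * \sum_(l in L) #|f l|)%N.
  rewrite big_distrr /= addnC -mulnS -sum_nat_const; apply: leq_sum => l lL; by have [] := hL l lL.
have L0 : (0 < #|L|)%N by apply/card_gt0P; exists l0.
rewrite ltnNge; apply/negP => h; nia.
Qed.

Lemma count_cover (q a b m n c : nat) : (16 * q * a <= c)%N -> (16 * q * b <= c)%N ->
  (4 * q * m <= c)%N ->
  (n <= a + b + m)%N -> (2 * q * n <= c)%N.
Proof.
move=> ha hb hm hn; apply: leq_trans (_ : 2 * q * (a + b + m) <= _)%N;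
  first by rewrite leq_mul2l hn orbT.
rewrite !mulnDr; move: ha hb hm; rewrite -!mulnA.
by move: (q * a)%N (q * b)%N (q * m)%N; clear; lia.
Qed.

Section Transversal.
Variables (kk : nat) (u u0 : R).
Hypotheses (k0 : (0 < kk)%N) (u00 : 0 < u0) (uu0 : 2%:R * kk%:R * u0 <= u).
Hypothesis noii0 : forall s, size s = kk -> pairwise (@cpl G) s -> (forall Y, Y \in s ->
  u0 <= rho Y) -> False.

(** Otherwise every anticomponent of [X] is below [u0], and grouping them gives [kk] pairwise
    complete sets excluded by [noii0]. *)
Lemma big_anticomp X : u <= rho X -> exists Y Z, [/\ Z \subset X, conn (@nadj G) Z, Y \subset Z,
   conn (@adj G) Y & u0 <= rho Y].
Proof.
move=> rX; apply: contrapT => H.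
have [||s [szs ps hs]] := @group_anticomponents u0 kk X u00; last first.
- by apply: (noii0 szs ps) => Y /hs[].
- exact: le_trans uu0 rX.
move=> D sD cD _; rewrite ltNge; apply/negP => rD; apply: H.
have [Y [sY cY _ rY]] := component_rho R D.
by exists Y, D; split=> //; rewrite rY.
Qed.

(** Every later block spoils fewer than [4 * kk] of the pieces and fewer than [kk] blocks remain, so
    some piece survives. A vertex of [S] not complete to [Y] misses [v], misses a fixed [y] of [Y],
    or is a neighbour of [v] mixed on [Y]; the three shares [1/16], [1/16], [1/4] of [1/kk] add up
    to less than [1/(2 * kk)]. *)
Lemma transversal_step B v W s : v \in B -> (4 * kk ^ 2 <= pnum u (nonnb (B :&: W) v))%N ->
  (size s < kk)%N -> all (cdense (16 * kk) B) s ->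
  exists Y, [/\ Y \subset B :&: W, u0 <= rho Y &
   forall S, S \in s -> (2 * kk * #|S :\: [set w | [forall y in Y, adj w y]]| <= #|S|)%N].
Proof.
move=> vB hp szs /allP ds.
have [P /pfamP[h1 h2] EP] := pnum_wit u (nonnb (B :&: W) v); rewrite EP in hp.
pose good (X Y Z : {set G}) := [/\ Z \subset X, conn (@nadj G) Z, Y \subset Z,
  conn (@adj G) Y & u0 <= rho Y].
have hex X : exists YZ : {set G} * {set G}, X \in P -> good X YZ.1 YZ.2.
  have [XP|XP] := boolP (X \in P); last by exists (set0, set0).
  by have [Y [Z hYZ]] := big_anticomp (h1 X XP).2; exists (Y, Z).
have [f hf] := choice hex.
pose bad S := [set X in P | (#|S| < 4 * kk * #|[set w in S | adj v w && mixed w (f X).1]|)%N].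
(* By [mixed_once] the sets counted for different pieces are disjoint. *)
have badS S : (#|bad S| < 4 * kk)%N.
  apply: (card_disjoint_family (f := fun X => [set w in S | adj v w && mixed w (f X).1]) (S := S)).
  - move=> X; rewrite inE => /andP[_ ->]; split=> //.
    by apply/subsetP => w; rewrite inE => /andP[].
  - move=> X X'; rewrite !inE => /andP[XP _] /andP[X'P _] nXX'.
    rewrite -setI_eq0; apply/eqP/setP => w; rewrite !inE; apply/negP.
    move=> /andP[/and3P[_ vw m1] /and3P[_ _ m2]].
    have [a1 a2 a3 a4 _] := hf X XP; have [b1 b2 b3 b4 _] := hf X' X'P.
    apply: (@mixed_once v w (f X).1 (f X).2 (f X').1 (f X').2) => //.
    + exact: pureW a1 b1 (h2 _ _ XP X'P nXX').
    + by apply: acplW (acpl_nonnb (B :&: W) v) => //; apply: subset_trans a1 (h1 X XP).1.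
    + by apply: acplW (acpl_nonnb (B :&: W) v) => //; apply: subset_trans b1 (h1 X' X'P).1.
  - by rewrite muln_gt0 k0.
have [X XP Xg] : exists2 X, X \in P & forall S, S \in s -> X \notin bad S.
  apply: contrapT => H.
  pose U := foldr (fun S V => bad S :|: V) set0.
  have memU X S (t : seq {set G}) : S \in t -> X \in bad S -> X \in U t.
    elim: t => //= S' t IH; rewrite inE => /orP[/eqP<-|/IH h] hb; rewrite inE; first by rewrite hb.
    by rewrite h ?orbT.
  have hs : P \subset U s.
    apply/subsetP => X XP; apply: contraT => n; case: H; exists X => // S Ss.
    by apply: contra n => hb; apply: memU hb.
  have hc t : (#|U t| <= size t * (4 * kk))%N.
    elim: t => [|S t IH]; first by rewrite cards0.
    rewrite /= mulSn; apply: leq_trans (leq_card_setU _ _) _.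
    by rewrite leq_add // ltnW.
  have := leq_trans (subset_leq_card hs) (hc s); move: hp szs k0; clear.
  rewrite -mulnn; nia.
have [a1 a2 a3 a4 a5] := hf X XP; have sXB := (h1 X XP).1.
have sYX : (f X).1 \subset nonnb (B :&: W) v by apply: subset_trans a3 (subset_trans a1 sXB).
have sYB : (f X).1 \subset B :&: W by apply: subset_trans sYX (nonnb_sub _ _).
exists (f X).1; split=> // S Ss.
have [y yY] : exists y, y \in (f X).1 by apply: (@rho_gt0_ex R); apply: lt_le_trans a5.
have yB : y \in B by have := subsetP sYB _ yY; rewrite inE => /andP[].
have /forall_inP dS := ds S Ss.
pose M := [set w in S | adj v w && mixed w (f X).1].
have hM : (4 * kk * #|M| <= #|S|)%N.
  by have := Xg S Ss; rewrite inE XP /= -leqNgt.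
have cov : S :\: [set w | [forall y in (f X).1,
  adj w y]] \subset (S :\: nb v) :|: (S :\: nb y) :|: M.
  apply/subsetP => w; rewrite !inE => /andP[nw wS]; rewrite wS !andbT /=.
  have [vw|//] := boolP (adj v w); have [yw|//] := boolP (adj y w) => /=.
  apply/mixedP; split; first by exists y; rewrite // adj_sym.
  move: nw; rewrite negb_forall => /existsP[b]; rewrite negb_imply => /andP[? ?]; by exists b.
have c1 := dS v vB; have c2 := dS y yB.
apply: (count_cover c1 c2 hM); apply: leq_trans (subset_leq_card cov) _.
apply: leq_trans (leq_card_setU _ _) _; rewrite leq_add2r; exact: leq_card_setU.
Qed.

(** [W] consists of vertices complete to the [i] sets already chosen. Each choice costs a later
    block at most [1 / (2 * kk)] of its vertices, so half of every block is always left in [W]. *)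
Lemma complete_transversal s W i : (forall B, B \in s -> (2 * kk * #|B :\: W| <= i * #|B|)%N) ->
  (i + size s <= kk)%N ->
  pairwise (cdense (16 * kk)) s ->
  (forall B B', B \in s -> B' \subset B -> (#|B| <= 2 * #|B'|)%N ->
     exists2 v, v \in B' & (4 * kk ^ 2 <= pnum u (nonnb B' v))%N) ->
  exists t, [/\ size t = size s, pairwise (@cpl G) t & forall Y, Y \in t ->
    Y \subset W /\ u0 <= rho Y].
Proof.
elim: s W i => [|B s IH] W i hW hi /= ps hs; first by exists [::].
case/andP: ps => pB ps.
have BW : (#|B| <= 2 * #|B :&: W|)%N.
  have := hW B (mem_head _ _); have := cardsID W B; move: hi k0; clear; rewrite /=; nia.
have [v vBW hv] := hs B (B :&: W) (mem_head _ _) (subsetIl _ _) BW.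
have vB : v \in B by case/setIP: vBW.
have szs : (size s < kk)%N by move: hi; rewrite /=; clear; lia.
have [Y [sY rY hY]] := transversal_step vB hv szs pB.
pose W' := W :&: [set w | [forall y in Y, adj w y]].
have [||||t [szt pt ht]] := IH W' i.+1; last first.
- exists (Y :: t); split; rewrite /= ?szt //.
    rewrite pt andbT; apply/allP => Z /ht[sZ _]; apply/cplP => y z yY /(subsetP sZ).
    by rewrite !inE => /andP[_ /forall_inP/(_ y yY)]; rewrite adj_sym.
  move=> Z; rewrite inE => /orP[/eqP->|/ht[sZ rZ]]; split=> //.
    by apply: subset_trans sY (subsetIr _ _).
  by apply: subset_trans sZ (subsetIl _ _).
- by move=> B' B'' hB; apply: hs; rewrite inE hB orbT.
- by [].
- by move: hi; rewrite /=; clear; lia.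
move=> S Ss; have h1 := hY S Ss.
have h2 : (2 * kk * #|S :\: W| <= i * #|S|)%N by apply: hW; rewrite inE Ss orbT.
have : (#|S :\: W'| <= #|S :\: W| + #|S :\: [set w | [forall y in Y, adj w y]]|)%N.
  rewrite /W' setDIr; exact: leq_card_setU.
move: h1 h2; clear; move: #|_| #|_| #|_| #|_| => n1 n2 n3 n4; clear; nia.
Qed.

End Transversal.

End Transversals.

(** * Squaring the length of a state *)

Section State.
Variables (R : realType) (G : sgraph).
Implicit Types (A B C D E F I J K X Y Z S T W : {set G}) (k x y z v w : G).
Implicit Types (P Q : {set G}) (s t : seq {set G}).

Local Notation rho := (@rho R G).
Local Notation r := (rho setT).

Hypothesis noP5 : no_path5 G.

Hypothesis noii : forall s, (2 <= size s)%N -> pairwise (@cpl G) s ->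
  (forall Y, Y \in s -> r <= (size s)%:R ^+ 400 * rho Y) -> False.

Hypothesis r1 : 1 <= r.

Definition state kp := has_blocks ((16%:R * 2%:R ^+ kp)^-1) (r / (2%:R ^+ kp) ^+ 80) [set: G] (2
  ^ kp).

(** The greedy clique has [2 ^ kp] vertices, and its singletons would form the blockade of outcome
    (ii) if [r] were at most the bound. *)
Lemma state_large kp : (0 < kp)%N -> state kp -> (2%:R ^+ kp) ^+ 400 < r.
Proof.
have r1' := r1.
move=> k0 [s /andP[/allP hs ps] szs]; rewrite ltNge; apply/negP => hr.
set q : R := 2%:R ^+ kp in hr hs ps.
have q1 : 1 <= q by rewrite exprn_ege1 // ler1n.
have kq : (2 ^ kp)%:R = q by rewrite natrX.
have [|||t [szt _ pt]] := @greedy_clique R G _ s setT 0 _ ps.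
- by rewrite invr_ge0; lra.
- move=> Y /hs/andP[_ hY]; split; last by rewrite setDT rho0 !mul0r.
  by apply: lt_le_trans hY; rewrite divr_gt0 ?exprn_gt0 //; lra.
- by rewrite add0n szs kq ltr_pdivrMr; lra.
apply: (@noii [seq [set x] | x <- t]).
- by rewrite size_map szt szs -{1}[2%N]expn1 leq_exp2l.
- rewrite pairwise_map; apply: sub_pairwise pt => x y xy /=.
  by apply/cplP => a b /set1P-> /set1P->.
- by move=> Y /mapP[x _ ->]; rewrite size_map szt szs kq rho_set1 mulr1.
Qed.

Lemma state_step kp : (4 <= kp)%N -> state kp -> state (2 * kp).
Proof.
move=> k4 st.
have hr : (2%:R ^+ kp) ^+ 400 < r by apply: state_large => //; apply: leq_trans k4.
have r1' := r1.
case: st => s /andP[/allP hs ps] szs.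
set q : R := 2%:R ^+ kp in hr hs ps.
have q16 : 16%:R <= q.
  have -> : 16%:R = 2%:R ^+ 4 :> R by rewrite -natrX.
  by rewrite ler_weXn2l // ler1n.
have kq : (2 ^ kp)%:R = q by rewrite natrX.
have q0 : 0 < q by lra.
have q1 : 1 <= q by lra.
have qn0 n : 0 < q ^+ n by rewrite exprn_gt0.
have qn1 n : 1 <= q ^+ n by rewrite exprn_ege1.
have qle m n : (m <= n)%N -> q ^+ m <= q ^+ n by move=> h; rewrite ler_weXn2l.
(* [X] is the Hall ratio demanded of the blocks of a state of length [q ^ 2]; [u] and [u0] are the
   thresholds for pure pieces and for the sets of a transversal. *)
pose X := r / q ^+ 160.
have EX : r = X * q ^+ 160 by rewrite /X divfK // gt_eqF.
have X1 : 1 <= X.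
  rewrite ler_pdivlMr // mul1r; apply: le_trans (ltW hr); exact: qle.
pose u := X / q ^+ 3; pose u0 := X / q ^+ 6.
have Eu : X = u * q ^+ 3 by rewrite /u divfK // gt_eqF.
have Eu0 : X = u0 * q ^+ 6 by rewrite /u0 divfK // gt_eqF.
have u00 : 0 < u0 by rewrite divr_gt0 //; lra.
have up : 0 < u by rewrite divr_gt0 //; lra.
have uu0 : 2%:R * (2 ^ kp)%:R * u0 <= u.
  rewrite kq -(ler_pM2r (qn0 3%N)) -Eu Eu0.
  have -> : q ^+ 6 = q ^+ 3 * q ^+ 3 by rewrite -exprD.
  have -> : 2%:R * q * u0 * q ^+ 3 = u0 * (q ^+ 3 * (2%:R * q)) by ring.
  rewrite ler_pM2l // ler_pM2l //; have : q * q <= q ^+ 3 by rewrite -expr2; apply: qle.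
  nra.
have noii0 t : size t = (2 ^ kp)%N -> pairwise (@cpl G) t -> (forall Y, Y \in t ->
  u0 <= rho Y) -> False.
  move=> szt pt ht; apply: (noii (s := t)) => //.
    by rewrite szt -{1}[2%N]expn1 leq_exp2l // (leq_trans _ k4).
  move=> Y /ht hY; rewrite szt kq EX Eu0 -mulrA -exprD mulrC.
  apply: ler_pM => //; [exact: ltW|exact: ltW|exact: qle].
have rs Y : Y \in s -> X * q ^+ 80 <= rho Y.
  move/hs=> /andP[_]; rewrite EX; have -> : q ^+ 160 = q ^+ 80 * q ^+ 80 by rewrite -exprD.
  by rewrite mulrA mulfK // gt_eqF.
have [|||s' [szs' ps' hs']] := @tighten R G _ (16 * 2 ^ kp)%N s _ _ ps.
- by rewrite invr_gt0; lra.
- by rewrite natrM kq mulVf // gt_eqF //; lra.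
- by move=> Y /rs; apply: lt_le_trans; rewrite mulr_gt0 //; lra.
(* Unless half of some block has few pure pieces in every nonneighbourhood, the blocks admit a
   complete transversal of length [2 ^ kp], excluded by [noii0]. *)
have [[B [B' [Bs sB cB hB]]]|H] := EM (exists B B', [/\ B \in s', B' \subset B,
  (#|B| <= 2 * #|B'|)%N &
   forall v, v \in B' -> (pnum u (nonnb B' v) < 4 * (2 ^ kp) ^ 2)%N]); last first.
  have [||||t [szt pt ht]] := @complete_transversal R G noP5 (2 ^ kp)%N u u0 _ u00 uu0 noii0 s'
    setT 0%N _ _ ps'.
  - by rewrite expn_gt0.
  - by move=> B _; rewrite setDT cards0 muln0.
  - by rewrite add0n szs' szs.
  - move=> B B' Bs sB cB; apply: contrapT => nv; apply: H; exists B, B'; split=> // v vB'.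
    by rewrite ltnNge; apply/negP => h; apply: nv; exists v.
  by case: (@noii0 t) => //; [rewrite szt szs' szs|move=> Y /ht[]].
have [tB [Z Zs [rB sBZ]]] := hs' B Bs.
have rB80 : X * q ^+ 80 <= rho B by rewrite rB; apply: rs.
have [b bB] : exists b, b \in B.
  by apply: (@rho_gt0_ex R); apply: lt_le_trans rB80; rewrite mulr_gt0 //; lra.
have cB0 : (0 < #|B'|)%N by move: cB; rewrite (cardD1 b) bB; clear; lia.
have rB' : X * q ^+ 80 <= 2%:R * rho B'.
  apply: le_trans rB80 _; have c0 : 0 < #|B'|%:R :> R by rewrite ltr0n.
  rewrite -(ler_pM2r c0); apply: le_trans (tB _ sB) _; rewrite mulrAC mulrC ler_wpM2r ?rho_ge0 //.
  by rewrite -natrM ler_nat.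
have Ek2 : 2%:R ^+ (2 * kp) = q ^+ 2 :> R by rewrite mulnC exprM.
apply: (has_blocksS (subsetT B')); rewrite /state Ek2.
have -> : r / q ^+ 2 ^+ 80 = X by rewrite -exprM.
have N2q : (2 ^ (2 * kp))%:R = q ^+ 2 by rewrite natrX Ek2.
have d2 : 0 < (16%:R * q ^+ 2)^-1 by rewrite invr_gt0 mulr_gt0.
have q80 : q ^+ 80 = q ^+ 76 * q ^+ 4 by rewrite -exprD.
have q76 : q ^+ 76 = q ^+ 64 * q ^+ 12 by rewrite -exprD.
have q12 : 16%:R ^+ 12 <= q ^+ 12 by rewrite lerXn2r // nnegrE; lra.
have c128 : 128%:R <= 16%:R ^+ 12 :> R.
  have -> : 128%:R <= 16%:R ^+ 12 :> R = (128%:R <= 16%:R ^+ 2 * 16%:R ^+ 10 :> R) by rewrite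
    -exprD.
  have h1 : 1 <= 16%:R ^+ 10 :> R by rewrite exprn_ege1 // ler1n.
  have h2 : 128%:R <= 16%:R ^+ 2 :> R by rewrite -natrX; lra.
  nra.
have big : X * q ^+ 4 * 64%:R <= rho B'.
  have h1 : 128%:R <= q ^+ 76.
    have := qn1 64%N; rewrite q76; nra.
  have : X * q ^+ 4 * 128%:R <= X * q ^+ 80.
    rewrite q80 -mulrA ler_pM2l; last by lra.
    by rewrite mulrC ler_pM2r.
  lra.
have q2le4 := qle 2%N 4%N isT.
(* Either [B'] is dense enough to be cut directly, or some nonneighbourhood [A] retains a
   [1 / (64 * q ^ 4)] share and has few pure pieces, hence a large potential. *)
have [[v vB hv]|H] := EM (exists2 v, v \in B' & rho B' < 32%:R * q ^+ 4 * rho (B' :\: nb v));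
  last first.
  pose sg := rho B' / (2%:R * q ^+ 2).
  have p2 : 0 < 2%:R * q ^+ 2 by rewrite mulr_gt0.
  have Esg : rho B' = sg * (2%:R * q ^+ 2) by rewrite /sg divfK // gt_eqF.
  have hsg : X <= sg.
    rewrite ler_pdivlMr //; apply: le_trans big.
    by rewrite -mulrA ler_pM2l; lra.
  apply: (has_blocks_sigma hsg); apply: direct_partition.
  - exact: ltW.
  - exact: le_trans hsg.
  - by rewrite N2q Esg mulrC.
  move=> x xB; rewrite -(ler_pM2l d2) mulrA.
  have : 32%:R * q ^+ 4 * rho (B' :\: nb x) <= rho B' by rewrite leNgt; apply/negP => h;
    apply: H; exists x.
  rewrite Esg; have -> : q ^+ 4 = q ^+ 2 * q ^+ 2 by rewrite -exprD.
  move=> h; rewrite -mulrA ler_pM2l // mulrC ler_pdivlMr ?mulr_gt0 //.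
  by rewrite -(ler_pM2r p2); lra.
apply: (has_blocksS (nonnb_sub B' v)).
have pA := hB v vB; set A := nonnb B' v in pA *.
have rA : X * q ^+ 76 <= 128%:R * rho A.
  have h1 := rho_nonnb1 R B' v; rewrite -/A in h1.
  have h2 : 64%:R * q ^+ 4 <= rho B'.
    apply: le_trans big; have := qn0 4%N; nra.
  have h3 : rho B' <= 64%:R * q ^+ 4 * rho A.
    have := qn0 4%N; nra.
  rewrite -(ler_pM2r (qn0 4%N)) -mulrA -q80; lra.
rewrite -Ek2; apply: (potential_blocks noP5 up) => //.
- rewrite Ek2 [X in _ <= X]mulrC ler_pdivlMr ?mulr_gt0 // Eu [q ^+ 3]exprS.
  by rewrite ler_pM2l // ler_pM2r.
- rewrite leqnn andbT -{1}[2%N]expn1 leq_exp2l // muln_gt0 /=; exact: leq_trans k4.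
rewrite /phi.
have uA : u <= rho A.
  have : u <= X by rewrite Eu ler_peMr // ltW.
  have : 128%:R * X <= X * q ^+ 76.
    rewrite mulrC ler_pM2l; last by lra.
    have := qn1 64%N; rewrite q76; nra.
  lra.
have p0 := pnum_gt0 uA.
have p0' : 0 < (pnum u A)%:R ^+ 14 :> R by rewrite exprn_gt0 // ltr0n.
rewrite ler_pdivlMr //.
have pq : (pnum u A)%:R <= 4%:R * q ^+ 2.
  by rewrite -kq -natrX -natrM ler_nat ltnW.
have pq14 : (pnum u A)%:R ^+ 14 <= (4%:R * q ^+ 2) ^+ 14 by rewrite lerXn2r ?nnegrE ?mulr_ge0
  ?exprn_ge0 //; lra.
have -> : 2%:R ^+ (2 * (2 * kp) + 5) = 32%:R * q ^+ 4 :> R.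
  rewrite addnC exprD; congr (_ * _); first by rewrite -natrX.
  by rewrite mulnA mulnC exprM.
rewrite N2q.
set W := X * _ * _.
have Xp : 0 <= X by apply: le_trans X1.
have W0 : 0 <= W.
  rewrite /W; apply: mulr_ge0; last by apply: exprn_ge0; apply: exprn_ge0; apply: ltW.
  by apply: mulr_ge0 => //; apply: mulr_ge0 => //; apply: exprn_ge0; apply: mulr_ge0 => //;
    apply: ltW.
apply: le_trans (ler_wpM2l W0 pq14) _.
rewrite -(ler_pM2l (ltr0n R 128)) //; apply: le_trans rA; rewrite q76.
(* This fixes the exponent [80]: the demand is [q ^ (8 + 28 + 28)], the constants are absorbed by
   [q ^ 12], and passing to [A] has cost [q ^ 4]. *)
have -> : 128%:R * (W * (4%:R * q ^+ 2) ^+ 14) = X * (q ^+ 64 * 16%:R ^+ 12).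
  rewrite /W; ring.
by rewrite ler_pM2l ?ler_pM2l //; lra.
Qed.

Lemma no_state kp : (4 <= kp)%N -> ~ state kp.
Proof.
move=> k4 st.
have H n : exists2 m, (n + 4 <= m)%N & state m.
  elim: n => [|n [m hm sm]]; first by exists kp.
  by exists (2 * m)%N; [lia|apply: state_step => //; lia].
have [n hn] : exists n : nat, r <= n%:R.
  by exists (Num.bound r); apply: ltW; apply: archi_boundP; exact: rho_ge0.
have [m hm sm] := H n.
have m0 : (0 < m)%N by lia.
have := state_large m0 sm; apply/negP; rewrite -leNgt.
apply: le_trans hn _; rewrite -!natrX ler_nat; apply: leq_trans (_ : 2 ^ m <= _)%N.
  by apply: leq_trans (ltnW (ltn_expl m (ltnSn 1))); lia.
by rewrite -{1}[(2 ^ m)%N]expn1 leq_pexp2l // expn_gt0.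
Qed.

End State.

(** * Tangles and anchors *)

Section Separation.
Variables (R : realType) (G : sgraph).
Implicit Types (A B C D E F I J K X Y Z S T U W Gam : {set G}) (k x y z v w t p : G).

Local Notation rho := (@rho R G).
Local Notation cn := (conn (@adj G)).

Hypothesis noP5 : no_path5 G.

Lemma mixed_two p X Y : cn X -> cn Y -> acpl X Y -> mixed p X -> mixed p Y -> False.
Proof.
move=> cX cY a mX mY.
have [x [x' [xX x'X px px' xx']]] := mixed_conn cX mX.
have [y [y' [yY y'Y py py' yy']]] := mixed_conn cY mY.
have n z z' : z \in X -> z' \in Y -> ~~ adj z z' by move=> zX zY;
  case/andP: (acplP _ _ a _ _ zX zY).
by apply: (@noP5 x' x p y y') => //; first [by rewrite adj_sym|exact: n].
Qed.

(** In the connected union of [K], [D], [D'] remove [D] and its neighbours and take the component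
    [C] containing [D']. A vertex [p] joining [C] to the rest is a neighbour of [D]; being complete
    to neither [D] nor [D'], it is mixed on [D] and on [C], against [mixed_two]. *)
Lemma separation D D' K d d' : cn D -> cn D' -> acpl D D' -> cn K -> d \in D -> d \in K ->
  d' \in D' -> d' \in K ->
  (forall x, x \in K -> ~ cpl [set x] D /\ ~ cpl [set x] D') -> False.
Proof.
move=> cD cD' aDD cK0 dD dK d'D' d'K nV0.
pose K' := (K :|: D) :|: D'.
have cK : cn K'.
  apply: (conn_meet (z := d')) => //; last by rewrite inE d'K.
  exact: (conn_meet (z := d)).
have notcpl x X : x \in X -> ~ cpl [set x] X.
  by move=> xX /cplP/(_ x x); rewrite inE eqxx adj_irrefl => /(_ isT xX).
have nV x : x \in K' -> ~ cpl [set x] D /\ ~ cpl [set x] D'.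
  rewrite /K' !inE => /orP[/orP[/nV0//|xD]|xD']; split; try exact: notcpl.
  - move/cplP=> /(_ x d'); rewrite inE => /(_ (eqxx _) d'D') h.
    by case/andP: (acplP _ _ aDD x d' xD d'D') => _; rewrite h.
  - move/cplP=> /(_ x d); rewrite inE => /(_ (eqxx _) dD) h.
    by case/andP: (acplP _ _ aDD d x dD xD') => _; rewrite adj_sym h.
pose N1 := [set x in K' :\: D | [exists y in D, adj x y]].
have sD'K : D' \subset (K' :\: D) :\: N1.
  apply/subsetP => x xD'.
  have h y : y \in D -> nadj y x by move=> yD; apply: (acplP _ _ aDD).
  have xD : x \notin D by apply/negP => /h; rewrite /nadj eqxx.
  rewrite !inE xD xD' !orbT /= andbT; apply/exists_inP => -[y /h/andP[_ n]].
  by rewrite adj_sym (negbTE n).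
have [C [sC d'C cC aC]] := component (subsetP sD'K _ d'D').
have sDC : D' \subset C by apply: (conn_in_closed cD' sD'K aC d'D' d'C).
have aDC : acpl D C.
  apply/acplP => y x yD /(subsetP sC); rewrite in_setD => /andP[xN1].
  rewrite in_setD => /andP[xD xK].
  have ne : y != x by apply: contraNneq xD => <-.
  rewrite /nadj ne /=; apply: contra xN1 => yx; rewrite inE in_setD xD xK /=.
  by apply/exists_inP; exists y; rewrite // adj_sym.
have sCK : C \subset K' by apply/subsetP => x /(subsetP sC); rewrite !in_setD => /and3P[].
have dKC : d \in K' :\: C.
  rewrite in_setD /K' !in_setU dK /= andbT; apply/negP => dC.
  by have := acplP _ _ aDC d d dD dC; rewrite /nadj eqxx.
have [c [p [cC' pKC cp]]] := conn_to_complement cK sCK d'C dKC.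
case/setDP: pKC => pK pC.
have pD : p \notin D.
  by apply/negP => pD; case/andP: (acplP _ _ aDC p c pD cC') => _; rewrite adj_sym cp.
have pN1 : p \in N1.
  apply: contraT => n; have := acplP _ _ aC c p cC'.
  by rewrite !in_setD pC n pD pK /nadj cp andbF => /(_ isT).
have [nD nD'] := nV p pK.
have mix X x : x \in X -> adj p x -> ~ cpl [set p] X -> mixed p X.
  move=> xX px n; apply/mixedP; split; first by exists x.
  apply: contrapT => h; apply: n; apply/cplP => a b /set1P-> bX.
  by apply: contraT => nb; case: h; exists b.
have mD : mixed p D.
  by move: pN1; rewrite inE => /andP[_ /exists_inP[y yD py]]; apply: (mix D y).
have mC : mixed p C.
  apply: (mix C c) => //; first by rewrite adj_sym.
  by move=> h; apply: nD'; apply: cplW h.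
exact: mixed_two cD cC aDC mD mC.
Qed.

Definition bdry U Gam := [set x in U :\: Gam | [exists y in Gam, adj x y]].

Lemma bdryP U Gam x : reflect [/\ x \in U, x \notin Gam & exists2 y,
  y \in Gam & adj x y] (x \in bdry U Gam).
Proof.
apply: (iffP idP); first by rewrite !inE => /andP[/andP[-> ->] /exists_inP].
by case=> xU xG h; rewrite !inE xU xG /=; apply/exists_inP.
Qed.

Definition anchor U (a : R) Gam A := [/\ cn A, A \subset U, a <= rho A & acpl A Gam].

Definition no_two U (c : R) := forall D D', cn D -> cn D' -> D \subset U -> D' \subset U ->
  acpl D D' -> c <= rho D -> c <= rho D' -> False.

(** Take a smallest admissible set [Gam]. If it contains two anticomplete sets of Hall ratio [a],
    one of them becomes an anchor for a smaller set [Gs]; since [Gs] is not admissible, its boundary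
    must be large. *)
Lemma refine_tangle U (a v beta : R) : cn U -> 0 < a -> 0 < beta -> 4%:R * v <= beta ->
  a <= rho U - 2%:R * beta ->
  (forall X Y, X \subset U -> Y \subset U -> cpl X Y -> cn Y -> a <= rho Y -> rho X <= v) ->
  no_two U (rho U - 2%:R * beta) ->
  (exists U', [/\ cn U', U' \subset U, rho U - beta <= rho U' & no_two U' a]) \/
  (exists Gam T, [/\ cn Gam, Gam \subset U, T \subset U, beta / 2%:R <= rho T &
     forall t, t \in T -> mixed t Gam /\ exists2 A, anchor U a Gam A & cpl [set t] A]).
Proof.
move=> cU a0 b0 vb ab hv tangle.
have U0 : 0 <= rho U by exact: rho_ge0.
pose okb Gam := forall t, t \in bdry U Gam ->
  cpl [set t] Gam \/ exists2 A, anchor U a Gam A & cpl [set t] A.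
pose adm Gam := [/\ cn Gam, Gam \subset U, rho U - beta <= rho Gam,
  rho (bdry U Gam) <= beta & okb Gam].
have bU : bdry U U = set0 by apply/setP => x; rewrite !inE andNb.
have [|Gam [cG sG rG bG oG] mG] := @ex_min_set _ adm.
  exists U; split=> //; [lra|by rewrite bU rho0 ltW|by move=> t; rewrite bU inE].
have [h|h] := EM (no_two Gam a); first by left; exists Gam.
have [D [D' [cD cD' [sD sD'] aDD [rD rD']]]] : exists D D', [/\ cn D, cn D',
  D \subset Gam /\ D' \subset Gam,
    acpl D D' & a <= rho D /\ a <= rho D'].
  apply: contrapT => H; apply: h => D D' cD cD' sD sD' aDD rD rD'.
  by apply: H; exists D, D'.
right; clear h.
pose V X := [set x in Gam | cpl [set x] X].
have rV X : cn X -> X \subset Gam -> a <= rho X -> rho (V X) <= v.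
  move=> cX sX rX; apply: (hv _ X) => //; try exact: subset_trans sG.
    by apply: subset_trans sG; apply/subsetP => x; rewrite inE => /andP[].
  by apply/cplP => x y; rewrite inE => /andP[_ /cplP h'] yX; apply: h'; rewrite ?inE.
have [G' [sG' cG' aG' rG']] := component_rho R (Gam :\: (V D :|: V D')).
have rG2 : rho U - 2%:R * beta + beta / 2%:R <= rho G'.
  rewrite rG'; have := rhoD R Gam (V D :|: V D'); have := rhoU R (V D) (V D').
  have := rV D cD sD rD; have := rV D' cD' sD' rD'; lra.
have G'Gam : G' \subset Gam by apply: subset_trans sG' (subsetDl _ _).
have [d dD] : exists d, d \in D by apply: (@rho_gt0_ex R); lra.
have [d' dD'] : exists d, d \in D' by apply: (@rho_gt0_ex R); lra.
(* No vertex of [G'] is complete to [D] or [D'], so [separation] with [K = G'] forbids meeting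
   both. *)
have dis : (forall x, x \in G' -> x \notin D) \/ (forall x, x \in G' -> x \notin D').
  apply: contrapT => /not_orP[/existsNP[x /not_implyP[xG /negP]]]; rewrite negbK => xD.
  move=> /existsNP[y /not_implyP[yG /negP]]; rewrite negbK => yD.
  apply: (@separation D D' G' x y) => // z /(subsetP sG'); rewrite in_setD in_setU negb_or !inE.
  by move=> /andP[/andP[+ +] zG]; rewrite zG /= => /negP ? /negP.
wlog {dis} dG' : D D' d d' cD cD' sD sD' aDD rD rD' dD dD' sG' aG' rG' {rV} / forall x,
  x \in G' -> x \notin D.
  move=> W; case: dis => dis; first exact: (W D D' d d').
  apply: (W D' D d' d cD' cD sD' sD _ rD' rD dD' dD _ _ _ dis); first by rewrite acplC.
  - by rewrite setUC.
  - by rewrite setUC.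
  - by rewrite setUC.
have aG'D : acpl G' D.
  apply/acplP => x y xG yD; apply: (acplP _ _ aG') => //.
  have yG' : y \notin G' by apply/negP => /dG'; rewrite yD.
  rewrite in_setD yG' in_setD (subsetP sD) // andbT in_setU negb_or !inE (subsetP sD) //=.
  apply/andP; split; apply/cplP => h.
    by have := h y y; rewrite inE eqxx adj_irrefl => /(_ isT yD).
  have := h y d'; rewrite inE eqxx => /(_ isT dD') hyd.
  by case/andP: (acplP _ _ aDD y d' yD dD') => _; rewrite hyd.
have [Gs [[cGs sGs aGs] sG's] mGs] := @ex_maximal_sup _ (fun X => [/\ cn X,
  X \subset Gam & acpl X D]) G' (And3 cG' G'Gam aG'D).
have rGs : rho U - 2%:R * beta + beta / 2%:R <= rho Gs by apply: le_trans rG2 _; apply: rhoS.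
have sGsU : Gs \subset U by apply: subset_trans sG.
have [g gGs] : exists g, g \in Gs by apply: (@rho_gt0_ex R); lra.
(* By maximality of [Gs] such an [x] also has a neighbour in [D], and [mixed_two] forbids it to be
   mixed on both sets. *)
have nbGs x : x \in bdry Gam Gs -> cpl [set x] D \/ cpl [set x] Gs.
  move=> /bdryP[xG xGs [y yGs xy]].
  have [z zD xz] : exists2 z, z \in D & adj x z.
    apply: contrapT => nz.
    have E : Gs :|: [set x] = Gs.
      apply: mGs; last exact: subsetUl.
      split; first by apply: (conn_edge (@adj_sym G) (x := y) (y := x)) => //;
        rewrite ?inE // 1?adj_sym //; exact: conn_set1.
        by rewrite subUset sGs sub1set.
      apply/acplP => p q /setUP[pGs|/set1P->] qD; first exact: (acplP _ _ aGs).
      have nxq : ~~ adj x q by apply/negP => h'; apply: nz; exists q.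
      rewrite /nadj nxq andbT; apply: contraTneq xy => ->.
      by rewrite adj_sym; case/andP: (acplP _ _ aGs y q yGs qD).
    by move: xGs; rewrite -E !inE eqxx orbT.
  apply: contrapT => /not_orP[n1 n2].
  have mix X w : w \in X -> adj x w -> ~ cpl [set x] X -> mixed x X.
    move=> wX px n; apply/mixedP; split; first by exists w.
    apply: contrapT => hh; apply: n; apply/cplP => p b /set1P-> bX.
    by apply: contraT => nb; case: hh; exists b.
  by apply: (@mixed_two x Gs D) => //; [exact: (mix Gs y)|exact: (mix D z)].
have oGs : okb Gs.
  move=> t /bdryP[tU tGs [y yGs ty]]; have [tG|tG] := boolP (t \in Gam).
    have [|h'|h'] := nbGs t; [|right|by left].
      by apply/bdryP; split=> //; exists y.
    by exists D => //; split=> //; [exact: subset_trans sG|rewrite acplC].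
  have [|h'|[A [cA sA rA aA] tA]] := oG t.
  - by apply/bdryP; split=> //; exists y => //; apply: (subsetP sGs).
  - by left; apply: cplW h'.
  by right; exists A => //; split=> //; apply: acplW aA.
have [hb|hb] := leP (rho (bdry U Gs)) beta.
  exfalso.
  have aGsr : acpl Gs ((U :\: bdry U Gs) :\: Gs).
    apply: acpl_split => p q pGs /setDP[/setDP[qU qn] qGs].
    apply: contra qn => pq; apply/bdryP; split=> //; exists p => //; by rewrite adj_sym.
  have [Q [sQ cQ aQ rQ]] := component_rho R (U :\: bdry U Gs).
  have rQ2 : rho U - beta <= rho Q by rewrite rQ; have := rhoD R U (bdry U Gs); lra.
  (* The initial bound on [Gs] is weaker by [beta / 2]. The tangle hypothesis restores it: the heavy
     component [Q] off the boundary cannot be anticomplete to [Gs], so it lies inside [Gs]. *)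
  have rGs2 : rho U - beta <= rho Gs.
    have [dQ|[x /setIP[xQ xGs]]] := set_0Vmem (Q :&: Gs); last first.
      by apply: le_trans rQ2 _; apply: rhoS; apply: conn_in_closed aGsr xQ xGs.
    exfalso; apply: (@tangle Gs Q) => //; [|  |lra|lra].
      by apply: subset_trans sQ (subsetDl _ _).
    apply: acplW (subxx Gs) _ aGsr; rewrite subsetD sQ -setI_eq0 dQ eqxx //.
  have : (#|Gam| <= #|Gs|)%N by apply: mG; split.
  rewrite leqNgt proper_card //; apply/properP; split=> //; exists d; first exact: (subsetP sD).
  by apply/negP => dGs; have := acplP _ _ aGs d d dGs dD; rewrite /nadj eqxx.
pose T := [set t in bdry U Gs | ~~ cpl [set t] Gs].
exists Gs, T; split=> //.
- by apply/subsetP => t; rewrite inE => /andP[/bdryP[]].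
- have h1 : rho [set t in bdry U Gs | cpl [set t] Gs] <= v.
    apply: (hv _ Gs) => //.
    + by apply/subsetP => t; rewrite inE => /andP[/bdryP[]].
    + by apply/cplP => x y; rewrite inE => /andP[_ /cplP h'] yX; apply: h'; rewrite ?inE.
    + lra.
  have : rho (bdry U Gs) <= rho T + rho [set t in bdry U Gs | cpl [set t] Gs].
    apply: rho_split; apply/subsetP => t tb; apply/setUP.
    by have [hc|hc] := boolP (cpl [set t] Gs); [right|left]; rewrite /T inE tb.
  lra.
move=> t; rewrite inE => /andP[tb nt]; split.
  have /bdryP[tU tGs [y yGs ty]] := tb.
  apply/mixedP; split; first by exists y.
  apply: contrapT => hh; case/negP: nt; apply/cplP => p b /set1P-> bX.
  by apply: contraT => nb; case: hh; exists b.
by have [|//] := oGs t tb; rewrite (negbTE nt).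
Qed.

End Separation.

(** * Comparable anchors and the descent of thresholds *)

Section Levels.
Variables (R : realType) (G : sgraph).
Implicit Types (A B C D E F I J K X Y Z S T U W Gam : {set G}) (k x y z w s t p : G).

Local Notation rho := (@rho R G).
Local Notation cn := (conn (@adj G)).
Local Notation r := (rho setT).

Hypothesis noP5 : no_path5 G.

(** By [mixed_two], [s] is anticomplete to [A] and [t] to [B], and some [a0] in [A] is nonadjacent
    to some [b0] in [B]. A common neighbour [g] in [Gam] gives the path [a0 t g s b0]; otherwise a
    neighbour [g] of [t] is mixed on the part of [Gam] and [s] that [t] misses, giving
    [a0 t g x y]. *)
Lemma anchored_comparable U Gam (a v : R) t s A B : cn Gam -> v < a ->
  (forall X Y, X \subset U -> Y \subset U -> cpl X Y -> cn Y -> a <= rho Y -> rho X <= v) ->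
  mixed t Gam -> mixed s Gam -> ~~ adj t s -> anchor U a Gam A -> anchor U a Gam B ->
  cpl [set t] A -> cpl [set s] B -> ~ cpl [set s] A -> ~ cpl [set t] B -> False.
Proof.
move=> cG va hv mt ms nts [cA sA rA aA] [cB sB rB aB] tA sB' nsA ntB.
have pure1 w E : cn E -> acpl E Gam -> mixed w Gam -> ~ cpl [set w] E -> forall e, e \in E ->
  ~~ adj w e.
  move=> cE aE mw nE e eE; apply/negP => we; apply: (mixed_two noP5 cE cG aE _ mw).
  apply/mixedP; split; first by exists e.
  apply: contrapT => hh; apply: nE; apply/cplP => p b /set1P-> bX.
  by apply: contraT => nb; case: hh; exists b.
have sA0 e : e \in A -> ~~ adj s e by apply: pure1.
have tB0 e : e \in B -> ~~ adj t e by apply: pure1.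
have tA1 e : e \in A -> adj t e by move=> eA; apply: (cplP _ _ tA); rewrite ?inE.
have sB1 e : e \in B -> adj s e by move=> eB; apply: (cplP _ _ sB'); rewrite ?inE.
have AG e z : e \in A -> z \in Gam -> ~~ adj e z by move=> eA zG;
  case/andP: (acplP _ _ aA _ _ eA zG).
have BG e z : e \in B -> z \in Gam -> ~~ adj e z by move=> eB zG;
  case/andP: (acplP _ _ aB _ _ eB zG).
have [a0 [b0 [aA0 bB0 nab]]] : exists a0 b0, [/\ a0 \in A, b0 \in B & ~~ adj a0 b0].
  apply: contrapT => H.
  have cAB : cpl A B.
    by apply/cplP => x y xA yB; apply: contraT => n; case: H; exists x, y.
  by have := hv A B sA sB cAB cB rB; lra.
have [[g [gG tg sg]]|H] := EM (exists g, [/\ g \in Gam, adj t g & adj s g]).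
  apply: (@noP5 a0 t g s b0) => //;
    [by rewrite adj_sym tA1|by rewrite adj_sym|exact: sB1|exact: AG| |exact: tB0|].
    by rewrite adj_sym sA0.
  by rewrite adj_sym BG.
case/mixedP: (ms) => -[y0 y0G sy0] _.
have sG : s \notin Gam.
  apply/negP => sG; have := sB1 b0 bB0; rewrite adj_sym; exact/negP/BG.
pose K0 := Gam :|: [set s].
have cK0 : cn K0.
  by apply: (conn_edge (@adj_sym G) (x := y0) (y := s)) => //; rewrite ?inE // 1?adj_sym //;
    exact: conn_set1.
have sK0 : s \in K0 :\: nb t by rewrite !inE eqxx orbT andbT.
have [K [sK sinK cK aK]] := component sK0.
case/mixedP: (mt) => -[g0 g0G tg0] _.
have g0K : g0 \in K0 :\: K.
  by rewrite in_setD in_setU g0G andbT; apply/negP => /(subsetP sK); rewrite !inE tg0.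
have sKK0 : K \subset K0 by apply: subset_trans sK (subsetDl _ _).
have [c [g [cK' gK cg]]] := conn_to_complement cK0 sKK0 sinK g0K.
case/setDP: gK => gK0 gK.
have tg : adj t g.
  apply: contraT => n; have := acplP _ _ aK c g cK'.
  by rewrite !in_setD gK gK0 in_nb n /nadj cg andbF => /(_ isT).
have gG : g \in Gam.
  move: gK0; rewrite !inE => /orP[//|/eqP E]; by rewrite E (negbTE nts) in tg.
have gs : ~~ adj g s.
  by apply/negP => gs; apply: H; exists g; rewrite adj_sym in gs.
have gc : adj g c by rewrite adj_sym.
have [x [y [xK yK gx gy xy]]] := conn_mixed cK cK' sinK gc gs.
have tK z : z \in K -> ~~ adj t z by move/(subsetP sK); rewrite !inE => /andP[].
have aK0 z : z \in K -> ~~ adj a0 z.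
  move/(subsetP sKK0); rewrite !inE => /orP[/(AG _ _ aA0)//|/eqP->].
  by rewrite adj_sym sA0.
apply: (@noP5 a0 t g x y) => //;
  [by rewrite adj_sym tA1|exact: AG|exact: aK0|exact: aK0|exact: tK|exact: tK].
Qed.

(** For nonadjacent [x], [y] with [y] not earlier in the order, comparability puts every anchor of
    [x] among those of [y]. The later nonneighbours of [x] are thus all complete to one anchor of
    [x], and have Hall ratio at most [v]. *)
Lemma anchored_blocks U Gam T (a v beta : R) kp : cn Gam -> T \subset U -> v < a -> 0 < beta ->
  (forall X Y, X \subset U -> Y \subset U -> cpl X Y -> cn Y -> a <= rho Y -> rho X <= v) ->
  (forall t, t \in T -> mixed t Gam /\ exists2 A, anchor U a Gam A & cpl [set t] A) ->
  beta / 2%:R <= rho T -> 64%:R * (2%:R ^+ kp) ^+ 2 * v <= beta ->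
  has_blocks ((16%:R * 2%:R ^+ kp)^-1) (beta / (4%:R * 2%:R ^+ kp)) T (2 ^ kp).
Proof.
move=> cG sT va b0 hv hT rT vb; set q : R := 2%:R ^+ kp in vb *.
have q1 : 1 <= q by rewrite exprn_ege1 // ler1n.
have kq : (2 ^ kp)%:R = q by rewrite natrX.
have v1 : 1 <= v.
  have [t tT] : exists t, t \in T by apply: (@rho_gt0_ex R); lra.
  have [_ [A [cA sA rA aA] tA]] := hT t tT.
  rewrite -(rho_set1 R t); apply: (hv _ A) => //; by rewrite sub1set (subsetP sT).
pose sg := beta / (4%:R * q).
have q40 : 0 < 4%:R * q by lra.
have Esg : beta = sg * (4%:R * q) by rewrite /sg divfK // gt_eqF.
have vsg : 16%:R * q * v <= sg.
  rewrite ler_pdivlMr //; apply: le_trans vb; rewrite expr2; lra.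
pose Is t := [set A : {set G} | `[< anchor U a Gam A >] && cpl [set t] A].
apply: (@ordered_partition R G (fun t => #|Is t|)).
- by rewrite invr_ge0; lra.
- by apply: le_trans vsg; nra.
- by rewrite kq -/sg; apply: le_trans rT; rewrite Esg; lra.
move=> x xT; have [mx [A hA xA]] := hT x xT.
apply: le_trans (_ : v <= _); last first.
  by rewrite mulrC ler_pdivlMr -/sg; lra.
case: (hA) => cA sA rA aA; apply: (hv _ A) => //.
  by apply/subsetP => y; rewrite inE => /andP[/(subsetP sT)].
apply/cplP => y z; rewrite inE => /and3P[yT hf nxy] zA.
suff : A \in Is y by rewrite inE => /andP[_ /cplP]; apply; rewrite ?inE.
have AIx : A \in Is x by rewrite inE xA andbT; apply/asboolP.
have [sub|/subsetPn[B BIx BIy]] := boolP (Is x \subset Is y); first exact: (subsetP sub).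
have sub' : Is y \subset Is x.
  apply/subsetP => C CIy; apply: contraT => CIx; exfalso.
  move: BIx BIy CIy CIx; rewrite !inE => /andP[/asboolP hB xB] + /andP[/asboolP hC yC].
  move/asboolP: (hB) => ->; move/asboolP: (hC) => -> /= /negP yB /negP xC.
  have [my _] := hT y yT.
  exact: (anchored_comparable cG va hv mx my nxy hB hC xB yC yB xC).
suff -> : Is y = Is x by [].
by apply/eqP; rewrite eqEcard sub'.
Qed.

Hypothesis noii : forall s : seq {set G}, (2 <= size s)%N -> pairwise (@cpl G) s ->
  (forall Y, Y \in s -> r <= (size s)%:R ^+ 400 * rho Y) -> False.
Hypothesis noi : forall X Y (y : R), cpl X Y -> 0 < y -> y <= 4%:R^-1 ->
  y ^+ 9 * r <= rho X -> (1 - 3%:R * y) * r <= rho Y -> False.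
Hypothesis r400 : 2%:R ^+ 400 < r.

Lemma r_ge1 : 1 <= r.
Proof. by apply: le_trans (ltW r400); rewrite exprn_ege1 // ler1n. Qed.

Lemma refine_step kp U (a v beta : R) : (4 <= kp)%N -> cn U -> 0 < a -> 0 <= v -> v < a ->
  0 < beta ->
  64%:R * (2%:R ^+ kp) ^+ 2 * v <= beta -> a <= rho U - 2%:R * beta ->
  r / (2%:R ^+ kp) ^+ 80 <= beta / (4%:R * 2%:R ^+ kp) ->
  (forall X Y, X \subset U -> Y \subset U -> cpl X Y -> cn Y -> a <= rho Y -> rho X <= v) ->
  no_two U (rho U - 2%:R * beta) ->
  exists U', [/\ cn U', U' \subset U, rho U - beta <= rho U' & no_two U' a].
Proof.
move=> k4 cU a0 v0 va b0 vb ab rb hv tg.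
have q1 : 1 <= (2%:R ^+ kp) ^+ 2 :> R by rewrite -exprM exprn_ege1 // ler1n.
have vb4 : 4%:R * v <= beta by apply: le_trans vb; nra.
have [//|[Gam [T [cG sG sT rT hT]]]] := refine_tangle noP5 cU a0 b0 vb4 ab hv tg.
exfalso; apply: (no_state noP5 noii r_ge1 k4).
apply: (has_blocksS (subsetT T)); apply: (has_blocks_sigma rb).
exact: anchored_blocks cG sT va b0 hv hT rT vb.
Qed.

Lemma pair_small X Y : cpl X Y -> r <= 2%:R ^+ 400 * rho X -> r <= 2%:R ^+ 400 * rho Y -> False.
Proof.
move=> cXY rX rY; apply: (@noii [:: X; Y]) => //=; first by rewrite cXY.
by move=> Z; rewrite !inE => /orP[]/eqP->.
Qed.

(** At threshold [u] complete pairs are excluded by outcome (ii) with two blocks, and anticomplete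
    pairs by hypothesis. So [pnum u U = 1], the potential is the Hall ratio, and [potential_blocks]
    yields a state. *)
Lemma no_leaf U : cn U -> r <= 2%:R * rho U -> no_two U (r / (2%:R ^+ 4) ^+ 82) -> False.
Proof.
move=> cU rU nt; have r4 := r400.
set q : R := 2%:R ^+ 4 in nt.
have q16 : q = 16%:R by rewrite /q -natrX.
have Eq400 : 2%:R ^+ 400 = q ^+ 100 :> R by rewrite /q -exprM.
rewrite Eq400 in r4.
have q0 : 0 < q by rewrite q16.
have q1 : 1 <= q by rewrite q16 ler1n.
have qn0 n : 0 < q ^+ n by rewrite exprn_gt0.
have qn1 n : 1 <= q ^+ n by rewrite exprn_ege1.
have qle m n : (m <= n)%N -> q ^+ m <= q ^+ n by move=> h; rewrite ler_weXn2l.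
pose b := r / q ^+ 100.
have Er : r = b * q ^+ 100 by rewrite /b divfK // gt_eqF.
have b1 : 1 < b by rewrite ltr_pdivlMr // mul1r.
have b0 : 0 < b by lra.
pose u := r / q ^+ 82.
have Eu : u = b * q ^+ 18.
  by rewrite /u Er; have -> : q ^+ 100 = q ^+ 18 * q ^+ 82 by [rewrite -exprD];
    rewrite mulrA mulfK // gt_eqF.
have Es : r / q ^+ 80 = b * q ^+ 20.
  by rewrite Er; have -> : q ^+ 100 = q ^+ 20 * q ^+ 80 by [rewrite -exprD];
    rewrite mulrA mulfK // gt_eqF.
have u0 : 0 < u by rewrite Eu mulr_gt0.
have bu : b <= u by rewrite Eu ler_peMr // ltW.
have rb X : u <= rho X -> r <= 2%:R ^+ 400 * rho X.
  by move=> h; rewrite Eq400 {1}Er mulrC ler_pM2l //; lra.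
have p1 : (pnum u U <= 1)%N.
  have [P /pfamP[h1 h2] ->] := pnum_wit u U; rewrite leqNgt;
    apply/negP => /card_gt1P[X [Y [XP YP nXY]]].
  have [[sX rX] [sY rY]] := (h1 X XP, h1 Y YP).
  case/orP: (h2 X Y XP YP nXY) => pXY; first by apply: (pair_small pXY); apply: rb.
  have [C [sC cC _ rC]] := component_rho R X; have [C' [sC' cC' _ rC']] := component_rho R Y.
  apply: (nt C C') => //; try by rewrite ?rC ?rC'.
  - exact: subset_trans sX.
  - exact: subset_trans sY.
  - exact: acplW pXY.
apply: (no_state noP5 noii r_ge1 (leqnn 4)).
apply: (has_blocksS (subsetT U)).
have uU : u <= rho U.
  have : 2%:R * u <= r.
    rewrite Eu Er mulrCA ler_pM2l //.
    apply: le_trans (_ : q * q ^+ 18 <= _); last by rewrite -exprS; apply: qle.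
    by rewrite ler_pM2r // q16; lra.
  lra.
have E1 : pnum u U = 1%N by apply/eqP; rewrite eqn_leq p1 pnum_gt0.
apply: (potential_blocks noP5 u0) => //.
- rewrite -/q Es Eu.
  have -> : q ^+ 20 = q ^+ 18 * (q * q) by rewrite -expr2 -exprD.
  rewrite [X in _ <= X]mulrC ler_pdivlMr; last by rewrite mulr_gt0 // ltr0n.
  by rewrite -q16 -mulrA.
- by rewrite -/q Es mulr_ege1 // ltW.
rewrite /phi E1 expr1n divr1 -/q Es.
have -> : (2 ^ 4)%:R = q :> R by rewrite q16.
have -> : 2%:R ^+ (2 * 4 + 5) = 2%:R * q ^+ 3 :> R by rewrite -[(2 * 4 + 5)%N]/(1 + 4 * 3)%N
  exprD exprM expr1.
have h1 : 2%:R * (b * q ^+ 20 * (8%:R * (2%:R * q ^+ 3) ^+ 2) * q ^+ 14) <= r.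
  have -> : 2%:R * (b * q ^+ 20 * (8%:R * (2%:R * q ^+ 3) ^+ 2) * q ^+ 14) = b * (64%:R * q ^+
    40) by ring.
  rewrite Er ler_pM2l //; apply: le_trans (_ : q ^+ 2 * q ^+ 40 <= _); last by rewrite -exprD;
    apply: qle.
  by rewrite ler_pM2r // q16 -natrX; lra.
lra.
Qed.

Definition level_exp l := (4 * 8 ^ l)%N.

(** Each application of [refine_step] replaces [q] by its eighth root, weakening the size bound on
    [U] but sharpening the tangle condition; level [0] descends to [no_leaf]. *)
Lemma no_level l U : cn U ->
  (1 - ((2%:R ^+ level_exp l) ^+ 32)^-1) * r <= rho U ->
  no_two U (rho U - 2%:R * (((2%:R ^+ level_exp l) ^+ 32)^-1 * r)) -> False.
Proof.
have r4 := r400; have r1 := r_ge1.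
elim: l U => [|l IH] U cU rU nt.
  rewrite /level_exp expn0 muln1 in rU nt; set q : R := 2%:R ^+ 4 in rU nt.
  have q16 : q = 16%:R by rewrite /q -natrX.
  have Eq400 : 2%:R ^+ 400 = q ^+ 100 :> R by rewrite /q -exprM.
  rewrite Eq400 in r4.
  have q0 : 0 < q by rewrite q16.
  have q1 : 1 <= q by rewrite q16 ler1n.
  have qn0 n : 0 < q ^+ n by rewrite exprn_gt0.
  have qn1 n : 1 <= q ^+ n by rewrite exprn_ege1.
  have qle m n : (m <= n)%N -> q ^+ m <= q ^+ n by move=> h; rewrite ler_weXn2l.
  (* Here [b = r / 2 ^ 400], the value of [v] at this level: two complete sets of Hall ratio at
     least [b] would give outcome (ii) with [k = 2]. *)
  pose b := r / q ^+ 100.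
  have Er : r = b * q ^+ 100 by rewrite /b divfK // gt_eqF.
  have b1 : 1 < b by rewrite ltr_pdivlMr // mul1r.
  have b0 : 0 < b by lra.
  have Ea n m : (n + m = 100)%N -> r / q ^+ m = b * q ^+ n.
    by move=> nm; rewrite Er -nm exprD mulrA mulfK // gt_eqF.
  have Ebeta : (q ^+ 32)^-1 * r = b * q ^+ 68 by rewrite mulrC (Ea 68%N).
  rewrite mulrBl mul1r Ebeta in rU; rewrite Ebeta in nt.
  have E18 := Ea 18%N 82%N erefl.
  have step n m : (n < m)%N -> 16%:R * (b * q ^+ n) <= b * q ^+ m.
    move=> h; rewrite mulrCA ler_pM2l // -q16 -exprS; exact: qle.
  have s1 := step 18%N 68%N isT; have s2 := step 68%N 100%N isT; rewrite -Er in s2.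
  have bp68 : 0 < b * q ^+ 68 by rewrite mulr_gt0.
  have bp18 : 0 < b * q ^+ 18 by rewrite mulr_gt0.
  have s0 := step 0%N 18%N isT; rewrite expr0 mulr1 in s0.
  have [|||||||||||U' [cU' sU' rU' nt']] := @refine_step 4 U (b * q ^+ 18) b (b * q ^+ 68) => //.
  - exact: ltW.
  - lra.
  - rewrite -/q mulrC ler_pM2l //; apply: le_trans (_ : q ^+ 2 * q ^+ 2 <= _);
      last by rewrite -exprD; apply: qle.
    by rewrite ler_pM2r // q16 -natrX; lra.
  - lra.
  - rewrite -/q (Ea 20%N) // ler_pdivlMr ?mulr_gt0 // -mulrA ler_pM2l // mulrCA -exprSr.
    apply: le_trans (_ : q * q ^+ 21 <= _); last by rewrite -exprS; apply: qle.
    by rewrite ler_pM2r // q16; lra.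
  - move=> X Y _ _ cXY _ rY; rewrite leNgt; apply/negP => rX; apply: (pair_small cXY).
      by rewrite Eq400 {1}Er mulrC ler_pM2l // ltW.
    by rewrite Eq400 {1}Er mulrC ler_pM2l //; lra.
  by apply: (no_leaf cU') => //; rewrite ?E18 //; lra.
set q : R := 2%:R ^+ level_exp l.+1 in rU nt.
set q' : R := 2%:R ^+ level_exp l in IH.
have Eq : q = q' ^+ 8 by rewrite /q /q' -exprM /level_exp expnS; congr (_ ^+ _); lia.
have l4 : (4 <= level_exp l.+1)%N by rewrite /level_exp leq_pmulr // expn_gt0.
have q16 : 16%:R <= q.
  have -> : 16%:R = 2%:R ^+ 4 :> R by rewrite -natrX.
  by rewrite ler_weXn2l // ler1n.
have q0 : 0 < q by lra.
have q1 : 1 <= q by lra.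
have qn0 n : 0 < q ^+ n by rewrite exprn_gt0.
have qle m n : (m <= n)%N -> q ^+ m <= q ^+ n by move=> h; rewrite ler_weXn2l.
(* Failure of outcome (i) with [y = w] supplies [a = (1 - 3w) r] and [v = w ^ 9 r], while
   [beta = w ^ 8 r] is the current [q ^ -32 * r]. As [w = q' ^ -32], the result is exactly what the
   next level down requires. *)
pose w := (q ^+ 4)^-1.
have w0 : 0 < w by rewrite invr_gt0.
have wq4 : w * q ^+ 4 = 1 by rewrite mulVf // gt_eqF.
have w256 : 256%:R * w * q ^+ 2 <= 1.
  rewrite -wq4 -mulrA [_ * (w * _)]mulrCA ler_pM2l //.
  have -> : q ^+ 4 = q ^+ 2 * q ^+ 2 by rewrite -exprD.
  by rewrite ler_pM2r // expr2; nra.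
have w16 : 256%:R * w <= 1.
  apply: le_trans w256; rewrite ler_peMr //; first by lra.
  by rewrite exprn_ege1.
have Ew8 : (q ^+ 32)^-1 = w ^+ 8 by rewrite /w exprVn -(exprM q 4 8).
have w8 : w ^+ 8 <= w.
  rewrite -[X in _ <= X]expr1 ler_wiXn2l //; lra.
have w80 : 0 < w ^+ 8 by rewrite exprn_gt0.
have w8s : 256%:R * w ^+ 8 <= w.
  have : w ^+ 8 <= w ^+ 2 by rewrite ler_wiXn2l //; lra.
  rewrite expr2; nra.
rewrite Ew8 in rU nt.
have w9 : w ^+ 9 <= w ^+ 8 by rewrite ler_wiXn2l //; lra.
have w90 : 0 < w ^+ 9 by rewrite exprn_gt0.
have r0 : 0 < r by lra.
have h1 : w * r <= r / 256%:R by nra.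
have h2 : 256%:R * (w ^+ 8 * r) <= w * r by nra.
have h3 : 0 < w ^+ 8 * r by rewrite mulr_gt0.
have [|||||||||||U' [cU' sU' rU' nt']] := @refine_step (level_exp l.+1) U ((1 - 3%:R * w) * r) (w
  ^+ 9 * r) (w ^+ 8 * r) => //.
- rewrite mulr_gt0 //; lra.
- by rewrite mulr_ge0 // ltW.
- rewrite ltr_pM2r //; lra.
- rewrite -/q mulrA ler_pM2r //; have -> : w ^+ 9 = w * w ^+ 8 by rewrite -exprS.
  rewrite mulrA ler_piMl //; first exact: ltW.
  have : 0 < w * q ^+ 2 by rewrite mulr_gt0.
  lra.
- by lra.
- rewrite -/q ler_pdivlMr ?mulr_gt0 // -mulrA [w ^+ 8 * r]mulrC ler_pM2l //.
  rewrite -Ew8 mulrC ler_pdivrMr //.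
  have -> : (q ^+ 32)^-1 * q ^+ 80 = q ^+ 48.
    by have -> : q ^+ 80 = q ^+ 32 * q ^+ 48 by [rewrite -exprD]; rewrite mulKf // gt_eqF.
  apply: le_trans (_ : q ^+ 2 <= _); last exact: qle.
  by rewrite expr2 ler_pM2r //; lra.
- move=> X Y _ _ cXY _ rY; rewrite leNgt; apply/negP => rX.
  apply: (noi cXY w0 _ (ltW rX) rY); lra.
have Ew' : (q' ^+ 32)^-1 = w.
  by rewrite /w Eq -exprM.
apply: (IH U' cU'); rewrite Ew'; first by lra.
move=> D D' cD cD' sD sD' aD rD rD'; apply: (nt' D D') => //; lra.
Qed.

Lemma no_counterexample : False.
Proof.
have r4 := r400; have r1 := r_ge1.
have [U [_ cU _ rU]] := component_rho R [set: G].
have [n hn] : exists n : nat, r <= n%:R.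
  by exists (Num.bound r); apply: ltW; apply: archi_boundP; exact: rho_ge0.
apply: (@no_level n U cU).
- rewrite rU ler_piMl; [|lra|by rewrite lerBlDr lerDl invr_ge0 !exprn_ge0].
  done.
set q : R := 2%:R ^+ level_exp n.
have l4 : (4 <= level_exp n)%N by rewrite /level_exp leq_pmulr // expn_gt0.
have q16 : 16%:R <= q.
  have -> : 16%:R = 2%:R ^+ 4 :> R by rewrite -natrX.
  by rewrite ler_weXn2l // ler1n.
have q0 : 0 < q by lra.
pose y := (q ^+ 32)^-1; rewrite -/y rU.
have y0 : 0 < y by rewrite invr_gt0 exprn_gt0.
(* The starting level is so high that a single vertex already qualifies as [X] in outcome (i); hence
   no vertex is complete to a set of almost full Hall ratio, and [separation] applies. *)
have yr : y * r < 1.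
  rewrite mulrC ltr_pdivrMr ?exprn_gt0 // mul1r; apply: le_lt_trans hn _.
  rewrite /q -!natrX ltr_nat; apply: leq_trans (ltn_expl n (ltnSn 1)) _.
  rewrite -expnM leq_exp2l // /level_exp; apply: leq_trans (_ : 8 ^ n <= _)%N; last by lia.
  by apply: ltnW; apply: ltn_expl.
have y16 : 16%:R * y <= 1.
  have : q <= q ^+ 32 by rewrite -[X in X <= _]expr1 ler_weXn2l //; lra.
  rewrite mulrC ler_pdivrMl ?exprn_gt0 // mulr1; lra.
have yr0 : 0 < y * r by rewrite mulr_gt0 //; lra.
have nocpl D x : (1 - 3%:R * y) * r <= rho D -> ~ cpl [set x] D.
  move=> rD cD; apply: (noi cD y0 _ _ rD); first by lra.
  rewrite rho_set1 exprSr -mulrA; apply: mulr_ile1;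
    [by rewrite exprn_ge0 // ltW|exact: ltW| |exact: ltW].
  by rewrite exprn_ile1 //; lra.
move=> D D' cD cD' sD sD' aD rD rD'.
have [d dD] : exists d, d \in D by apply: (@rho_gt0_ex R); lra.
have [d' dD'] : exists d, d \in D' by apply: (@rho_gt0_ex R); lra.
apply: (separation noP5 cD cD' aD cU dD (subsetP sD _ dD) dD' (subsetP sD' _ dD')).
by move=> x _; split; apply: nocpl; lra.
Qed.

End Levels.

(** * The theorem *)

Lemma P5_free_no_path (G : sgraph) : P5_free G ->
  forall a b c d e : G, adj a b -> adj b c -> adj c d -> adj d e ->
  ~~ adj a c -> ~~ adj a d -> ~~ adj a e -> ~~ adj b d -> ~~ adj b e -> ~~ adj c e -> False.
Proof.
move=> free a b c d e ab bc cd de /negbTE ac /negbTE ad /negbTE ae /negbTE bd /negbTE be /negbTE ce.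
pose l := [:: a; b; c; d; e].
pose S := [set x in l].
have mem (i : 'I_5) : nth a l i \in S by rewrite inE mem_nth.
pose f (i : path_graph 5) : induced S := exist _ (nth a l i) (mem i).
have irr (x : G) : adj x x = false by exact: adj_irrefl.
have [ba cb [dc ed]] : [/\ adj b a, adj c b & adj d c /\ adj e d].
  by rewrite [adj b a]adj_sym [adj c b]adj_sym [adj d c]adj_sym [adj e d]adj_sym.
have [ca da ea] : [/\ adj c a = false, adj d a = false & adj e a = false].
  by rewrite [adj c a]adj_sym [adj d a]adj_sym [adj e a]adj_sym.
have [db eb ec] : [/\ adj d b = false, adj e b = false & adj e c = false].
  by rewrite [adj d b]adj_sym [adj e b]adj_sym [adj e c]adj_sym.
apply: (free S); exists f.
  have ne (x y z : G) : adj x z -> adj y z = false -> (x == y) = false.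
    by move=> h h'; apply: contraTF h => /eqP->; rewrite h'.
  have ul : uniq l.
    rewrite /= !inE (ne a b b) // [a == c]eq_sym (ne c a d) // [a == d]eq_sym (ne d a c) //.
    rewrite (ne a e b) // (ne b c c) // (ne b d a) // (ne b e a) // (ne c d d) // (ne c e b) //.
    by rewrite (ne d e e).
  apply: inj_card_bij.
    move=> i j /(congr1 val) /= /eqP; rewrite nth_uniq ?ltn_ord // => /eqP h; exact: val_inj.
  rewrite card_sig card_ord -[5%N]/(size l); apply: leq_trans (card_size l).
  by apply: subset_leq_card; apply/subsetP => x; rewrite !inE.
by case=> [[|[|[|[|[|//]]]]] hi]; case=> [[|[|[|[|[|//]]]]] hj] /=.
Qed.

(** * Transfer between [rho] and the Hall ratio of induced subgraphs *)

Section Embedding.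
Variables (R : realType) (H G : sgraph) (g : H -> G).
Hypotheses (gI : injective g) (gA : forall x y, adj (g x) (g y) = adj x y).

Lemma stability_number_embed : stability_number H = al (g @: setT).
Proof.
apply/eqP; rewrite eqn_leq; apply/andP; split.
  apply/bigmax_leqP => A /stableP sA; rewrite -(card_imset _ gI); apply: al_ge.
    by apply: imsetS; apply: subsetT.
  by apply/stableP => _ _ /imsetP[x xA ->] /imsetP[y yA ->]; rewrite gA sA.
have [I sI [/stableP stI <-]] := al_witness (g @: setT).
have -> : #|I| = #|g @^-1: I|.
  rewrite -(card_imset _ gI); congr #|pred_of_set _|; apply/setP => y; apply/idP/imsetP.
    by move=> yI; have /imsetP[x _ E] := subsetP sI _ yI; exists x; rewrite // inE -E.
  by case=> x; rewrite inE => h ->.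
rewrite /stability_number (bigD1 (g @^-1: I)) /=; first exact: leq_maxl.
by apply/stableP => x y; rewrite !inE => xI yI; rewrite -gA stI.
Qed.

Lemma psi_embed : psi R H = #|g @: setT|%:R / (al (g @: setT))%:R.
Proof.
rewrite /psi stability_number_embed card_imset // cardsT; case: ifP => // /negbT.
by rewrite -eqn0Ngt => /eqP ->; rewrite mul0r.
Qed.

End Embedding.

Section Hall.
Variables (R : realType) (G : sgraph).

Lemma hall_ratio_le : hall_ratio R G <= rho R [set: G].
Proof.
rewrite /hall_ratio; elim/big_rec: _ => [|S x _ hx]; first exact: rho_ge0.
rewrite ge_max hx andbT (@psi_embed R (induced S) G val) //; last exact: val_inj.
set F := _ @: _.
have [->|[y yF]] := set_0Vmem F; first by rewrite cards0 mul0r rho_ge0.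
by rewrite ler_pdivrMr ?ltr0n ?(al_gt0 yF) // card_le_rho // subsetT.
Qed.

(** A subset of [X] is realized as an induced subgraph of [induced X], embedded in [G] by two
    projections. With [hall_ratio_le], this is the direction that carries lower bounds on [rho] to
    the outcomes. *)
Lemma hall_ratio_set_ge (X : {set G}) : rho R X <= hall_ratio_set R X.
Proof.
have ge0 : 0 <= hall_ratio_set R X.
  by rewrite /hall_ratio_set /hall_ratio; elim/big_rec: _ => // S x _ hx; rewrite le_max hx orbT.
apply: rho_le => // F sF; have [->|[y yF]] := set_0Vmem F; first by rewrite cards0 mulr_ge0.
rewrite -ler_pdivrMr ?ltr0n ?(al_gt0 yF) //.
pose S : {set induced X} := [set x | val x \in F].
pose g (x : induced S) : G := val (val x).
have E : g @: setT = F.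
  apply/setP => x; apply/imsetP/idP => [[z _ ->]|xF].
    by have := valP z; rewrite inE.
  have xX : x \in X by apply: (subsetP sF).
  have xS : (exist _ x xX : induced X) \in S by rewrite inE.
  by exists (exist _ (exist _ x xX : induced X) xS : induced S).
have := @psi_embed R (induced S) G g _ _; rewrite E => <- //.
  by rewrite /hall_ratio_set /hall_ratio (bigD1 S) //= le_max lexx.
by move=> a b h; apply: val_inj; apply: val_inj.
Qed.

Lemma clique_number_edge : (2 <= clique_number G)%N -> exists x y : G, adj x y.
Proof.
have [A /forall_inP cA ->] : {A : {set G} | clique A & clique_number G = #|A|}.
  apply: eq_bigmax_cond; apply/card_gt0P; exists set0; rewrite unfold_in.
  by apply/forall_inP => x; rewrite inE.
move=> /card_gt1P[x [y [xA yA nxy]]]; exists x, y.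
by move/forall_inP: (cA x xA) => /(_ y yA)/implyP; apply.
Qed.

End Hall.

Theorem theorem2p1 (R : realType) :
  exists d : R, 9%:R <= d /\
    forall G : sgraph, P5_free G -> (2 <= clique_number G)%N ->
      (exists (X Y : {set G}) (y : R),
         [/\ complete_pair X Y,
             0 < y,
             y <= 4%:R^-1,
             y ^+ 9 * hall_ratio R G <= hall_ratio_set R X &
             (1 - 3%:R * y) * hall_ratio R G <= hall_ratio_set R Y])
      \/
      (exists (k : nat) (B : 'I_k -> {set G}),
         [/\ (2 <= k)%N,
             complete_blockade B &
             forall i : 'I_k,
               k%:R `^ (- d) * hall_ratio R G <= hall_ratio_set R (B i)]).
Proof.
exists 400%:R; split; first by rewrite ler_nat.
move=> G free cl; apply: contrapT => /not_orP[Hi Hii].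
have noP5 := P5_free_no_path free.
have cplpair (X Y : {set G}) : cpl X Y -> complete_pair X Y.
  by move=> c; split; [exact: cpl_disj|apply/cplP].
have noi (X Y : {set G}) (y : R) : cpl X Y -> 0 < y -> y <= 4%:R^-1 ->
    y ^+ 9 * rho R [set: G] <= rho R X -> (1 - 3%:R * y) * rho R [set: G] <= rho R Y -> False.
  move=> cXY y0 y4 hX hY; apply: Hi; exists X, Y, y; split=> //; first exact: cplpair.
    apply: le_trans (hall_ratio_set_ge R X); apply: le_trans hX.
    by rewrite ler_wpM2l ?hall_ratio_le // exprn_ge0 // ltW.
  apply: le_trans (hall_ratio_set_ge R Y); apply: le_trans hY.
  by rewrite ler_wpM2l ?hall_ratio_le //; lra.
have noii (s : seq {set G}) : (2 <= size s)%N -> pairwise (@cpl G) s ->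
    (forall Y, Y \in s -> rho R [set: G] <= (size s)%:R ^+ 400 * rho R Y) -> False.
  move=> s2 ps hs; apply: Hii; exists (size s), (fun i => nth set0 s i).
  have cB (i j : 'I_(size s)) : i != j -> cpl (nth set0 s i) (nth set0 s j).
    move=> nij; have /(pairwiseP set0) pp := ps.
    have [lt|lt|E] := ltngtP i j; [by apply: pp; rewrite ?inE|by rewrite cplC; apply: pp;
      rewrite ?inE|].
    by case/eqP: nij; apply: val_inj.
  split=> //.
    by split=> i j nij; [exact: cpl_disj (cB _ _ nij)|apply: cplpair; apply: cB].
  move=> i; apply: le_trans (hall_ratio_set_ge R _).
  rewrite powRN powR_mulrn // mulrC ler_pdivrMr; last by rewrite exprn_gt0 // ltr0n; lia.
  by rewrite mulrC; apply: le_trans (hall_ratio_le R G) _; apply: hs; rewrite mem_nth.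
apply: (@no_counterexample R G noP5 noii noi).
(* If [r] is at most [2 ^ 400], the two ends of an edge already form a blockade for outcome (ii). *)
rewrite ltNge; apply/negP => hr; have [x [y xy]] := clique_number_edge cl.
apply: (noii [:: [set x]; [set y]]) => //=.
  by rewrite !andbT; apply/cplP => a b /set1P-> /set1P->.
by move=> Y; rewrite !inE => /orP[]/eqP->; rewrite rho_set1 mulr1.
Qed.
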